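(* Let $q$ be a prime power and let $F_1,\ldots,F_m\in\mathbb{F}_q[t][x]$, $r_i=\deg_xF_i>0$, be pairwise non-associate, irreducible, separable over $\mathbb{F}_q(t)$ and monic in $x$, and let $n\ge3$ with $n\ge\operatorname{sl}F_i$ for all $i$. Let $a_0,\ldots,a_n$ be free variables, $\mathbf{a}=(a_0,\ldots,a_n)$, $\mathbf{f}=\sum_{j=0}^na_jt^j$, $N_i=\deg_tF_i(t,\mathbf{f})=r_in$. Let $F_i=\prod_{j=1}^{\mu_i}\Gamma_{ij}$ with $\Gamma_{ij}\in\mathbb{F}_{q^{\mu_i}}[t][x]$ be the factorization of $F_i$ into absolutely irreducible factors, where $\mathbb{F}_{q^{\mu_i}}$ is the minimal field over which $F_i$ splits into absolutely irreducible factors; let $\mathbb{F}_{q^\mu}$ be the compositum of the $\mathbb{F}_{q^{\mu_i}}$ and $H_\mu=\mathrm{Gal}(\mathbb{F}_{q^\mu}/\mathbb{F}_q)\cong\mathbb{Z}/\mu$, acting on polynomials via their coefficients. Let $L$ be the splitting field of $\prod_iF_i(t,\mathbf{f})$ over $\mathbb{F}_q(\mathbf{a})$ and $G=\mathrm{Gal}(L/\mathbb{F}_q(\mathbf{a}))$, viewed as a permutation group on the roots of the $F_i(t,\mathbf{f})$. Let $\Omega_{ij}$ be the set of roots of $\Gamma_{ij}(t,\mathbf{f})$ in $L$ and, for $\sigma\in H_\mu$, $\Omega_{ij}^\sigma$ the set of roots of $\Gamma_{ij}^\sigma(t,\mathbf{f})$. Then $G$ consists exactly of those permutations $\pi$ of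 $\bigcup_{i,j}\Omega_{ij}$ for which there exists $\sigma\in H_\mu$ with $\pi(\Omega_{ij})=\Omega_{ij}^\sigma$ for all $i,j$.
   Context: For $P(t,x)=\sum_{j=0}^r c_j(t)x^j$ monic in $x$, $\operatorname{sl}P=\max_{1\le j\le r}\frac{\deg c_{r-j}(t)}{j}$ (with $\deg0=-\infty$). Separable over $\mathbb{F}_q(t)$ means $F_i\notin\mathbb{F}_q[t][x^p]$, $p=\mathrm{char}\,\mathbb{F}_q$. *)

(* Defs.v *)
From HB Require Import structures.
From mathcomp Require Import all_boot all_order all_algebra all_fingroup all_field.
Set Implicit Arguments. Unset Strict Implicit. Unset Printing Implicit Defensive.
Import Order.TTheory GRing.Theory.
Local Open Scope ring_scope.

Fixpoint mpolyR (R : idomainType) (k : nat) : idomainType :=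
  if k is k'.+1 then GRing.IntegralDomain.clone {poly mpolyR R k'} _ else R.

Fixpoint mconst (R : idomainType) (k : nat) : R -> mpolyR R k :=
  match k return R -> mpolyR R k with
  | 0 => fun c => c
  | k'.+1 => fun c => (mconst k' c)%:P
  end.

(* the variable X_j of mpolyR R k (0 if j >= k) *)
Fixpoint mvar (R : idomainType) (k : nat) (j : nat) : mpolyR R k :=
  match k return mpolyR R k with
  | 0 => 0
  | k'.+1 => if j == k' then 'X else (mvar R k' j)%:P
  end.

Definition ratfun (Fq : finFieldType) (n : nat) : fieldType :=
  GRing.Field.clone {fraction mpolyR Fq n.+1} _.

Definition cK (Fq : finFieldType) (n : nat) (c : Fq) : ratfun Fq n :=
  tofrac (mconst n.+1 c).

Definition avar (Fq : finFieldType) (n : nat) (j : nat) : ratfun Fq n :=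
  tofrac (mvar Fq n.+1 j).

Definition fgen (Fq : finFieldType) (n : nat) : {poly ratfun Fq n} :=
  \sum_(j < n.+1) avar Fq n j *: 'X^j.

(* For P(t,x) in F_q[t][x] (outer variable x, inner variable t):
   P(t, f) in F_q(a)[t]. *)
Definition subst_f (Fq : finFieldType) (n : nat) (P : {poly {poly Fq}})
  : {poly ratfun Fq n} :=
  (map_poly (map_poly (@cK Fq n)) P).[fgen Fq n].

Definition subst_fL (Fq : finFieldType) (n : nat) (L : fieldExtType (ratfun Fq n))
  (Fm : fieldType) (iota : Fm -> L) (P : {poly {poly Fm}}) : {poly L} :=
  (map_poly (map_poly iota) P).[map_poly (in_alg L) (fgen Fq n)].

(* P in R[t][x] is separable over R(t): P is not in R[t][x^p], p = char. *)
Definition sep_x (R : idomainType) (p : nat) (P : {poly {poly R}}) : Prop :=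
  exists j : nat, ~~ (p %| j)%N /\ P`_j != 0.

(* n >= sl P, where for P = sum_{j<=r} c_j(t) x^j monic of degree r,
   sl P = max_{1<=j<=r} deg c_{r-j} / j  (deg 0 = -infinity).
   Unfolded: for all 1<=j<=r with c_{r-j} <> 0, deg c_{r-j} <= n*j. *)
Definition sl_le (R : idomainType) (P : {poly {poly R}}) (n : nat) : Prop :=
  forall j : nat, (0 < j <= (size P).-1)%N ->
    let c := P`_((size P).-1 - j) in
    c != 0 -> ((size c).-1 <= n * j)%N.

Definition abs_irreducible (Fm : fieldType) (P : {poly {poly Fm}}) : Prop :=
  forall (E : fieldType) (e : {rmorphism Fm -> E}),
    irreducible_poly (map_poly (map_poly e) P).

Definition maps_onto (T : Type) (f : T -> T) (A B : T -> Prop) : Prop :=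
  (forall x, A x -> B (f x)) /\ (forall y, B y -> exists2 x, A x & f x = y).

(* Main.v *)
Require Import Defs.
From HB Require Import structures.
From mathcomp Require Import all_boot all_order all_algebra all_fingroup all_field.
From mathcomp Require Import cyclic ring.
From Stdlib Require Import Classical.
Set Implicit Arguments. Unset Strict Implicit. Unset Printing Implicit Defensive.
Import Order.TTheory GRing.Theory.
Local Open Scope ring_scope.

(* The geometric factors Gamma_ij define irreducible curves in the (t,x)-plane, and a
   root of Gamma_ij(t, f) is a point of intersection of the curve with the generic graph x = f(t).
   Let G' be the subgroup of G fixing F_{q^mu}. It suffices to show that G' contains every
   transposition of two roots of the same Gamma_ij(t, f): then G' is the full product of symmetric
   groups of the Omega_ij, and every sigma in H_mu lifts to G.
   - Specialising f to the graphs through a generic point (t1, x1) of the curve shows that the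
     stabiliser of one root is transitive on the others, because the remaining intersection
     points are generic on the curve over the field of definition of the pencil.
   - Specialising f to a graph tangent to the curve at (t1, x1) gives one double root and
     otherwise simple roots, over all curves together. Deforming this graph linearly in s gives
     a cover of the s-line that is simply branched at s = 0, whose inertia is a transposition.
   - Conjugating this transposition by a doubly transitive group gives all of them.
   Separability of the F_i enters through the derivative of (x - q) / W along the curve, which
   excludes double roots away from the base points of a pencil q + beta W. *)

(** * Extending specialisations to roots *)

(** The specialisations live on E[a_0] with E = F_m(a_1, ..., a_n). This ring is principal, so
    fractions can be reduced and automorphisms of a specialised splitting field come from the Galois
    group without any theory of integral closure. The price is that only a_0 may be specialised
    freely: a map from E to a field needs algebraically independent images of a_1, ..., a_n. This
    governs the pencils. Tangency at (t1, x1) determines a_0 and a_1 from the other coefficients, so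
    the deformation in s is taken in the direction t, which makes a_1 transcendental again. The
    coefficients a_2 and a_3 still move the graph among the tangent ones: one is the parameter of a
    pencil, the other lies outside the field of definition of the remaining data and makes the
    argument against double roots work. This accounts for n >= 3. The pencils are defined over
    transcendental extensions of F_m, over which the curves must stay irreducible; hence absolute
    irreducibility. *)

Lemma root_map_polyC (R S : nzRingType) (h : {rmorphism R -> S}) (p : {poly R}) (x : S) :
  (map_poly (map_poly h) (map_poly polyC p)).[x%:P] = (map_poly h p).[x]%:P.
Proof.
rewrite -map_poly_comp -(horner_map polyC) -map_poly_comp; congr (_.[_]).
by apply: eq_map_poly => c /=; rewrite map_polyC.
Qed.

(** If every rho failed, each rho_i would have a polynomial f_i that vanishes at beta but not at
    rho_i. The resultant of p with a generic combination of the f_i is 0 in T, hence in Om, and this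
    forces a common root there. *)
Lemma place_step (S : idomainType) (T Om : fieldType) (e : {rmorphism S -> T})
    (phi : {rmorphism S -> Om}) (p : {poly S}) (beta : T) (rs : seq Om) :
  (forall a, e a = 0 -> phi a = 0) ->
  phi (lead_coef p) != 0 -> root (map_poly e p) beta ->
  map_poly phi p = phi (lead_coef p) *: \prod_(r <- rs) ('X - r%:P) ->
  exists2 rho, rho \in rs &
    forall f : {poly S}, root (map_poly e f) beta -> root (map_poly phi f) rho.
Proof.
move=> ker nzl rp split_p; apply: NNPP => noroot.
have [fs sz_fs Dfs]: exists2 fs : seq {poly S}, size fs = size rs &
    forall i, (i < size rs)%N -> root (map_poly e fs`_i) beta /\
      ~~ root (map_poly phi fs`_i) rs`_i.
  suff: forall rs' : seq Om, {subset rs' <= rs} -> exists2 fs : seq {poly S}, size fs = size rs' &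
    forall i, (i < size rs')%N -> root (map_poly e fs`_i) beta /\
      ~~ root (map_poly phi fs`_i) rs'`_i by apply.
  elim=> [|r rs' IH] sub; first by exists [::].
  have [|fs sz_fs Dfs] := IH; first by move=> x xr; apply: sub; rewrite inE xr orbT.
  have [f fb fr]: exists2 f : {poly S}, root (map_poly e f) beta & ~~ root (map_poly phi f) r.
    apply: NNPP => nof; apply: noroot; exists r; first by apply: sub; rewrite mem_head.
    by move=> f fb; apply: contraT => fr; case: nof; exists f.
  by exists (f :: fs) => [|[|i]] //=; [rewrite sz_fs | move=> /Dfs].
(* The inner variable Y is new: f0 is the sum of the f_i Y^i, so that vanishing at rho_k kills the
   specialisation of each f_i at rho_k, in particular that of f_k. *)
pose f0 : {poly {poly S}} := \sum_(i < size rs) (map_poly polyC fs`_i) * ('X^i)%:P.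
pose P : {poly {poly S}} := map_poly polyC p.
(* The multiple of P changes no value at a root of P, but gives f the leading coefficient of P, so
   that the resultant commutes with phi. *)
pose f := f0 + 'X^(size f0) * P.
have lP : lead_coef P = (lead_coef p)%:P by rewrite lead_coef_map_inj //; apply: polyC_inj.
have nzp : p != 0 by apply: contraNneq nzl => ->; rewrite lead_coef0 rmorph0.
have nzP : P != 0 by rewrite -lead_coef_eq0 lP polyC_eq0 lead_coef_eq0.
have szXP : size ('X^(size f0) * P) = (size f0 + size P)%N.
  by rewrite size_mul ?size_polyXn // monic_neq0 ?monicXn.
have ltf : (size f0 < size ('X^(size f0) * P)%R)%N.
  by rewrite szXP -addn1 leq_add2l size_poly_gt0.
have szf : size f = (size f0 + size P)%N by rewrite /f addrC size_polyDl.
have lf : lead_coef f = lead_coef P.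
  by rewrite /f addrC lead_coefDl // lead_coefM lead_coefXn mul1r.
have szP : (1 < size P)%N.
  have -> : size P = size p by rewrite size_map_poly_id0 // polyC_eq0 lead_coef_eq0.
  rewrite ltnNge; apply/negP => /size1_polyC Dp; move: rp nzl; rewrite Dp map_polyC rootC.
  by rewrite lead_coefC => /eqP /ker ->; rewrite eqxx.
have szf1 : (1 < size f)%N by rewrite szf ltn_addl.
have [uv _ Duv] := resultant_in_ideal szP szf1.
have e_root g : root (map_poly e g) beta ->
   (map_poly (map_poly e) (map_poly polyC g)).[beta%:P] = 0.
  by move=> /eqP gb; rewrite root_map_polyC gb.
have e_f : (map_poly (map_poly e) f).[beta%:P] = 0.
  rewrite /f /P rmorphD rmorphM /= hornerD hornerM (e_root _ rp) mulr0 addr0.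
  rewrite /f0 rmorph_sum horner_sum big1 // => i _.
  by rewrite rmorphM /= hornerM e_root ?mul0r //; case: (Dfs i).
have eres : map_poly e (resultant P f) = 0.
  have := congr1 (fun q => (map_poly (map_poly e) q).[beta%:P]) Duv.
  rewrite /= map_polyC hornerC rmorphD !rmorphM /= hornerD !hornerM.
  by rewrite e_f e_root // !mulr0 addr0 => ->.
have phires : map_poly phi (resultant P f) = 0.
  apply/polyP=> i; rewrite coef0 coef_map /=; apply: ker.
  by have := congr1 (fun q : {poly T} => q`_i) eres; rewrite /= coef_map coef0.
have nzl' : map_poly phi (lead_coef P) != 0 by rewrite lP map_polyC /= polyC_eq0.
have := phires; rewrite map_resultant ?lf // => /eqP.
rewrite resultant_eq0 ltn_neqAle eq_sym => /andP[/negP[]]; rewrite -/(coprimep _ _).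
have -> : map_poly (map_poly phi) P =
    (phi (lead_coef p))%:P%:P * \prod_(r <- rs) ('X - r%:P%:P).
  have -> : map_poly (map_poly phi) P = map_poly polyC (map_poly phi p).
    by rewrite /P -!map_poly_comp; apply: eq_map_poly => c /=; rewrite map_polyC.
  rewrite split_p map_polyZ /= mul_polyC; congr (_ *: _).
  by rewrite rmorph_prod; apply: eq_bigr => r _; rewrite rmorphB /= map_polyX map_polyC.
rewrite mul_polyC coprimepZl ?polyC_eq0 //.
have: forall r, r \in rs -> ~~ root (map_poly (map_poly phi) f) r%:P.
  move=> r /(nthP 0)[k ltk <-]; apply/negP => /eqP.
  rewrite /f rmorphD rmorphM /= hornerD hornerM root_map_polyC split_p.
  rewrite hornerZ [(\prod_(_ <- _) _).[_]](_ : _ = 0); last first.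
    by apply/eqP; rewrite -/(root _ _) root_prod_XsubC mem_nth.
  rewrite mulr0 mulr0 addr0 /f0 rmorph_sum horner_sum /= => H.
  have := congr1 (fun q : {poly Om} => q`_k) H; rewrite coef0 /= coef_sum.
  rewrite (bigD1 (Ordinal ltk)) //= big1 ?addr0 => [|i ik].
    rewrite rmorphM /= hornerM root_map_polyC map_polyC hornerC /= map_polyXn coefCM coefXn eqxx mulr1.
    by move=> /eqP R0; case: (Dfs k ltk) => _ /negP[].
  rewrite rmorphM /= hornerM root_map_polyC map_polyC hornerC /= map_polyXn coefCM coefXn.
  by have := ik; rewrite -val_eqE eq_sym /= => /negPf ->; rewrite mulr0.
have copr (F : {poly {poly Om}}) (l : seq Om) :
    (forall r, r \in l -> ~~ root F r%:P) -> coprimep (\prod_(r <- l) ('X - r%:P%:P)) F.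
  elim: l => [|r l IH] Hr; first by rewrite big_nil coprime1p.
  rewrite big_cons coprimepMl IH ?andbT => [|x xr]; last by apply: Hr; rewrite inE xr orbT.
  by rewrite coprimep_sym coprimep_XsubC Hr ?mem_head.
by move/copr.
Qed.

(* A specialisation phi of S extended to a ring pl_ring into which roots of polynomials have
   been adjoined; it lies over T only through pl_src, which need not be injective. *)
Record place (S : idomainType) (T Om : fieldType) (e : {rmorphism S -> T})
    (phi : {rmorphism S -> Om}) := Place {
  pl_ring : idomainType;
  pl_in : {rmorphism S -> pl_ring};
  pl_src : {rmorphism pl_ring -> T};
  pl_tgt : {rmorphism pl_ring -> Om};
  pl_srcE : forall a, pl_src (pl_in a) = e a;
  pl_tgtE : forall a, pl_tgt (pl_in a) = phi a;
  pl_ker : forall a, pl_src a = 0 -> pl_tgt a = 0 }.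

(** Roots are adjoined one at a time as polynomial variables, without taking quotients: evaluation
    at a root and at its specialisation satisfies the kernel condition by [place_step]. *)
Lemma place_exists (S : idomainType) (T Om : fieldType) (e : {rmorphism S -> T})
    (phi : {rmorphism S -> Om}) (p : {poly S}) (rs : seq T) (rhos : seq Om) :
  (forall a, e a = 0 -> phi a = 0) ->
  phi (lead_coef p) != 0 -> (forall x, x \in rs -> root (map_poly e p) x) ->
  map_poly phi p = phi (lead_coef p) *: \prod_(r <- rhos) ('X - r%:P) ->
  exists (pl : place e phi) (b : T -> pl_ring pl), forall x, x \in rs -> pl_src pl (b x) = x.
Proof.
elim: rs S e phi p => [|x rs IH] S e phi p ker nzl rp split_p.
  by exists (@Place S T Om e phi S idfun e phi (fun=> erefl) (fun=> erefl) ker), (fun=> 0).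
have [rho _ Hrho] := place_step ker nzl (rp x (mem_head _ _)) split_p.
pose e1 : {rmorphism {poly S} -> T} := horner_eval x \o map_poly e.
pose phi1 : {rmorphism {poly S} -> Om} := horner_eval rho \o map_poly phi.
have e1C a : e1 a%:P = e a by rewrite /= map_polyC /horner_eval hornerC.
have phi1C a : phi1 a%:P = phi a by rewrite /= map_polyC /horner_eval hornerC.
have [||||pl [b Hb]] := IH _ e1 phi1 (map_poly polyC p).
- by move=> a /eqP/Hrho/eqP.
- by rewrite lead_coef_map_inj ?phi1C //; apply: polyC_inj.
- move=> y yrs; rewrite -map_poly_comp (eq_map_poly e1C) rp // inE yrs orbT //.
- by rewrite lead_coef_map_inj ?phi1C -?map_poly_comp ?(eq_map_poly phi1C) //; apply: polyC_inj.
pose io : {rmorphism S -> pl_ring pl} := pl_in pl \o polyC.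
have srcE a : pl_src pl (io a) = e a by rewrite /= pl_srcE e1C.
have tgtE a : pl_tgt pl (io a) = phi a by rewrite /= pl_tgtE phi1C.
exists (@Place S T Om e phi _ io _ _ srcE tgtE (@pl_ker _ _ _ _ _ pl)).
exists (fun y => if y == x then pl_in pl 'X else b y) => y /=.
case: eqVneq => [-> _|yx]; first by rewrite pl_srcE /= map_polyX /horner_eval hornerX.
by rewrite inE (negPf yx) => /Hb.
Qed.

(** Divide u and v by their gcd. If phi v' were 0, then phi u' would be 0 as well, against the
    Bezout identity of u' and v'. *)
Lemma place_frac (F T Om : fieldType) (e : {rmorphism {poly F} -> T})
    (phi : {rmorphism {poly F} -> Om}) (pl : place e phi) (a : pl_ring pl) (u v : {poly F}) :
  e v != 0 -> pl_src pl a * e v = e u ->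
  exists u' v' : {poly F}, [/\ phi v' != 0, pl_src pl a * e v' = e u' &
    pl_tgt pl a * phi v' = phi u'].
Proof.
move=> nzev Dev.
have nzv : v != 0 by apply: contraNneq nzev => ->; rewrite rmorph0.
pose d := gcdp u v.
have nzd : d != 0 by rewrite gcdp_eq0 negb_and nzv orbT.
have Du : u = u %/ d * d by rewrite divpK ?dvdp_gcdl.
have Dv : v = v %/ d * d by rewrite divpK ?dvdp_gcdr.
exists (u %/ d), (v %/ d).
have ed : e d != 0 by apply: contraNneq nzev => e0; rewrite Dv rmorphM /= e0 mulr0.
have src : pl_src pl a * e (v %/ d) = e (u %/ d).
  by apply: (mulIf ed); rewrite -mulrA -!rmorphM -Du -Dv.
have tgt : pl_tgt pl a * phi (v %/ d) = phi (u %/ d).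
  apply/eqP; rewrite -subr_eq0 -!(pl_tgtE pl) -rmorphM -rmorphB; apply/eqP.
  by apply: pl_ker; rewrite rmorphB rmorphM /= !pl_srcE src subrr.
split=> //; apply/negP=> /eqP v0.
have /Bezout_eq1_coprimepP[[x y] /= Bxy] : coprimep (u %/ d) (v %/ d).
  by apply: coprimep_div_gcd; rewrite nzv orbT.
have := congr1 phi Bxy; rewrite rmorphD !rmorphM rmorph1 /= -tgt v0 !mulr0 addr0.
by move/eqP; rewrite eq_sym oner_eq0.
Qed.

Definition fixed_in_frac (F K : fieldType) (L : splittingFieldType K)
    (G : {group gal_of {:L}}) (e : {poly F} -> L) :=
  forall x : L, (forall g, g \in G -> g x = x) -> exists2 uv : {poly F} * {poly F},
    e uv.2 != 0 & x * e uv.2 = e uv.1.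

Definition gal_stable (K : fieldType) (L : splittingFieldType K)
    (G : {group gal_of {:L}}) (rs : seq L) :=
  forall g x, g \in G -> x \in rs -> g x \in rs.

(* A polynomial in one auxiliary variable encodes the whole tuple of conjugates of the roots. *)
Definition conj_gen (K : fieldType) (L : splittingFieldType K) (S : idomainType)
    (b : L -> S) (rs : seq L) (g : gal_of {:L}) : {poly S} :=
  \poly_(i < size rs) b (g rs`_i).

Lemma map_conj_gen (K : fieldType) (L : splittingFieldType K) (S : idomainType)
    (T : nzRingType) (s : {rmorphism S -> T}) (b : L -> S) (rs : seq L) (g : gal_of {:L}) :
  map_poly s (conj_gen b rs g) = \poly_(i < size rs) s (b (g rs`_i)).
Proof.
by apply/polyP=> i; rewrite /conj_gen coef_map !coef_poly; case: ifP => _; rewrite /= ?rmorph0.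
Qed.

(** The polynomial with roots the tuples of conjugates c_g, for g in G, has coefficients that are
    fractions over F[X], so tau fixes their specialisations and sends the specialised tuple c_1 to
    some c_g. Whole tuples are used so that one g serves all roots. *)
Lemma spec_gal (F K Om : fieldType) (L : splittingFieldType K) (e : {rmorphism {poly F} -> L})
    (phi : {rmorphism {poly F} -> Om}) (pl : place e phi) (b : L -> pl_ring pl)
    (rs : seq L) (G : {group gal_of {:L}}) (tau : {rmorphism Om -> Om}) :
  (forall x, x \in rs -> pl_src pl (b x) = x) ->
  fixed_in_frac G e -> gal_stable G rs -> (forall a, tau (phi a) = phi a) ->
  exists2 g, g \in G & forall x, x \in rs -> tau (pl_tgt pl (b x)) = pl_tgt pl (b (g x)).
Proof.
move=> lift fixG stab tauK; pose c := conj_gen b rs.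
pose Th : {poly {poly pl_ring pl}} := \prod_(g in G) ('X - (c g)%:P).
have srcTh : map_poly (map_poly (pl_src pl)) Th = 
     \prod_(g in G) ('X - (\poly_(i < size rs) g rs`_i)%:P).
  rewrite rmorph_prod /=; apply: eq_bigr => g gG.
  rewrite rmorphB /= map_polyX map_polyC /= map_conj_gen; congr (_ - _%:P).
  apply/polyP=> i; rewrite !coef_poly; case: ifP => // ltis.
  rewrite lift //. by apply: stab => //; rewrite mem_nth.
have Th_fixed h k l : h \in G -> h (pl_src pl (Th`_k`_l)) = pl_src pl (Th`_k`_l).
  move=> hG; have -> : pl_src pl (Th`_k`_l) = (map_poly (map_poly (pl_src pl)) Th)`_k`_l.
    by rewrite !coef_map.
  rewrite srcTh; pose R : {poly {poly L}} := \prod_(g in G) ('X - (\poly_(i < size rs) g rs`_i)%:P).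
  suff RE : map_poly (map_poly h) R = R by rewrite -/R -{2}RE !coef_map.
  rewrite [LHS]rmorph_prod /= [RHS](reindex_inj (mulIg h)%g) /=.
  apply: eq_big => g; first by rewrite groupMr.
  move=> _; rewrite rmorphB /= map_polyX map_polyC /=; congr (_ - _%:P).
  apply/polyP=> i; rewrite coef_map !coef_poly /=; case: ifP; rewrite ?rmorph0 // => _.
  by rewrite galM ?memvf.
have tgtTh : map_poly (map_poly (pl_tgt pl)) Th = \prod_(g in G) ('X - (map_poly (pl_tgt pl) (c g))%:P).
  by rewrite rmorph_prod /=; apply: eq_bigr => g gG; rewrite rmorphB /= map_polyX map_polyC.
have tauTh : map_poly (map_poly tau) (map_poly (map_poly (pl_tgt pl)) Th) =
    map_poly (map_poly (pl_tgt pl)) Th.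
  apply/polyP=> k; apply/polyP=> l; rewrite !coef_map /=.
  have [|[u v] /= nzv Dv] := fixG (pl_src pl Th`_k`_l); first by move=> h; apply: Th_fixed.
  have [u' [v' [nzv' _ Dt]]] := place_frac nzv Dv.
  by apply: (mulIf nzv'); rewrite -{1}tauK -rmorphM /= Dt tauK.
have : root (map_poly (map_poly tau) (map_poly (map_poly (pl_tgt pl)) Th))
         (map_poly tau (map_poly (pl_tgt pl) (c 1%g))).
  rewrite tgtTh (bigD1 1%g) //= rmorphM rootM rmorphB /= map_polyX map_polyC /=.
  by rewrite root_XsubC eqxx.
rewrite tauTh tgtTh /root horner_prod prodf_seq_eq0 => /hasP[g _ /andP[gG]].
rewrite hornerXsubC subr_eq0 => /eqP Hg; exists g => // x /(nthP 0)[i ltis <-].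
have := congr1 (fun q : {poly Om} => q`_i) Hg.
by rewrite /= !map_conj_gen coef_map /= !coef_poly ltis gal_id.
Qed.

Lemma place_root (S : idomainType) (T Om : fieldType) (e : {rmorphism S -> T})
    (phi : {rmorphism S -> Om}) (pl : place e phi) (a : pl_ring pl) (p : {poly S}) :
  root (map_poly e p) (pl_src pl a) -> root (map_poly phi p) (pl_tgt pl a).
Proof.
have srcE := pl_srcE pl; have tgtE := pl_tgtE pl.
have -> : map_poly e p = map_poly (pl_src pl) (map_poly (pl_in pl) p).
  by rewrite -map_poly_comp; apply: eq_map_poly => c; rewrite /= srcE.
have -> : map_poly phi p = map_poly (pl_tgt pl) (map_poly (pl_in pl) p).
  by rewrite -map_poly_comp; apply: eq_map_poly => c; rewrite /= tgtE.
by rewrite /root !horner_map => /eqP/pl_ker ->.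
Qed.

(** The difference of the two sides, formed inside the place, has source 0 and hence target 0.
    Unlike [place_root], this keeps the multiplicities. *)
Lemma place_split (S : idomainType) (T Om : fieldType) (e : {rmorphism S -> T})
    (phi : {rmorphism S -> Om}) (pl : place e phi) (b : T -> pl_ring pl) (rs : seq T)
    (p : {poly S}) :
  (forall x, x \in rs -> pl_src pl (b x) = x) ->
  map_poly e p = e (lead_coef p) *: \prod_(x <- rs) ('X - x%:P) ->
  map_poly phi p = phi (lead_coef p) *: \prod_(x <- rs) ('X - (pl_tgt pl (b x))%:P).
Proof.
move=> lift Dp; pose q := map_poly (pl_in pl) p - 
  pl_in pl (lead_coef p) *: \prod_(x <- rs) ('X - (b x)%:P).
have src_q : map_poly (pl_src pl) q = 0.
  rewrite rmorphB /= map_polyZ /= -map_poly_comp (eq_map_poly (pl_srcE pl)) pl_srcE Dp.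
  rewrite rmorph_prod /= [X in _ *: X - _]big_seq [X in _ - _ *: X]big_seq.
  apply/eqP; rewrite subr_eq0; apply/eqP; congr (_ *: _); apply: eq_bigr => x /lift bx.
  by rewrite rmorphB /= map_polyX map_polyC /= bx.
have : map_poly (pl_tgt pl) q = 0.
  apply/polyP=> i; rewrite coef0 coef_map /=; apply: pl_ker.
  by have := congr1 (fun r : {poly T} => r`_i) src_q; rewrite /= coef_map coef0.
rewrite rmorphB /= map_polyZ /= -map_poly_comp (eq_map_poly (pl_tgtE pl)) pl_tgtE.
move/eqP; rewrite subr_eq0 => /eqP ->; rewrite rmorph_prod /=; congr (_ *: _).
by apply: eq_bigr => x _; rewrite rmorphB /= map_polyX map_polyC.
Qed.

(** Used with z = x - t1 and s the parameter: once s is cancelled, p y^2 is a multiple of s, which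
    is absurd when p and y are nonzero at s = 0. *)
Lemma ramif_identity (R : comNzRingType) (s z y w r p : R) :
  z * y = s * w -> z ^+ 2 * r + s * p = 0 -> s * (s * (w * w) * r + p * (y * y)) = 0.
Proof.
move=> Dy D0; have -> : s * (s * (w * w) * r + p * (y * y)) =
  (s * w) ^+ 2 * r + y ^+ 2 * (s * p) by ring.
rewrite -Dy; have -> : (z * y) ^+ 2 * r + y ^+ 2 * (s * p) = y ^+ 2 * (z ^+ 2 * r + s * p).
  by ring.
by rewrite D0 mulr0.
Qed.

(** * Inertia and transpositions *)

Section Ramification.
Variables (k K : fieldType) (L : splittingFieldType K).
Variable (e : {rmorphism {poly k} -> L}).
Let phi : {rmorphism {poly k} -> k} := horner_eval 0.
Variables (pl : place e phi) (b : L -> pl_ring pl) (rs : seq L) (G : {group gal_of {:L}}).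
Hypothesis lift : forall x, x \in rs -> pl_src pl (b x) = x.
Hypothesis fixG : fixed_in_frac G e.
Hypothesis Gfix : forall g a, g \in G -> g (e a) = e a.
Hypothesis stab : gal_stable G rs.
Hypothesis eX : e 'X != 0.
Variables (t1 : k) (R0 : {poly k}) (P1 : {poly {poly k}}) (x : L).
Hypothesis x_rs : x \in rs.
Hypothesis x_t1 : pl_tgt pl (b x) = t1.
Hypothesis P1_t1 : (map_poly phi P1).[t1] != 0.
Hypothesis Px : (x - e t1%:P) ^+ 2 * (map_poly (e \o polyC) R0).[x] + e 'X * (map_poly e P1).[x] = 0.

(* If the conjugates of the roots had pairwise distinct specialisations, Lagrange
   interpolation would express x - t1 as s times an integral element, and the quadratic
   equation Px would then be violated modulo s^2. *)
Lemma inertia_nontrivial :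
  exists2 g : gal_of {:L}, g \in G /\ g != 1%g &
    forall z, z \in rs -> pl_tgt pl (b (g z)) = pl_tgt pl (b z).
Proof.
apply: NNPP => noinert.
pose c := conj_gen b rs.
pose C (g : gal_of {:L}) : {poly L} := \poly_(i < size rs) g rs`_i.
pose kap g := map_poly (pl_tgt pl) (c g).
have srcc g : g \in G -> map_poly (pl_src pl) (c g) = C g.
  move=> gG; rewrite map_conj_gen; apply/polyP=> i; rewrite !coef_poly; case: ifP => // lti.
  by rewrite lift // stab ?mem_nth.
have kap_neq g : g \in G -> g != 1%g -> kap 1%g != kap g.
  move=> gG g1; apply: contra_notN noinert => /eqP kg; exists g => // z /(nthP 0)[i lti <-].
  have := congr1 (fun q : {poly k} => q`_i) kg.
  by rewrite /kap !map_conj_gen !coef_poly lti gal_id => ->.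
pose toS : {rmorphism k -> pl_ring pl} := pl_in pl \o polyC.
have toS_src a : pl_src pl (toS a) = e a%:P by rewrite /= pl_srcE.
have toS_tgt a : pl_tgt pl (toS a) = a by rewrite /= pl_tgtE /= /horner_eval hornerC.
pose kc g := map_poly toS (kap g).
have src_kc g : map_poly (pl_src pl) (kc g) = map_poly (e \o polyC) (kap g).
  by rewrite /kc -map_poly_comp; apply: eq_map_poly => a; rewrite /= pl_srcE.
have tgt_kc g : map_poly (pl_tgt pl) (kc g) = kap g.
  by rewrite /kc -map_poly_comp map_poly_id // => a _; apply: toS_tgt.
(* At s = 0 this is zero for g != 1 and nonzero for g = 1. Since x - t1 also vanishes at s = 0,
   every y g specialises to 0. *)
pose others g := \prod_(h in G | h != 1%g) (c g - kc h).
pose y (g : gal_of {:L}) := (b (g x) - toS t1)%:P * others g.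
have tgt_y g : g \in G -> map_poly (pl_tgt pl) (y g) = 0.
  move=> gG; rewrite rmorphM /= map_polyC /= rmorphB /= toS_tgt.
  have [->|g1] := eqVneq g 1%g; first by rewrite gal_id x_t1 subrr mul0r.
  rewrite rmorph_prod /= (bigD1 g) ?gG //= (rmorphB (map_poly (pl_tgt pl))) /=.
  by rewrite tgt_kc subrr mul0r mulr0.
pose Y (g : gal_of {:L}) := (g x - e t1%:P)%:P * \prod_(h in G | h != 1%g) (C g - map_poly (e \o polyC) (kap h)).
have src_y g : g \in G -> map_poly (pl_src pl) (y g) = Y g.
  move=> gG; rewrite rmorphM /= map_polyC /= rmorphB /= pl_srcE lift ?stab //; congr (_ * _).
  by rewrite rmorph_prod /=; apply: eq_bigr => h _; rewrite rmorphB /= srcc ?src_kc.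
(* Numerator of the Lagrange interpolation of the values y g at the nodes c g. It is invariant under
   G, and it specialises to 0. *)
pose Q : {poly {poly pl_ring pl}} :=
  \sum_(g in G) (y g)%:P * \prod_(h in G | h != g) ('X - (c h)%:P).
pose srcQ : {poly {poly L}} := \sum_(g in G) (Y g)%:P * \prod_(h in G | h != g) ('X - (C h)%:P).
have srcQE : map_poly (map_poly (pl_src pl)) Q = srcQ.
  rewrite rmorph_sum /=; apply: eq_bigr => g gG; rewrite rmorphM /= map_polyC /= src_y //.
  congr (_ * _); rewrite rmorph_prod /=; apply: eq_bigr => h /andP[hG _].
  by rewrite rmorphB /= map_polyX map_polyC /= srcc.
have tgtQ : map_poly (map_poly (pl_tgt pl)) Q = 0.
  rewrite rmorph_sum big1 //= => g gG.
  by rewrite rmorphM /= map_polyC /= tgt_y // polyC0 mul0r.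
have mapC (h g : gal_of {:L}) : map_poly h (C g) = C (g * h)%g.
  apply/polyP=> i; rewrite coef_map !coef_poly /=; case: ifP; rewrite ?rmorph0 // => _.
  by rewrite galM ?memvf.
have mapY (h g : gal_of {:L}) : h \in G -> map_poly h (Y g) = Y (g * h)%g.
  move=> hG; rewrite /Y rmorphM /= map_polyC /= rmorphB /= Gfix // galM ?memvf //; congr (_ * _).
  rewrite rmorph_prod /=; apply: eq_bigr => h' _; rewrite rmorphB /= mapC; congr (_ - _).
  by rewrite -map_poly_comp; apply: eq_map_poly => a /=; rewrite Gfix.
have srcQ_fix h : h \in G -> map_poly (map_poly h) srcQ = srcQ.
  move=> hG; rewrite rmorph_sum /= [RHS](reindex_inj (mulIg h)) /=.
  apply: eq_big => g; first by rewrite groupMr.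
  move=> gG; rewrite rmorphM /= map_polyC /= mapY //; congr (_ * _).
  rewrite rmorph_prod /= [RHS](reindex_inj (mulIg h)) /=.
  apply: eq_big => g'; first by rewrite groupMr // (inj_eq (mulIg h)).
  by move=> _; rewrite rmorphB /= map_polyX map_polyC /= mapC.
(* J is the ideal generated by s after inverting the polynomials v(s) with v(0) != 0. Invariance
   puts the coefficients of Q in k(s), and their vanishing at 0 puts them in J. *)
pose J (A : {poly L}) := exists (v : {poly k}) (w : {poly pl_ring pl}),
  phi v != 0 /\ (e v)%:P * A = (e 'X)%:P * map_poly (pl_src pl) w.
have J0 : J 0 by exists 1, 0; rewrite !rmorph0 !mulr0 rmorph1 oner_eq0.
have JD A B : J A -> J B -> J (A + B).
  move=> [v [w [nzv Dv]]] [v' [w' [nzv' Dv']]].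
  exists (v * v'), ((pl_in pl v')%:P * w + (pl_in pl v)%:P * w').
  split; first by rewrite rmorphM mulf_neq0.
  rewrite rmorphM rmorphD !rmorphM /= !map_polyC /= !pl_srcE.
  by ring: Dv Dv'.
have JM A w : J A -> J (A * map_poly (pl_src pl) w).
  move=> [v [w' [nzv Dv]]]; exists v, (w' * w); split=> //.
  by rewrite mulrA Dv rmorphM mulrA.
have J_coef i j : J (srcQ`_i`_j)%:P.
  have Da : srcQ`_i`_j = pl_src pl Q`_i`_j by rewrite -srcQE !coef_map.
  have [h hG|[u v] /= nzv Dv] := fixG (x := srcQ`_i`_j).
    by rewrite -{2}(srcQ_fix h hG) !coef_map.
  rewrite Da in Dv *; have [u' [v' [nzv' Dv' Dt]]] := place_frac nzv Dv.
  have tgt0 : pl_tgt pl Q`_i`_j = 0.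
    have := congr1 (fun q : {poly {poly k}} => q`_i`_j) tgtQ.
    by rewrite /= !coef_map /= !coef0.
  have : root u' 0 by rewrite /root; apply/eqP; rewrite -/(horner_eval 0 u') -Dt tgt0 mul0r.
  case/factor_theorem=> q; rewrite subr0 => Du; exists v', (pl_in pl q)%:P; split=> //.
  by rewrite map_polyC /= pl_srcE -!rmorphM /= mulrC Dv' Du mulrC.
have JQ : J (srcQ.[C 1%g]).
  rewrite horner_coef; apply: (big_ind J) => // i _.
  have -> : C 1%g ^+ i = map_poly (pl_src pl) (c 1%g ^+ i) by rewrite rmorphXn /= srcc.
  apply: (JM); rewrite -[_`_i]coefK poly_def; apply: (big_ind J) => // j _.
  have -> : srcQ`_i`_j *: 'X^j = (srcQ`_i`_j)%:P * map_poly (pl_src pl) 'X^j.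
    by rewrite map_polyXn mul_polyC.
  exact: JM.
have srcQ1 : srcQ.[C 1%g] = Y 1%g * \prod_(h in G | h != 1%g) (C 1%g - C h).
  rewrite horner_sum (bigD1 1%g) //= [X in _ + X]big1 ?addr0 => [|g /andP[gG g1]].
    rewrite hornerM hornerC horner_prod; congr (_ * _).
    by apply: eq_bigr => h _; rewrite hornerXsubC.
  rewrite hornerM horner_prod (bigD1 1%g) ?group1 //= 1?eq_sym // hornerXsubC.
  by rewrite subrr mul0r mulr0.
have [v [w [nzv Dv]]] := JQ.
pose D := (pl_in pl v)%:P * others 1%g * \prod_(h in G | h != 1%g) (c 1%g - c h).
have srcD : (x - e t1%:P)%:P * map_poly (pl_src pl) D = (e 'X)%:P * map_poly (pl_src pl) w.
  rewrite -Dv srcQ1 !rmorphM /= map_polyC /= pl_srcE /Y gal_id !mulrA.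
  rewrite (mulrC (x - _)%:P); congr (_ * _).
    by congr (_ * _); rewrite rmorph_prod /=; apply: eq_bigr => h _; rewrite rmorphB /= srcc ?src_kc.
  by rewrite rmorph_prod /=; apply: eq_bigr => h /andP[hG _]; rewrite rmorphB /= !srcc.
have tgtD : map_poly (pl_tgt pl) D != 0.
  rewrite !rmorphM /= map_polyC /= pl_tgtE !mulf_neq0 ?polyC_eq0 //.
    rewrite rmorph_prod /=; apply/prodf_neq0 => h /andP[hG h1].
    by rewrite rmorphB /= tgt_kc subr_eq0 kap_neq.
  rewrite rmorph_prod /=; apply/prodf_neq0 => h /andP[hG h1].
  by rewrite rmorphB /= subr_eq0 kap_neq.
pose r := (map_poly toS R0).[b x]; pose p1 := (map_poly (pl_in pl) P1).[b x].
have src_r : pl_src pl r = (map_poly (e \o polyC) R0).[x].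
  rewrite /r -horner_map /= lift // -map_poly_comp; congr (_.[_]).
  by apply: eq_map_poly => a; rewrite /= pl_srcE.
have src_p1 : pl_src pl p1 = (map_poly e P1).[x].
  rewrite /p1 -horner_map /= lift // -map_poly_comp; congr (_.[_]).
  by apply: eq_map_poly => a; rewrite /= pl_srcE.
have tgt_p1 : pl_tgt pl p1 = (map_poly phi P1).[t1].
  rewrite /p1 -horner_map /= x_t1 -map_poly_comp; congr (_.[_]).
  by apply: eq_map_poly => a; rewrite /= pl_tgtE.
clearbody D r p1.
(* This is the quadratic equation multiplied by D^2 and divided by s. At s = 0 only the term p1 D^2
   is left, and it is nonzero. *)
pose A := (pl_in pl 'X)%:P * (w * w) * r%:P + p1%:P * (D * D).
have srcA : map_poly (pl_src pl) A = 0.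
  have eXP : (e 'X)%:P != 0 by rewrite polyC_eq0.
  apply: (mulfI eXP); rewrite mulr0 rmorphD !rmorphM /= !map_polyC /= src_r src_p1 pl_srcE.
  apply: ramif_identity srcD _.
  by have := congr1 polyC Px; rewrite rmorphD !rmorphM.
have tgtA : map_poly (pl_tgt pl) A = 0.
  apply/polyP=> i; rewrite coef0 coef_map /=; apply: pl_ker.
  by have := congr1 (fun q : {poly L} => q`_i) srcA; rewrite /= coef_map coef0.
move: tgtA; rewrite /A rmorphD !rmorphM /= !map_polyC /= pl_tgtE tgt_p1 /= /horner_eval hornerX.
rewrite polyC0 !mul0r add0r => /eqP; rewrite !mulf_eq0 polyC_eq0 (negPf P1_t1) /=.
by rewrite orbb (negPf tgtD).
Qed.
End Ramification.

Lemma poly_split0 (k : fieldType) (P : {poly {poly k}}) :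
  P = map_poly polyC (map_poly (horner_eval 0) P) + 'X%:P * map_poly (drop_poly 1) P.
Proof.
apply/polyP=> i; apply/polyP=> j.
rewrite coefD coefCM !coef_map /= coefD coefXM coefC coef_drop_poly /horner_eval horner_coef0.
by case: j => [|j]; rewrite ?addr0 //= add0r addn1.
Qed.

Lemma two_fibre (T1 T2 : eqType) (f : T1 -> T2) (s : seq T1) (a : T2) (r : seq T2) :
  uniq s -> perm_eq (map f s) (a :: a :: r) -> uniq (a :: r) ->
  exists x y, [/\ x \in s, y \in s, x != y, f x = a /\ f y = a &
    (forall z w, z \in s -> w \in s -> f z = f w -> z != w -> f z = a) /\
    (forall z, z \in s -> f z = a -> z = x \/ z = y)].
Proof.
move=> us pe /= /andP[ar ur].
have cnt b : count [pred z | f z == b] s = count_mem b (a :: a :: r).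
  by rewrite -(seq.permP pe) count_map.
have ca : size [seq z <- s | f z == a] = 2.
  by rewrite size_filter cnt /= eqxx (count_memPn ar).
case Ds: [seq z <- s | f z == a] ca => [|x [|y [|? ?]]] // _.
have xy_s z : (z \in s) && (f z == a) = (z \in [:: x; y]) by rewrite -Ds mem_filter andbC.
have /andP[xs /eqP fx] : (x \in s) && (f x == a) by rewrite xy_s !inE eqxx.
have /andP[ys /eqP fy] : (y \in s) && (f y == a) by rewrite xy_s !inE eqxx orbT.
have : uniq [:: x; y] by rewrite -Ds filter_uniq.
rewrite /= inE andbT => xy; exists x, y; split=> //; split=> [z w zs ws fzw zw|z zs fz].
  apply/eqP/contraT => fza.
  have : count [pred u | f u == f z] s = 1.
    have : f z \in a :: a :: r by rewrite -(perm_mem pe) map_f.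
    by rewrite cnt /= !inE (negPf fza) /= eq_sym (negPf fza) /= !add0n => fzr; rewrite count_uniq_mem ?fzr.
  have : (1 < size [seq u <- s | f u == f z])%N.
    have sub : {subset [:: z; w] <= [seq u <- s | f u == f z]}.
      by move=> u; rewrite !inE mem_filter => /orP[]/eqP->; rewrite ?eqxx ?zs // fzw eqxx ws.
    by apply: uniq_leq_size sub; rewrite /= inE zw.
  by rewrite size_filter => + c1; rewrite c1.
by have := xy_s z; rewrite zs fz eqxx !inE => /esym/orP[]/eqP; [left | right].
Qed.

(** An inertia element keeps all specialised roots, so it can move only the two roots above the
    double root t1; being nontrivial, it swaps them. The last clause records that x specialises to
    t1, from which one later reads off the curve it belongs to. *)
Lemma ramified_transposition (k K : fieldType) (L : splittingFieldType K)
    (e : {rmorphism {poly k} -> L}) (phi := horner_eval 0 : {rmorphism {poly k} -> k})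
    (rs : seq L) (G : {group gal_of {:L}}) (P : {poly {poly k}}) (t1 : k) (rhos : seq k) :
  fixed_in_frac G e -> (forall g a, g \in G -> g (e a) = e a) -> gal_stable G rs ->
  (forall g : gal_of {:L}, g \in G -> (forall z, z \in rs -> g z = z) -> g = 1%g) ->
  injective e -> uniq rs ->
  map_poly e P = e (lead_coef P) *: \prod_(x <- rs) ('X - x%:P) ->
  phi (lead_coef P) != 0 ->
  map_poly phi P = phi (lead_coef P) *: (('X - t1%:P) ^+ 2 * \prod_(r <- rhos) ('X - r%:P)) ->
  uniq (t1 :: rhos) -> (map_poly (coefp 1) P).[t1] != 0 ->
  exists (g : gal_of {:L}) x y, [/\ g \in G, x \in rs, y \in rs, x != y &
    [/\ g x = y, g y = x, (forall z, z \in rs -> z != x -> z != y -> g z = z) &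
     forall Q : {poly {poly k}}, root (map_poly e Q) x -> root (map_poly phi Q) t1]].
Proof.
move=> fixG Gfix stab faith inje urs eP nzl phiP urho P1t1.
have rootP x : x \in rs -> root (map_poly e P) x.
  by move=> xrs; rewrite eP rootZ ?root_prod_XsubC // -[0](rmorph0 e) (inj_eq inje);
     apply: contraNneq nzl => ->; rewrite rmorph0.
have ker a : e a = 0 -> phi a = 0 by rewrite -[0](rmorph0 e) => /inje ->; rewrite rmorph0.
have phiP' : map_poly phi P = phi (lead_coef P) *: \prod_(r <- [:: t1, t1 & rhos]) ('X - r%:P).
  by rewrite phiP !big_cons mulrA expr2.
have [pl [b lift]] := place_exists ker nzl rootP phiP'.
have pe : perm_eq [seq pl_tgt pl (b x) | x <- rs] [:: t1, t1 & rhos].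
  apply: prod_XsubC_eq; rewrite big_map.
  by apply: (scalerI nzl); rewrite -phiP' (place_split lift eP).
have [x [y [xs ys xy [fx fy] [finj fxy]]]] := two_fibre urs pe urho.
have eX : e 'X != 0 by rewrite -[0](rmorph0 e) (inj_eq inje) polyX_eq0.
(* P is its value at s = 0, namely (X - t1)^2 R0, plus s times a remainder; evaluating at x gives
   the quadratic equation required for inertia. *)
pose R0 := phi (lead_coef P) *: \prod_(r <- rhos) ('X - r%:P).
have Px : (x - e t1%:P) ^+ 2 * (map_poly (e \o polyC) R0).[x] +
    e 'X * (map_poly e (map_poly (drop_poly 1) P)).[x] = 0.
  have := rootP x xs; rewrite /root {1}(poly_split0 P) => /eqP <-.
  rewrite rmorphD rmorphM /= map_polyC hornerD hornerM hornerC; congr (_ + _).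
  rewrite phiP scalerAr -/R0 -map_poly_comp rmorphM hornerM rmorphXn rmorphB /=.
  by rewrite map_polyX map_polyC /= horner_exp hornerXsubC.
have P1 : (map_poly phi (map_poly (drop_poly 1) P)).[t1] != 0.
  rewrite (_ : map_poly phi _ = map_poly (coefp 1) P) //.
  apply/polyP=> i; rewrite !coef_map /=.
  by rewrite /horner_eval horner_coef0 coef_drop_poly.
have [g [gG g1] Dg] := inertia_nontrivial lift fixG Gfix stab eX xs fx P1 Px.
have fixz z : z \in rs -> pl_tgt pl (b z) != t1 -> g z = z.
  move=> zs; apply: contraNeq => gz.
  by rewrite -Dg //; apply/eqP/(finj (g z) z) => //; [exact: stab | exact: Dg].
have gxy z : z \in rs -> pl_tgt pl (b z) = t1 -> g z = x \/ g z = y.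
  by move=> zs fz; apply: fxy; [exact: stab | rewrite Dg].
have ginj : injective g by apply: fmorph_inj.
have [gx|gx] := gxy x xs fx.
  case/eqP: g1; apply: faith => // z zs.
  have [fz|/fixz] := eqVneq (pl_tgt pl (b z)) t1; last by apply.
  have [-> //|->] := fxy z zs fz; have [gy|//] := gxy y ys fy.
  by case/eqP: xy; apply: ginj; rewrite gx gy.
have gy : g y = x.
  by have [//|gy] := gxy y ys fy; case/eqP: xy; apply: ginj; rewrite gx gy.
exists g, x, y; split=> //; split=> // [z zs zx zy|Q rQ].
  by apply: fixz => //; apply/eqP => /(fxy z zs) [] /eqP; apply/negP.
by rewrite -fx; apply: place_root; rewrite lift.
Qed.

(** * Fraction fields and splitting fields *)

Lemma frac_split (R : idomainType) (x : {fraction R}) :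
  tofrac (generic_quotient.repr x).2 != 0 /\ x * tofrac (generic_quotient.repr x).2 = tofrac (generic_quotient.repr x).1.
Proof.
split; first by rewrite tofrac_eq0 denom_ratioP.
rewrite -{1}[x]generic_quotient.reprK; set r := generic_quotient.repr x; unlock FracField.tofrac.
rewrite -[LHS]FracField.pi_mul; apply/generic_quotient.eqmodP; rewrite /= FracField.equivfE /FracField.mulf.
have o1 := oner_neq0 R; rewrite !(numer_Ratio _ o1) !(denom_Ratio _ o1) !mulr1.
by rewrite !numden_Ratio ?denom_ratioP // mulrC.
Qed.

Lemma frac_lift (R : idomainType) (T : fieldType) (h : {rmorphism R -> T}) :
  injective h -> exists h' : {rmorphism {fraction R} -> T}, forall a, h' (tofrac a) = h a.
Proof.
move=> injh; pose f (x : {fraction R}) := h (generic_quotient.repr x).1 / h (generic_quotient.repr x).2.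
have hne v : v != 0 -> h v != 0 by move=> v0; rewrite -(rmorph0 h) (inj_eq injh).
have fE x u v : v != 0 -> x * tofrac v = tofrac u -> f x = h u / h v.
  move=> nzv Dx; have [nzd Dr] := frac_split x; rewrite tofrac_eq0 in nzd.
  apply/eqP; rewrite /f eqr_div ?hne // -!rmorphM (inj_eq injh) -tofrac_eq !tofracM.
  by rewrite -Dr -Dx mulrAC.
have fD x : exists u v, [/\ v != 0, x * tofrac v = tofrac u & f x = h u / h v].
  have [nzd Dr] := frac_split x; rewrite tofrac_eq0 in nzd.
  by exists (generic_quotient.repr x).1, (generic_quotient.repr x).2; rewrite (fE x _ _ nzd Dr).
have fB : zmod_morphism f.
  move=> x y; have [u [v [nzv Dx ->]]] := fD x; have [u' [v' [nzv' Dy ->]]] := fD y.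
  rewrite (fE _ (u * v' - u' * v) (v * v')) ?mulf_neq0 //.
    rewrite rmorphB !rmorphM /=; have := hne _ nzv; have := hne _ nzv'.
    by move: (h u) (h u') (h v) (h v') => a a' c c' Hc' Hc; field; rewrite Hc Hc'.
  by rewrite tofracB !tofracM mulrBl -Dx -Dy; congr (_ - _); rewrite !mulrA // mulrAC.
have fM : monoid_morphism f.
  split; first by rewrite (fE 1 1 1) ?oner_eq0 ?mul1r ?rmorph1 ?divr1.
  move=> x y; have [u [v [nzv Dx ->]]] := fD x; have [u' [v' [nzv' Dy ->]]] := fD y.
  have Dxy : x * y * tofrac (v * v') = tofrac (u * u') by rewrite !tofracM -Dx -Dy mulrACA.
  by rewrite (fE _ _ _ _ Dxy) ?mulf_neq0 // !rmorphM mulf_div.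
pose HA := GRing.isZmodMorphism.Build _ _ f fB.
pose HM := GRing.isMonoidMorphism.Build _ _ f fM.
pose g : {rmorphism {fraction R} -> T} := HB.pack f HA HM.
exists g => a; have Da : tofrac a * tofrac 1 = tofrac a by rewrite tofrac1 mulr1.
by rewrite /= (fE _ _ _ _ Da) ?oner_eq0 // rmorph1 divr1.
Qed.

Lemma irreducible_factor (F : fieldType) (p : {poly F}) :
  (1 < size p)%N -> exists2 r, r %| p & irreducible_poly r.
Proof.
have [n] := ubnP (size p); elim: n p => // n IH p ltpn p_gt1.
have [irr|nirr] := classic (irreducible_poly p); first by exists p.
have [q [q1 qp qNp]] : exists q : {poly F}, [/\ size q != 1%N, q %| p & ~~ (q %= p)].
  apply: NNPP => noq; apply: nirr; split=> // q q1 qp.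
  by apply: contraT => qNp; case: noq; exists q.
have nzp : p != 0 by rewrite -size_poly_gt0 ltnW.
have nzq : q != 0 by apply: dvdpN0 nzp.
have ltqp : (size q < size p)%N by rewrite ltn_neqAle dvdp_leq // andbT dvdp_size_eqp.
have [||r rq irr_r] := IH q; first exact: leq_trans ltqp _.
  by rewrite ltn_neqAle eq_sym q1 size_poly_gt0.
by exists r => //; apply: dvdp_trans qp.
Qed.

Lemma split_in_ext (F : fieldType) (p : {poly F}) : p != 0 ->
  exists (L : fieldExtType F) (rs : seq L),
    map_poly (in_alg L) p %= \prod_(z <- rs) ('X - z%:P).
Proof.
have [n] := ubnP (size p); elim: n F p => // n IH F p ltpn nzp.
have [p1|p_gt1] := leqP (size p) 1.
  by exists F^o, [::]; rewrite big_nil -size_poly_eq1 size_map_poly eqn_leq p1 size_poly_gt0.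
have [r rp irr_r] := irreducible_factor p_gt1.
have [K _ [x rx _]] := irredp_FAdjoin irr_r.
have /factor_theorem[q Dq] : root (map_poly (in_alg K) p) x.
  by rewrite -(divpK rp) rmorphM rootM rx orbT.
have nzq : q != 0.
  by apply: contraNneq nzp => q0; rewrite -(map_poly_eq0 (in_alg K)) Dq q0 mul0r.
have szq : size p = (size q).+1.
  by rewrite -(size_map_poly (in_alg K)) Dq size_Mmonic ?monicXsubC // size_XsubC addn2.
have [|L [zs Dzs]] := IH K q _ nzq; first by rewrite -szq.
exists (baseFieldType L), (in_alg L x :: zs); rewrite big_cons.
have -> : map_poly (in_alg (baseFieldType L)) p = map_poly (in_alg L) (map_poly (in_alg K) p).
  rewrite -map_poly_comp; apply: eq_map_poly => a /=; exact: baseField_scaleE.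
rewrite Dq rmorphM /= rmorphB /= map_polyX map_polyC /= mulrC.
by rewrite eqp_mull.
Qed.

Lemma splitting_ext_splittingField (F : fieldType) (p : {poly F}) (L : fieldExtType F) :
  splittingFieldFor 1 (map_poly (in_alg L) p) {:L} ->
  exists M : splittingFieldType F, splittingFieldFor 1 (map_poly (in_alg M) p) {:M}.
Proof.
move=> splL; have ax : SplittingField.axiom L.
  by exists (map_poly (in_alg L) p) => //; apply/polyOver1P; exists p.
pose HS := FieldExt_isSplittingField.Build F L ax.
pose M : splittingFieldType F := HB.pack (FieldExt.sort L) HS.
by exists M.
Qed.

Lemma splitting_field_exists (F : fieldType) (p : {poly F}) : p != 0 ->
  exists L : splittingFieldType F, splittingFieldFor 1 (map_poly (in_alg L) p) {:L}.
Proof.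
move=> nzp; have [L0 [rs Drs]] := split_in_ext nzp.
pose L := subvs_of <<1 & rs>>; pose toL := linfun (vsval : L -> L0).
have [zs Dzs] : exists zs, map toL zs = rs.
  exists (map (vsproj _) rs); rewrite -map_comp map_id_in // => y rs_y.
  by rewrite /= lfunE /= vsprojK ?seqv_sub_adjoin.
have splL : splittingFieldFor 1 (map_poly (in_alg L) p) {:L}.
  exists zs.
    rewrite -(eqp_map (vsval : {rmorphism L -> L0})).
    have -> : map_poly vsval (map_poly (in_alg L) p) = map_poly (in_alg L0) p.
      by rewrite -map_poly_comp; apply: eq_map_poly => a; apply: rmorph_alg.
    suff <- : \prod_(z <- rs) ('X - z%:P) = map_poly vsval (\prod_(z <- zs) ('X - z%:P)) by [].
    rewrite -[in LHS]Dzs big_map rmorph_prod; apply: eq_bigr => z _.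
    by rewrite rmorphB /= map_polyX map_polyC /= lfunE.
  apply/vspaceP=> u; rewrite memvf; pose U := (toL @: <<1 & zs>>)%VS.
  have : vsval u \in U by rewrite /U aimg_adjoin_seq aimg1 Dzs (valP u).
  by case/memv_imgP=> v vU; rewrite lfunE => /val_inj ->.
exact: splitting_ext_splittingField splL.
Qed.

(** * Curves and pencils of graphs *)

(* [csub h P f] is P(t, f(t)) for P in F[t][x] read over T through h; [ev2 h z x P] is P(z, x). *)
Definition csub (F T : nzRingType) (h : F -> T) (P : {poly {poly F}}) (f : {poly T}) : {poly T} :=
  (map_poly (map_poly h) P).[f].

Definition ev2 (F : nzRingType) (T : comNzRingType) (h : {rmorphism F -> T}) (z x : T) :
  {rmorphism {poly {poly F}} -> T} :=
  horner_eval x \o map_poly (horner_eval z \o map_poly h).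

Arguments ev2 : simpl never.

Lemma ev2E (F : nzRingType) (T : comNzRingType) (h : {rmorphism F -> T}) z x P :
  ev2 h z x P = (map_poly (horner_eval z \o map_poly h) P).[x].
Proof. by []. Qed.

Lemma ev2C (F : nzRingType) (T : comNzRingType) (h : {rmorphism F -> T}) z x c :
  ev2 h z x c%:P = (map_poly h c).[z].
Proof. by rewrite ev2E map_polyC hornerC. Qed.

Lemma ev2X (F : nzRingType) (T : comNzRingType) (h : {rmorphism F -> T}) z x :
  ev2 h z x 'X = x.
Proof. by rewrite ev2E map_polyX hornerX. Qed.

Lemma horner_csub (F : nzRingType) (T : comNzRingType) (h : {rmorphism F -> T}) P f z :
  (csub h P f).[z] = ev2 h z f.[z] P.
Proof. by rewrite /csub -[LHS]/(horner_eval z _) -horner_map /= -map_poly_comp. Qed.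

Lemma csub_comp (F F' T : nzRingType) (c : {rmorphism F -> F'}) (h : {rmorphism F' -> T}) 
    (g : F -> T) P f :
  g =1 h \o c -> csub h (map_poly (map_poly c) P) f = csub g P f.
Proof.
move=> Dg; rewrite /csub -map_poly_comp; congr (_.[f]); apply: eq_map_poly => p /=.
by rewrite -map_poly_comp; apply: eq_map_poly => a; rewrite Dg.
Qed.

Lemma map_csub (F T T' : comNzRingType) (h : {rmorphism F -> T}) (h' : {rmorphism T -> T'})
    (g : F -> T') P f :
  g =1 h' \o h -> map_poly h' (csub h P f) = csub g P (map_poly h' f).
Proof.
move=> Dg; rewrite /csub -horner_map -map_poly_comp; congr (_.[_]); apply: eq_map_poly => p /=.
by rewrite -map_poly_comp; apply: eq_map_poly => a; rewrite /= Dg.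
Qed.

Lemma deriv_horner2 (T : comNzRingType) (P : {poly {poly T}}) (f : {poly T}) :
  (P.[f])^`() = (map_poly (@deriv T) P).[f] + P^`().[f] * f^`().
Proof.
elim/poly_ind: P => [|P c IH]; first by rewrite map_poly0 deriv0 !horner0 mul0r addr0 deriv0.
rewrite hornerMXaddC derivD derivM IH derivMXaddC.
have -> : map_poly (@deriv T) (P * 'X + c%:P) = map_poly (@deriv T) P * 'X + (c^`())%:P.
  apply/polyP=> i; rewrite coef_map_id0 ?deriv0 // !coefD !coefMX !coefC raddfD /=.
  by case: i => [|i]; rewrite /= ?deriv0 ?coef_map_id0 ?deriv0.
by rewrite hornerMXaddC hornerD hornerMX; ring.
Qed.

(** Otherwise a Bezout relation over k(t) would give a nonzero d in k[t] with d(z) = 0. Monicity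
    turns divisibility over k(t) into divisibility in k[t][x]. *)
Lemma algebraic_coprime (k T : fieldType) (h : {rmorphism k -> T}) (Gm H : {poly {poly k}}) (z x : T) :
  Gm \is monic -> irreducible_poly Gm -> ~ algebraicOver h z ->
  ev2 h z x Gm = 0 -> ev2 h z x H = 0 -> exists Q, H = Q * Gm.
Proof.
move=> monG irrG trz G0 H0; have [GH|GnH] := boolP (Gm %| H).
  by exists (H %/ Gm); apply/eqP; rewrite -Pdiv.IdomainMonic.dvdp_eq.
have /eqP cop : coprimep Gm H by rewrite irreducible_poly_coprime.
have [[u v] /= Euv] := Bezoutp Gm H.
have /size_poly1P[d nzd Dd] : size (u * Gm + v * H) == 1%N by rewrite (eqp_size Euv) cop.
case: trz; exists d => //; rewrite /root -(ev2C h z x) -Dd rmorphD !rmorphM G0 H0.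
by rewrite !mulr0 addr0.
Qed.

Lemma algebraic_horner (k T : fieldType) (h : {rmorphism k -> T}) (p : {poly k}) (z : T) :
  algebraicOver h z -> algebraicOver h (map_poly h p).[z].
Proof.
move/integral_algebraic => algz; apply/integral_algebraic; apply: integral_horner => //.
by apply/integral_poly => i; rewrite coef_map; apply: integral_id.
Qed.

(** If z were algebraic, so would be the ordinate xi, a root of the monic polynomial Gm(z, x), and
    then also beta = (xi - q(z)) / W(z). *)
Lemma transcendental_root (k T : fieldType) (h : {rmorphism k -> T}) (Gm : {poly {poly k}})
    (q W : {poly k}) (z beta : T) :
  Gm \is monic -> ~ algebraicOver h beta -> (map_poly h W).[z] != 0 ->
  ev2 h z ((map_poly h q).[z] + (map_poly h W).[z] * beta) Gm = 0 -> ~ algebraicOver h z.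
Proof.
move=> monG trb Wz; set xi := _ + _ => G0 algz; apply: trb.
have algxi : algebraicOver h xi.
  apply/integral_algebraic.
  apply: (@integral_root_monic _ _ h xi (map_poly (horner_eval z \o map_poly h) Gm)).
  - exact: monic_map.
  - by apply/eqP.
  - by apply/integral_poly => i; rewrite coef_map; apply/integral_algebraic/algebraic_horner.
have -> : beta = (xi - (map_poly h q).[z]) / (map_poly h W).[z].
  by rewrite /xi addrC addKr mulrC mulKf.
apply: algebraic_div; last exact: algebraic_horner.
by apply: algebraic_sub => //; apply: algebraic_horner.
Qed.

(** On the curve beta is the rational function (x - q) / W. An algebraic relation between beta and z
    therefore becomes a polynomial vanishing at a generic point of the curve, hence on the whole
    curve, in particular at the point above z'. *)
Lemma ev2_generic_conj (k T : fieldType) (h : {rmorphism k -> T}) (Gm G : {poly {poly k}})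
    (q W : {poly k}) (z z' beta : T) 
    (xi := fun y : T => (map_poly h q).[y] + (map_poly h W).[y] * beta) :
  Gm \is monic -> irreducible_poly Gm -> ~ algebraicOver h beta ->
  (map_poly h W).[z] != 0 -> (map_poly h W).[z'] != 0 ->
  ev2 h z (xi z) Gm = 0 -> ev2 h z' (xi z') Gm = 0 -> ev2 h beta z G = 0 -> ev2 h beta z' G = 0.
Proof.
move=> monG irrG trb Wz Wz' Gz Gz'; pose S := swapXY G.
have swapE y : ev2 h beta y G = \sum_(j < size S) (map_poly h S`_j).[y] * beta ^+ j.
  rewrite -(swapXYK G) -/S; have -> : ev2 h beta y (swapXY S) = ev2 h y beta S.
    rewrite -{1}(hornerC y beta) -horner_csub /csub -swapXY_map horner2_swapXY.
    by rewrite -/(csub h S beta%:P) horner_csub hornerC.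
  by rewrite ev2E horner_poly.
(* G with (x - q) / W substituted for beta, the denominators cleared by a power of W. *)
pose H := \sum_(j < size S) (S`_j)%:P * ('X - q%:P) ^+ j * (W ^+ (size S - j))%:P.
have HE y : ev2 h y (xi y) H = (map_poly h W).[y] ^+ size S * ev2 h beta y G.
  rewrite swapE mulr_sumr rmorph_sum; apply: eq_bigr => j _.
  rewrite !rmorphM rmorphXn rmorphB !ev2C ev2X rmorphXn horner_exp /xi addrC addKr exprMn.
  have -> : (map_poly h W).[y] ^+ size S = (map_poly h W).[y] ^+ (size S - j) * (map_poly h W).[y] ^+ j.
    by rewrite -exprD subnK // ltnW.
  move: (_ ^+ (size S - j)) (_ ^+ j) (_ ^+ j) (_.[y]) => A B D E; ring.
have trz := transcendental_root monG trb Wz Gz.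
move=> G0; have [|Q DH] := algebraic_coprime monG irrG trz Gz (H := H); first by rewrite HE G0 mulr0.
have /eqP : ev2 h z' (xi z') H = 0 by rewrite DH rmorphM Gz' mulr0.
by rewrite HE mulf_eq0 expf_eq0 (negPf Wz') andbF => /eqP.
Qed.

Lemma monic_mul_small (R : idomainType) (p q r : {poly R}) :
  q \is monic -> p * q = r -> (size r < size q)%N -> r = 0.
Proof.
move=> monq Dr ltrq; have [p0|nzp] := eqVneq p 0; first by rewrite -Dr p0 mul0r.
move: ltrq; rewrite -Dr size_Mmonic //.
have := nzp; rewrite -size_poly_gt0; case: (size p) => // m _.
by rewrite addSn /= ltnNge leq_addl.
Qed.

(* Along the curve Gm = 0 this is -Gm_x W^2 times the t-derivative of (x - q) / W, so it
   vanishes at the multiple roots of Gm(t, q + beta W). *)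
Definition curve_wronskian (R : nzRingType) (Gm : {poly {poly R}}) (W q : {poly R}) : {poly {poly R}} :=
  W%:P * map_poly (@deriv R) Gm + Gm^`() * ((W * q^`() - W^`() * q)%:P + (W^`())%:P * 'X).

Lemma map_curve_wronskian (R S : nzRingType) (c : {rmorphism R -> S}) (G : {poly {poly R}})
    (W q : {poly R}) :
  map_poly (map_poly c) (curve_wronskian G W q) =
  curve_wronskian (map_poly (map_poly c) G) (map_poly c W) (map_poly c q).
Proof.
rewrite /curve_wronskian rmorphD !rmorphM /= -deriv_map rmorphD rmorphM /= !map_polyC /= map_polyX.
rewrite rmorphB !rmorphM /= -!deriv_map; congr (_ * _ + _).
by rewrite -!map_poly_comp_id0 ?deriv0 ?raddf0 //; apply: eq_map_poly => p /=; rewrite deriv_map.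
Qed.

Lemma curve_wronskian_affine (R : comNzRingType) (G : {poly {poly R}}) (W q w : {poly R}) (a : R) :
  curve_wronskian G W (q + a *: w) =
  curve_wronskian G W q + a%:P *: (G^`() * (W * w^`() - W^`() * w)%:P).
Proof.
have E : W * (q + a *: w)^`() - W^`() * (q + a *: w) =
    (W * q^`() - W^`() * q) + a%:P * (W * w^`() - W^`() * w).
  rewrite derivD derivZ -!mul_polyC.
  by move: q^`() w^`() W^`() a%:P => q' w' W' A; ring.
rewrite /curve_wronskian E polyCD polyCM -mul_polyC.
move: (_ - _)%:P (_ - _)%:P (_^`())%:P (_^`()) (a%:P)%:P W%:P (map_poly _ _) => A B D H I J M.
by ring.
Qed.

(** At a point with x = q + beta W the factor W q' - W' q + W' x equals W f', so the expression is W
    times the chain rule for Gm(t, f(t)). *)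
Lemma ev2_curve_wronskian (k T : fieldType) (h : {rmorphism k -> T}) (G : {poly {poly k}})
    (q W : {poly k}) (beta z : T) (f := map_poly h q + beta *: map_poly h W) :
  ev2 h z f.[z] (curve_wronskian G W q) = (map_poly h W).[z] * ((csub h G f)^`()).[z].
Proof.
have ev2_deriv : ev2 h z f.[z] (map_poly (@deriv k) G) = 
    ((map_poly (@deriv T) (map_poly (map_poly h) G)).[f]).[z].
  rewrite -horner_csub /csub; congr (_.[_].[_]).
  rewrite -!map_poly_comp_id0 ?deriv0 ?raddf0 //; by apply: eq_map_poly => p /=; rewrite deriv_map.
have ev2_deriv2 : ev2 h z f.[z] G^`() = ((map_poly (map_poly h) G)^`().[f]).[z].
  by rewrite -horner_csub /csub deriv_map.
rewrite /curve_wronskian rmorphD !rmorphM rmorphD rmorphM !ev2C ev2X ev2_deriv ev2_deriv2.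
rewrite /csub deriv_horner2 (hornerD (_.[f])) hornerM.
have -> : (f^`()).[z] = (map_poly h q^`()).[z] + beta * (map_poly h W^`()).[z].
  by rewrite /f derivD derivZ hornerD hornerZ !deriv_map.
have -> : f.[z] = (map_poly h q).[z] + beta * (map_poly h W).[z].
  by rewrite /f hornerD hornerZ.
rewrite rmorphB !rmorphM hornerD hornerN !hornerM /=.
move: (_.[z]) (_.[z]) (_.[z]) (_.[z]) (_.[z]) (_.[z]) => A B C D E F.
by ring.
Qed.

(** A multiple root off the zeros of W makes the Wronskian a multiple of G. The Wronskian is D1 + a
    D2 with D1 and D2 over k1, so its remainder modulo G is affine in a, and its vanishing would put
    a in k1. *)
Lemma generic_separable (k1 k T : fieldType) (c : {rmorphism k1 -> k}) (h : {rmorphism k -> T})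
    (Gm : {poly {poly k1}}) (q1 w2 W : {poly k1}) (a : k) (beta z : T) 
    (q := map_poly c q1 + a *: map_poly c w2)
    (f := map_poly h q + beta *: map_poly h (map_poly c W)) :
  Gm \is monic -> irreducible_poly (map_poly (map_poly c) Gm) -> Gm^`() != 0 ->
  ~ algebraicOver h beta -> (forall y, c y != a) -> W * w2^`() - W^`() * w2 != 0 ->
  (map_poly h (map_poly c W)).[z] != 0 ->
  (csub h (map_poly (map_poly c) Gm) f).[z] = 0 ->
  ((csub h (map_poly (map_poly c) Gm) f)^`()).[z] != 0.
Proof.
set G := map_poly _ Gm => monG irrG nzGx trb ac nzw Wz Gz.
have monG' : G \is monic by apply: monic_map.
have fz : f.[z] = (map_poly h q).[z] + (map_poly h (map_poly c W)).[z] * beta.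
  by rewrite hornerD hornerZ mulrC.
have Gz' : ev2 h z f.[z] G = 0 by rewrite -horner_csub.
have trz : ~ algebraicOver h z.
  by apply: (@transcendental_root _ _ h G q (map_poly c W) z beta) => //; rewrite -fz.
apply/eqP => dGz; pose Dl := curve_wronskian G (map_poly c W) q.
have Dlz : ev2 h z f.[z] Dl = 0 by rewrite ev2_curve_wronskian dGz mulr0.
have [Q DDl] := algebraic_coprime monG' irrG trz Gz' Dlz.
pose cc := map_poly (map_poly c).
pose D1 := curve_wronskian Gm W q1; pose D2 := Gm^`() * (W * w2^`() - W^`() * w2)%:P.
have DlE : Dl = cc D1 + a%:P *: cc D2.
  rewrite /Dl /q curve_wronskian_affine /cc map_curve_wronskian /D2 rmorphM /= map_polyC /=.
  have -> : map_poly c (W * w2^`() - W^`() * w2) = map_poly c W * (map_poly c w2)^`() -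
      (map_poly c W)^`() * map_poly c w2 by rewrite rmorphB !rmorphM /= -!deriv_map.
  by rewrite deriv_map.
have szG : size G = size Gm by rewrite size_map_poly_id0 // map_poly_eq0 lead_coef_eq0 monic_neq0.
(* Only D1 needs reduction: D2 is the x-derivative of Gm times a polynomial in t alone, so its
   x-degree is already smaller than that of Gm. *)
pose R1 := D1 %% Gm.
have D1E : D1 = (D1 %/ Gm) * Gm + R1 by apply: Pdiv.IdomainMonic.divp_eq.
have szR1 : (size R1 < size Gm)%N by rewrite ltn_modp monic_neq0.
have szD2 : (size D2 < size Gm)%N.
  rewrite /D2 mulrC mul_polyC; apply: leq_ltn_trans (size_scale_leq _ _) _.
  by rewrite lt_size_deriv // monic_neq0.
have zero : cc R1 + a%:P *: cc D2 = 0.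
  apply: (monic_mul_small (p := Q - cc (D1 %/ Gm)) monG').
    rewrite mulrBl -DDl DlE {1}D1E /cc rmorphD rmorphM /= -/cc; ring.
  rewrite szG; apply: leq_ltn_trans (size_polyD _ _) _; rewrite gtn_max.
  rewrite (leq_ltn_trans (size_poly _ _)) //=.
  by apply: leq_ltn_trans (size_scale_leq _ _) _; apply: leq_ltn_trans (size_poly _ _) _.
have nzD2 : D2 != 0 by rewrite mulf_neq0 ?polyC_eq0.
have [i [j nzij]] : exists i j, D2`_i`_j != 0.
  exists (size D2).-1, (size (lead_coef D2)).-1.
  by rewrite -!lead_coefE !lead_coef_eq0.
have /eqP := congr1 (fun p : {poly {poly k}} => p`_i`_j) zero.
rewrite /= coefD coefZ coefD coefCM /cc !coef_map /= ?coef_map /= !coef0 addr_eq0 => /eqP Da.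
(* A nonzero coefficient of D2 solves the relation for a inside k1. *)
have /eqP[] := ac (- R1`_i`_j / D2`_i`_j).
have nzc : c D2`_i`_j != 0 by rewrite fmorph_eq0.
by rewrite fmorph_div rmorphN Da opprK mulfK.
Qed.

Lemma generic_coprime (k T : fieldType) (h : {rmorphism k -> T}) (G G' : {poly {poly k}})
    (q W : {poly k}) (beta z : T) (f := map_poly h q + beta *: map_poly h W) :
  G \is monic -> irreducible_poly G -> G' \is monic -> irreducible_poly G' ->
  ~ algebraicOver h beta -> (map_poly h W).[z] != 0 ->
  (csub h G f).[z] = 0 -> (csub h G' f).[z] = 0 -> G = G'.
Proof.
move=> monG irrG monG' irrG' trb Wz; rewrite !horner_csub => Gz Gz'.
have fz : f.[z] = (map_poly h q).[z] + (map_poly h W).[z] * beta.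
  by rewrite hornerD hornerZ mulrC.
have trz : ~ algebraicOver h z.
  by apply: (@transcendental_root _ _ h G q W z beta) => //; rewrite -fz.
have [Q DG'] := algebraic_coprime monG irrG trz Gz Gz'.
have GG' : G %| G' by rewrite DG' dvdp_mull.
have : G %= G' by apply: irrG'.2 => //; case: irrG => szG _; rewrite gtn_eqF.
move=> /eqp_eq; rewrite !(monicP _) // !scale1r. exact.
Qed.

(** * Galois groups over rational function fields *)

Lemma gal_eq1_on_gens (K : fieldType) (L : splittingFieldType K) (rs : seq L) (g : gal_of {:L}) :
  <<1 & rs>>%VS = fullv -> (forall z, z \in rs -> g z = z) -> g = 1%g.
Proof.
move=> gen_rs fix_rs; apply/eqP/gal_eqP => x _; rewrite gal_id.
have : x \in fixedField [set g].
  suff : (<<1 & rs>> <= fixedField [set g])%VS by rewrite gen_rs => /subvP -> //; rewrite memvf.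
  apply/Fadjoin_seqP; split; first exact: sub1v.
  by move=> z zrs; apply/fixedFieldP; rewrite ?memvf // => h /set1P ->; apply: fix_rs.
by move/fixedFieldP => H; apply: H; rewrite ?memvf ?set11.
Qed.

Lemma galois_of_uniq_roots (K : fieldType) (L : splittingFieldType K) (rs : seq L) :
  <<1 & rs>>%VS = fullv -> \prod_(x <- rs) ('X - x%:P) \is a polyOver 1%VS -> uniq rs ->
  galois 1 {:L}.
Proof.
move=> gen_rs over_rs urs; apply/splitting_galoisField.
exists (\prod_(x <- rs) ('X - x%:P)); split=> //; first by rewrite separable_prod_XsubC.
by exists rs => //; rewrite eqpxx.
Qed.

Lemma gal_stable_roots (K : fieldType) (L : splittingFieldType K) (S : nzRingType)
    (e : {rmorphism S -> L}) (P : {poly S}) (c : L) (rs : seq L) (G : {group gal_of {:L}}) :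
  c != 0 -> map_poly e P = c *: \prod_(x <- rs) ('X - x%:P) ->
  (forall g a, g \in G -> g (e a) = e a) -> gal_stable G rs.
Proof.
move=> nzc eP Gfix g x gG.
have rootE y : (y \in rs) = root (map_poly e P) y by rewrite eP rootZ // root_prod_XsubC.
rewrite !rootE -(fmorph_root g) -map_poly_comp.
by rewrite (eq_map_poly (g := e)) // => a /=; rewrite Gfix.
Qed.

Lemma uniq_of_simple_roots (F : fieldType) (c : F) (rs : seq F) (P : {poly F}) :
  P = c *: \prod_(x <- rs) ('X - x%:P) -> (forall x, x \in rs -> P^`().[x] != 0) -> uniq rs.
Proof.
elim: rs P => //= x rs IH P; rewrite big_cons => DP simple.
pose Q := c *: \prod_(y <- rs) ('X - y%:P).
have DPQ : P = ('X - x%:P) * Q by rewrite DP -scalerAr.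
have dP y : P^`().[y] = Q.[y] + (y - x) * Q^`().[y].
  by rewrite DPQ derivM derivXsubC mul1r hornerD hornerM hornerXsubC.
have rootQ y : y \in rs -> Q.[y] = 0.
  by move=> yrs; apply/eqP; rewrite hornerZ mulf_eq0 -/(root _ y) root_prod_XsubC yrs orbT.
apply/andP; split.
  apply/negP => /rootQ Qx; have := simple x (mem_head _ _).
  by rewrite dP Qx subrr mul0r addr0 eqxx.
apply: (IH Q) => // y yrs; have := simple y; rewrite inE yrs orbT dP rootQ // add0r.
by move=> /(_ isT); rewrite mulf_eq0 => /norP[].
Qed.

(** Describes E as the fraction field of A by its properties, so that the field of coefficients can
    remain abstract in the sections below. *)
Record fraction_map (A : idomainType) (E : fieldType) := FractionMap {
  frac_map :> {rmorphism A -> E};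
  frac_map_inj : injective frac_map;
  frac_map_denom : forall x, exists2 v, v != 0 & exists u, x * frac_map v = frac_map u;
  frac_map_lift : forall (T : fieldType) (h : {rmorphism A -> T}), injective h ->
    exists h' : {rmorphism E -> T}, forall a, h' (frac_map a) = h a
}.

Lemma tofrac_inj (A : idomainType) : injective (@FracField.tofrac A).
Proof. by move=> a b /eqP; rewrite tofrac_eq => /eqP. Qed.

Lemma tofrac_denom (A : idomainType) (x : {fraction A}) :
  exists2 v, v != 0 & exists u, x * tofrac v = tofrac u.
Proof.
have [nzd Dx] := frac_split x; rewrite tofrac_eq0 in nzd.
by exists (generic_quotient.repr x).2 => //; exists (generic_quotient.repr x).1.
Qed.

Definition tofrac_map (A : idomainType) : fraction_map A {fraction A} :=
  FractionMap (@tofrac_inj A) (@tofrac_denom A) (@frac_lift A).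

Lemma frac_map_ext (A : idomainType) (E T : fieldType) (fr : fraction_map A E) (s1 s2 : {rmorphism E -> T}) :
  (forall a, s1 (fr a) = s2 (fr a)) -> s1 =1 s2.
Proof.
move=> eqs x; have [v nzv [u Dx]] := frac_map_denom fr x.
have nzs : s1 (fr v) != 0 by rewrite fmorph_eq0 -(rmorph0 fr) (inj_eq (@frac_map_inj _ _ fr)).
by apply: (mulIf nzs); rewrite -rmorphM eqs -rmorphM Dx eqs.
Qed.

Lemma frac_map_clear (A : idomainType) (E : fieldType) (fr : fraction_map A E) (p : {poly E}) :
  exists2 r, r != 0 & exists P : {poly A}, map_poly fr P = fr r *: p.
Proof.
elim/poly_ind: p => [|p c [r nzr [P DP]]].
  by exists 1; rewrite ?oner_eq0 //; exists 0; rewrite rmorph0 scaler0.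
have [d nzd [n Dc]] := frac_map_denom fr c.
exists (r * d); rewrite ?mulf_neq0 //; exists (d%:P * P * 'X + (r * n)%:P).
rewrite rmorphD !rmorphM /= !map_polyC map_polyX /= DP -Dc -!mul_polyC !polyCM mulrDr.
by congr (_ + _); [rewrite !mulrA [X in X * _ * _]mulrC | rewrite [X in _ * X]mulrC mulrA].
Qed.

Lemma clear_denominators (R : idomainType) (p : {poly {fraction R}}) :
  exists2 r, r != 0 & exists P : {poly R}, map_poly (@FracField.tofrac R) P = tofrac r *: p.
Proof. exact: (frac_map_clear (tofrac_map R)). Qed.

Section FracSplitting.
Variables (k : fieldType) (L : splittingFieldType {fraction {poly k}}).

Definition frac_emb : {rmorphism {poly k} -> L} := in_alg L \o @FracField.tofrac {poly k}.
Definition const_emb : {rmorphism k -> L} := frac_emb \o polyC.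

Lemma frac_emb_inj : injective frac_emb.
Proof.
move=> p q /fmorph_inj Dpq; apply/eqP; rewrite -tofrac_eq; exact/eqP.
Qed.

Lemma frac_embE p : frac_emb p = (map_poly const_emb p).[frac_emb 'X].
Proof.
rewrite /const_emb map_poly_comp /= horner_map /=; congr (frac_emb _).
by elim/poly_ind: p => [|p c IH]; rewrite ?map_poly0 ?horner0 // rmorphD rmorphM /= map_polyC map_polyX
   hornerMXaddC -IH.
Qed.

Lemma frac_embX_transcendental : ~ algebraicOver const_emb (frac_emb 'X).
Proof.
move=> [p nzp]; rewrite /root -frac_embE => /eqP p0; case/eqP: nzp.
by apply: frac_emb_inj; rewrite p0 rmorph0.
Qed.

Lemma gal_frac_emb (g : gal_of {:L}) p : g \in ('Gal({:L} / 1))%g -> g (frac_emb p) = frac_emb p.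
Proof. by move=> gG; apply: (fixed_gal (sub1v _) gG); rewrite rpredZ ?rpred1. Qed.

Lemma frac_fixed : galois 1 {:L} -> fixed_in_frac 'Gal({:L} / 1)%G frac_emb.
Proof.
move=> gal1 x fx; have : x \in (1%AS : {subfield L}).
  by rewrite -(galois_fixedField gal1); apply/fixedFieldP; rewrite ?memvf.
case/vlineP=> c ->; have [nzd Dc] := frac_split c; rewrite tofrac_eq0 in nzd.
exists (generic_quotient.repr c) => /=.
2: by rewrite -[LHS]/(in_alg L c * in_alg L (tofrac _)) -rmorphM Dc.
by rewrite -[X in _ != X](rmorph0 frac_emb) (inj_eq frac_emb_inj).
Qed.

(** The minimal polynomial of z over k(s), with denominators cleared, is a relation between s and z;
    by [ev2_generic_conj] it also holds for z', so z and z' are conjugate. *)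
Lemma frac_generic_conj (Gm : {poly {poly k}}) (q W : {poly k}) (z z' : L)
    (f := map_poly const_emb q + frac_emb 'X *: map_poly const_emb W) :
  Gm \is monic -> irreducible_poly Gm ->
  (map_poly const_emb W).[z] != 0 -> (map_poly const_emb W).[z'] != 0 ->
  (csub const_emb Gm f).[z] = 0 -> (csub const_emb Gm f).[z'] = 0 ->
  exists2 g : gal_of {:L}, g \in 'Gal({:L} / 1)%g & g z = z'.
Proof.
move=> monG irrG Wz Wz' Gz Gz'.
apply: normalField_root_minPoly; rewrite ?sub1v ?normalFieldf ?memvf //.
have /polyOver1P[p Dp] := minPolyOver 1%AS z.
have [r nzr [P DP]] := clear_denominators p.
have PE y : ev2 const_emb (frac_emb 'X) y P = frac_emb r * (minPoly 1 z).[y].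
  rewrite Dp -hornerZ -[frac_emb r]/(in_alg L (tofrac r)) -map_polyZ -DP -map_poly_comp.
  by rewrite ev2E; congr (_.[y]); apply: eq_map_poly => a; apply: (esym (frac_embE a)).
have nzer : frac_emb r != 0 by rewrite -(rmorph0 frac_emb) (inj_eq frac_emb_inj).
have f_at y : f.[y] = (map_poly const_emb q).[y] + (map_poly const_emb W).[y] * frac_emb 'X.
  by rewrite hornerD hornerZ mulrC.
have : ev2 const_emb (frac_emb 'X) z' P = 0.
  apply: (ev2_generic_conj (q := q) monG irrG frac_embX_transcendental Wz Wz').
  - by rewrite -f_at -horner_csub.
  - by rewrite -f_at -horner_csub.
  - by rewrite PE minPolyxx mulr0.
move/eqP; rewrite PE.
by rewrite mulf_eq0 (negPf nzer).
Qed.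
End FracSplitting.

Lemma frac_splitting_exists (k : fieldType) (P : {poly {poly k}}) : P != 0 ->
  exists (L : splittingFieldType {fraction {poly k}}) (rs : seq L),
    <<1 & rs>>%VS = fullv /\
    map_poly (frac_emb L) P = frac_emb L (lead_coef P) *: \prod_(x <- rs) ('X - x%:P).
Proof.
move=> nzP; have nzp : map_poly (@FracField.tofrac {poly k}) P != 0.
  by rewrite map_poly_eq0_id0 ?lead_coef_eq0 // tofrac_eq0 lead_coef_eq0.
have [L [rs Drs gen_rs]] := splitting_field_exists nzp.
exists L, rs; split=> //; move: Drs; rewrite -map_poly_comp => Drs.
have inj : injective (frac_emb L) := @frac_emb_inj k L.
have := eqp_eq Drs; rewrite (monicP (monic_prod_XsubC _ _ _)) scale1r => ->.
by rewrite (lead_coef_map_inj inj) ?rmorph0.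
Qed.

(** * Degree and leading coefficient of P(t, f(t)) *)

Lemma coef_mul_top (R : nzRingType) (p q : {poly R}) (a b : nat) :
  (size p <= a.+1)%N -> (size q <= b.+1)%N -> (p * q)`_(a + b) = p`_a * q`_b.
Proof.
move=> sp sq; rewrite coefM (bigD1 (Ordinal (leq_addr b a : (a < (a + b).+1)%N))) //= addKn.
rewrite big1 ?addr0 // => i; rewrite -val_eqE /= => ia.
have [lt|gt|eq] := ltngtP i a; last by rewrite eq eqxx in ia.
  by rewrite [q`_ _]nth_default ?mulr0 // (leq_trans sq) // ltn_subRL ltn_add2r.
by rewrite [p`_ _]nth_default ?mul0r // (leq_trans sp).
Qed.

Lemma size_coef_exp (R : nzRingType) (f : {poly R}) (n j : nat) :
  (size f <= n.+1)%N -> (size (f ^+ j) <= (j * n).+1)%N /\ (f ^+ j)`_(j * n) = f`_n ^+ j.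
Proof.
move=> sf; elim: j => [|j [IHs IHc]]; first by rewrite !expr0 mul0n size_poly1 coef1.
rewrite exprS mulSn coef_mul_top // IHc exprS; split=> //.
apply: leq_trans (size_polyMleq _ _) _; rewrite -subn1 leq_subLR.
have -> : (1 + (n + j * n).+1 = n.+1 + (j * n).+1)%N by rewrite add1n addSn addnS.
exact: leq_add.
Qed.

(** One more than the weighted degree of P, with weight 1 for t and n for x. The polynomial [clead]
    gathers the coefficients of top weight; its variable stands for the coefficient of t^n in f. *)
Definition cdeg (F : nzRingType) (n : nat) (P : {poly {poly F}}) : nat :=
  (\max_(j < size P | (P`_j != 0)%R) (size (P`_j)%R + j * n))%N.

Definition clead (F : nzRingType) (n : nat) (P : {poly {poly F}}) : {poly F} :=
  \poly_(j < size P) (if (j * n < cdeg n P)%N then P`_j`_((cdeg n P).-1 - j * n) else 0).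

Lemma size_csub (F : fieldType) (T : comNzRingType) (h : {rmorphism F -> T}) (n : nat)
    (P : {poly {poly F}}) (f : {poly T}) :
  (size f <= n.+1)%N -> 
  (size (csub h P f) <= cdeg n P)%N /\ (csub h P f)`_(cdeg n P).-1 = (map_poly h (clead n P)).[f`_n].
Proof.
move=> sf; set D := cdeg n P.
have csubE : csub h P f = \sum_(j < size P) map_poly h P`_j * f ^+ j.
  rewrite /csub horner_coef (_ : size (map_poly _ P) = size P).
    by apply: eq_bigr => j _; rewrite coef_map_id0 ?rmorph0 ?map_poly0.
  have [->|nzP] := eqVneq P 0; first by rewrite map_poly0 !size_poly0.
  by rewrite size_map_poly_id0 // map_poly_eq0 lead_coef_eq0.
have leD j : P`_j != 0 -> (size (P`_j)%R + j * n <= D)%N.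
  move=> nzj; have ltj : (j < size P)%N.
    by rewrite ltnNge; apply: contraNN nzj => /(nth_default 0) ->.
  exact: (leq_bigmax_cond (Ordinal ltj)).
have term_size j : (size (map_poly h P`_j * f ^+ j)%R <= D)%N.
  have [->|nzj] := eqVneq P`_j 0; first by rewrite rmorph0 mul0r size_poly0.
  apply: leq_trans (leD j nzj); apply: leq_trans (size_polyMleq _ _) _.
  rewrite -subn1 leq_subLR addnCA add1n.
  by apply: leq_add; [exact: size_poly | case: (size_coef_exp j sf)].
split; first by rewrite csubE; apply: (big_ind (fun p : {poly T} => size p <= D)%N);
  [rewrite size_poly0 | move=> p q sp sq; apply: leq_trans (size_polyD _ _) _; rewrite geq_max sp | ].
have szc : (size (map_poly h (clead n P)) <= size P)%N.
  by apply: leq_trans (size_poly _ _) _; apply: size_poly.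
rewrite csubE coef_sum (horner_coef_wide _ szc); apply: eq_bigr => j _.
rewrite coef_map coef_poly ltn_ord -/D.
have [->|nzj] := eqVneq P`_j 0; first by rewrite rmorph0 mul0r !coef0 if_same [X in X * _](_ : _ = 0) ?mul0r //; apply: (rmorph0 h).
have := leD j nzj; case: (D) => [|d] ltD.
  by rewrite leqn0 addn_eq0 size_poly_eq0 (negPf nzj) in ltD.
have ltjn : (j * n < d.+1)%N.
  by apply: leq_trans ltD; rewrite -add1n leq_add2r size_poly_gt0.
rewrite ltjn -[X in _`_X](subnK (ltjn : j * n <= d)%N) coef_mul_top.
- by rewrite coef_map; case: (size_coef_exp j sf) => _ ->.
- apply: leq_trans (size_poly _ _) _; rewrite -(leq_add2r (j * n)) addSn subnK //.
- by case: (size_coef_exp j sf).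
Qed.

Lemma clead_neq0 (F : fieldType) (n : nat) (P : {poly {poly F}}) : P != 0 -> 
  (0 < cdeg n P)%N /\ clead n P != 0.
Proof.
move=> nzP; have ltP : ((size P).-1 < size P)%N by rewrite prednK ?size_poly_gt0.
have nzl : P`_(Ordinal ltP) != 0 by rewrite /= -lead_coefE lead_coef_eq0.
have card : (0 < #|[pred j : 'I_(size P) | (P`_j != 0)%R]|)%N.
  by apply/card_gt0P; exists (Ordinal ltP).
have [j nzj Dj] := eq_bigmax_cond (fun j : 'I_(size P) => (size (P`_j)%R + j * n)%N) card.
have Dc : cdeg n P = (size (P`_j)%R + j * n)%N := Dj.
have nzj' : P`_j != 0 by [].
have sj : (0 < size (P`_j)%R)%N by rewrite size_poly_gt0.
split; first by rewrite Dc addn_gt0 sj.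
apply: contraNneq nzj' => c0; have := congr1 (fun p : {poly F} => p`_j) c0.
rewrite coef0 /= coef_poly ltn_ord Dc -[X in (X < _)%N]add0n ltn_add2r sj.
have -> : ((size (P`_j)%R + j * n).-1 - j * n)%N = (size (P`_j)%R).-1 by rewrite -subn1 subnAC addnK subn1.
by move/eqP; rewrite -lead_coefE lead_coef_eq0 => /eqP ->.
Qed.

(** The top coefficient is [clead n P] at the transcendental a, hence nonzero. That it is constant
    in the inner variable matters: it then survives every specialisation of that variable. *)
Lemma lead_csub (F T : fieldType) (h : {rmorphism F -> T}) (n : nat) (P : {poly {poly F}})
    (f : {poly {poly T}}) (a : T) :
  P != 0 -> (size f <= n.+1)%N -> f`_n = a%:P -> ~ algebraicOver h a ->
  exists2 u, u != 0 & lead_coef (csub (polyC \o h) P f) = u%:P.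
Proof.
move=> nzP sf fn tra; have [D0 nzc] := clead_neq0 n nzP.
have [sz cf] := size_csub (polyC \o h) P sf.
exists (map_poly h (clead n P)).[a].
  by apply/eqP => c0; apply: tra; exists (clead n P) => //; apply/eqP.
have cE : (map_poly (polyC \o h) (clead n P)).[f`_n] = (map_poly h (clead n P)).[a]%:P.
  by rewrite fn map_poly_comp horner_map.
rewrite -cE -cf lead_coefE; congr (_`_(_).-1); apply/eqP; rewrite eqn_leq sz /=.
rewrite -(prednK D0) ltnNge; apply/negP => /(nth_default 0).
rewrite cf cE => /eqP; rewrite polyC_eq0 => /eqP c0.
by apply: tra; exists (clead n P) => //; apply/eqP.
Qed.

Lemma horner_taylor1 (R : comNzRingType) (p : {poly R}) (u v : R) :
  exists w, p.[u + v] = p.[u] + p^`().[u] * v + w * v ^+ 2.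
Proof.
elim/poly_ind: p => [|p c [w IH]]; first by exists 0; rewrite deriv0 !horner0 !mul0r !addr0.
exists (p^`().[u] + w * (u + v)); rewrite derivMXaddC !hornerMXaddC hornerD hornerMX IH; ring.
Qed.

Lemma double_root_factor (F : fieldType) (p : {poly F}) (t : F) :
  p.[t] = 0 -> p^`().[t] = 0 -> exists q, p = ('X - t%:P) ^+ 2 * q.
Proof.
move=> pt; have /factor_theorem[r ->] : root p t by apply/eqP.
rewrite derivM hornerD !hornerM hornerXsubC subrr mulr0 add0r derivXsubC hornerC mulr1.
by move=> rt; have /factor_theorem[q ->] : root r t by [apply/eqP]; exists q; ring.
Qed.

(** * The generic polynomial f *)

Lemma mconst_is_zmod_morphism (R : idomainType) (k : nat) : zmod_morphism (@mconst R k).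
Proof. by elim: k => //= k IH a b; rewrite IH polyCB. Qed.

Lemma mconst_is_monoid_morphism (R : idomainType) (k : nat) : monoid_morphism (@mconst R k).
Proof. by elim: k => //= k [IH1 IHM]; split=> [|a b]; rewrite ?IH1 ?IHM ?polyCM. Qed.

HB.instance Definition _ (R : idomainType) (k : nat) :=
  GRing.isZmodMorphism.Build R (mpolyR R k) (@mconst R k) (@mconst_is_zmod_morphism R k).
HB.instance Definition _ (R : idomainType) (k : nat) :=
  GRing.isMonoidMorphism.Build R (mpolyR R k) (@mconst R k) (@mconst_is_monoid_morphism R k).

Definition frac_const (k : fieldType) : {rmorphism k -> {fraction {poly k}}} :=
  @FracField.tofrac {poly k} \o polyC.
Definition frac_var (k : fieldType) : {fraction {poly k}} := tofrac 'X.

Lemma poly_map_horner (R : comNzRingType) (S : comNzRingType) (u : {rmorphism {poly R} -> S}) (p : {poly R}) :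
  (map_poly (u \o polyC) p).[u 'X] = u p.
Proof.
rewrite map_poly_comp horner_map; congr (u _).
elim/poly_ind: p => [|p c IH]; first by rewrite map_poly0 horner0.
by rewrite rmorphD rmorphM /= map_polyC map_polyX hornerMXaddC IH.
Qed.

Lemma frac_var_transcendental (k : fieldType) : ~ algebraicOver (frac_const k) (frac_var k).
Proof.
move=> [p nzp]; rewrite /root poly_map_horner /= tofrac_eq0.
by rewrite (negPf nzp).
Qed.

Lemma transcendental_notin (k T : fieldType) (h : {rmorphism k -> T}) (x : T) :
  ~ algebraicOver h x -> forall y, h y != x.
Proof. by move=> trx y; apply/eqP => Dx; apply: trx; rewrite -Dx; apply: algebraic_id. Qed.

Lemma transcendental_affine (k T : fieldType) (h : {rmorphism k -> T}) (x : T) (a b : k) :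
  ~ algebraicOver h x -> a != 0 -> ~ algebraicOver h (h b + h a * x).
Proof.
move=> trx nza alg; apply: trx.
have -> : x = (h b + h a * x - h b) / h a by rewrite addrC addKr mulrC mulKf ?fmorph_eq0.
apply: algebraic_div; last exact: algebraic_id.
by apply: algebraic_sub => //; apply: algebraic_id.
Qed.

Lemma transcendental_comp (k T T' : fieldType) (h : {rmorphism k -> T}) (u : {rmorphism T -> T'}) (x : T) :
  ~ algebraicOver h x -> ~ algebraicOver (u \o h) (u x).
Proof. by move=> trx [p nzp]; rewrite map_poly_comp fmorph_root => rp; apply: trx; exists p. Qed.

Lemma transcendental_sub (F k T : fieldType) (c : {rmorphism F -> k}) (h : {rmorphism k -> T}) (x : T) :
  ~ algebraicOver h x -> ~ algebraicOver (h \o c) x.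
Proof.
move=> trx [p nzp]; rewrite map_poly_comp => rp; apply: trx.
by exists (map_poly c p); rewrite ?map_poly_eq0.
Qed.

Definition poly_ext (A : idomainType) (k T : fieldType) (u : {rmorphism A -> k})
    (j : {rmorphism k -> T}) (x : T) : {rmorphism {poly A} -> T} :=
  horner_eval x \o map_poly (j \o u).

Lemma poly_ext_inj (A : idomainType) (k T : fieldType) (u : {rmorphism A -> k})
    (j : {rmorphism k -> T}) (x : T) :
  injective u -> ~ algebraicOver j x -> injective (poly_ext u j x).
Proof.
move=> inju trx; apply: raddf_inj => p /= p0; apply/eqP/contraT => nzp; case: trx.
exists (map_poly u p); last by rewrite /root -map_poly_comp; apply/eqP.
by rewrite map_poly_eq0_id0 // -(rmorph0 u) (inj_eq inju) lead_coef_eq0.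
Qed.

Lemma poly_extC (A : idomainType) (k T : fieldType) (u : {rmorphism A -> k})
    (j : {rmorphism k -> T}) (x : T) a : poly_ext u j x a%:P = j (u a).
Proof. by rewrite /= map_polyC /horner_eval hornerC. Qed.

Lemma poly_extX (A : idomainType) (k T : fieldType) (u : {rmorphism A -> k})
    (j : {rmorphism k -> T}) (x : T) : poly_ext u j x 'X = x.
Proof. by rewrite /= map_polyX /horner_eval hornerX. Qed.

Section GenericPolynomial.
Variables (Fm : fieldType) (N : nat).
Local Notation R := (mpolyR Fm N).

(* The coefficients a_4, ..., a_(N+3) are the variables N-1, ..., 0 of mpolyR Fm N, so that
   a_0, a_1, a_2, a_3 may be adjoined last. *)
Definition high_coefs : {poly R} := \poly_(i < N) mvar Fm N (N - i.+1).

Definition gen_poly (T : nzRingType) (g : R -> T) (a0 a1 a2 a3 : T) : {poly T} :=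
  a0%:P + a1%:P * 'X + a2%:P * 'X^2 + a3%:P * 'X^3 + map_poly g high_coefs * 'X^4.

Lemma eq_gen_poly (T : nzRingType) (g g' : R -> T) a0 a1 a2 a3 :
  g =1 g' -> gen_poly g a0 a1 a2 a3 = gen_poly g' a0 a1 a2 a3.
Proof. by move=> gg'; rewrite /gen_poly (eq_map_poly gg'). Qed.

Lemma coef_gen_poly (T : nzRingType) (g : {rmorphism R -> T}) a0 a1 a2 a3 i :
  (gen_poly g a0 a1 a2 a3)`_i = 
    if i is j.+4 then g high_coefs`_j else [:: a0; a1; a2; a3]`_i.
Proof.
rewrite !coefD !coefCM coefMXn coefX !coefXn coefC coef_map.
by case: i => [|[|[|[|i]]]]; rewrite /= ?mulr0 ?mulr1 ?addr0 ?add0r // subSS subSS subSS subSS subn0.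
Qed.

Lemma map_gen_poly (T T' : nzRingType) (g : {rmorphism R -> T}) (u : {rmorphism T -> T'}) a0 a1 a2 a3 :
  map_poly u (gen_poly g a0 a1 a2 a3) = gen_poly (u \o g) (u a0) (u a1) (u a2) (u a3).
Proof.
apply/polyP=> i; rewrite coef_map !coef_gen_poly.
by case: i => [|[|[|[|i]]]] //=; rewrite nth_nil rmorph0.
Qed.

Lemma size_gen_poly (T : nzRingType) (g : {rmorphism R -> T}) a0 a1 a2 a3 :
  (size (gen_poly g a0 a1 a2 a3) <= N.+4)%N.
Proof.
apply/leq_sizeP => j; rewrite coef_gen_poly; case: j => [|[|[|[|j]]]] //.
by rewrite !ltnS => ltj; rewrite nth_default ?rmorph0 // (leq_trans (size_poly _ _)).
Qed.

(** The variable 0 is a_(N+3) when N > 0; for N = 0 the polynomial is a cubic with top coefficient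
    a_3. *)
Definition top_coef (T : Type) (g : R -> T) (a3 : T) : T :=
  if N is _.+1 then g (mvar Fm N 0) else a3.

Lemma gen_poly_top (T : nzRingType) (g : {rmorphism R -> T}) a0 a1 a2 a3 :
  (gen_poly g a0 a1 a2 a3)`_N.+3 = top_coef g a3.
Proof.
rewrite coef_gen_poly /top_coef; move: g; rewrite /high_coefs.
by case: N => [|M] g //; rewrite coef_poly ltnSn subnn.
Qed.
End GenericPolynomial.

Lemma mvar0_transcendental (Fm : fieldType) (M : nat) (p : {poly Fm}) :
  p != 0 -> (map_poly (@mconst Fm M.+1) p).[mvar Fm M.+1 0] != 0.
Proof.
move=> nzp; elim: M => [|M IH].
  rewrite /= (_ : (map_poly _ p).[_] = p) //.
  elim/poly_ind: p {nzp} => [|p c IH]; first by rewrite map_poly0 horner0.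
  by rewrite (rmorphD (map_poly polyC)) rmorphM /= map_polyC map_polyX hornerMXaddC IH.
have -> : mvar Fm M.+2 0 = (mvar Fm M.+1 0)%:P by [].
have -> : map_poly (@mconst Fm M.+2) p = map_poly polyC (map_poly (@mconst Fm M.+1) p).
  by rewrite -map_poly_comp.
by rewrite horner_map polyC_eq0.
Qed.

Lemma top_coef_transcendental (Fm : fieldType) (N : nat) (k T : fieldType)
    (g : {rmorphism mpolyR Fm N -> k}) (j : {rmorphism k -> T}) (a3 : T) :
  injective g -> ~ algebraicOver j a3 ->
  ~ algebraicOver (j \o g \o @mconst Fm N) (top_coef (j \o g) a3).
Proof.
move=> injg tra3; case: N g injg => [|M] g injg.
  by move=> [p nzp rp]; apply: tra3; exists (map_poly g p); rewrite ?map_poly_eq0 // -map_poly_comp.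
move=> [p nzp]; rewrite /top_coef map_poly_comp /root horner_map /= fmorph_eq0.
rewrite -(rmorph0 g) (inj_eq injg) => p0.
by move: (mvar0_transcendental M nzp); rewrite p0.
Qed.

Lemma frac_poly_lift (A : idomainType) (E T : fieldType) (fr : fraction_map A E)
    (h : {rmorphism A -> T}) (x : T) :
  injective (horner_eval x \o map_poly h) ->
  exists e : {rmorphism {poly E} -> T},
    [/\ injective e, forall p, e (map_poly fr p) = (map_poly h p).[x],
        forall c, e (fr c)%:P = h c & e 'X = x].
Proof.
move=> inj_hx; have inj_h : injective h.
  by move=> c d Dcd; apply/polyC_inj/inj_hx; rewrite /= !map_polyC /horner_eval !hornerC.
have [h' Dh'] := frac_map_lift fr inj_h.
pose e : {rmorphism {poly E} -> T} := horner_eval x \o map_poly h'.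
have eE p : e (map_poly fr p) = (map_poly h p).[x].
  by rewrite /= -map_poly_comp; congr (_.[x]); apply: eq_map_poly.
exists e; split; [|exact: eE|move=> c|]; last 2 first.
- rewrite /= map_polyC /horner_eval hornerC; exact: Dh'.
- by rewrite /= map_polyX /horner_eval hornerX.
apply: raddf_inj => p p0; apply/eqP/contraT => nzp.
have [r nzr [P DP]] := frac_map_clear fr p.
have P0 : (map_poly h P).[x] = 0 by rewrite -eE DP -mul_polyC rmorphM p0 mulr0.
have P_eq0 : P = 0 by apply: inj_hx; rewrite /= /horner_eval P0 rmorph0 horner0.
move: DP; rewrite P_eq0 rmorph0 => /esym/eqP; rewrite scaler_eq0 (negPf nzp) orbF.
by rewrite -(rmorph0 fr) (inj_eq (@frac_map_inj _ _ fr)) (negPf nzr).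
Qed.

Lemma poly_morph_ext (A S : nzRingType) (s1 s2 : {rmorphism {poly A} -> S}) :
  (forall c, s1 c%:P = s2 c%:P) -> s1 'X = s2 'X -> s1 =1 s2.
Proof.
move=> eqC eqX; elim/poly_ind=> [|p c IH]; first by rewrite !rmorph0.
by rewrite !rmorphD !rmorphM /= IH eqX eqC.
Qed.

Section CoefField.
Variables (Fm : fieldType) (N : nat).
Local Notation R := (mpolyR Fm N).
Local Notation R3 := {poly {poly {poly R}}}.
(* E is F_m(a_n, ..., a_1); the ring E[a_0] is principal and has generic f over it. *)
Variables (E : fieldType) (fr : fraction_map R3 E).

Definition coef_emb : {rmorphism R -> E} := fr \o (polyC \o (polyC \o polyC)).
Definition coef_const : {rmorphism Fm -> E} := coef_emb \o @mconst Fm N.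
Definition gcoef3 : E := fr 'X%:P%:P.
Definition gcoef2 : E := fr 'X%:P.
Definition gcoef1 : E := fr 'X.
Definition generic_f : {poly {poly E}} :=
  gen_poly (polyC \o coef_emb) 'X gcoef1%:P gcoef2%:P gcoef3%:P.

(** A map on [R3] extends to its fraction field once it is injective, and injectivity is obtained
    one variable at a time along the tower: a_3, then a_2, then a_1. *)
Lemma coef_field_lift (k1 k2 k3 Om : fieldType) (g : {rmorphism R -> k1})
    (j1 : {rmorphism k1 -> k2}) (j2 : {rmorphism k2 -> k3}) (j3 : {rmorphism k3 -> Om})
    (x3 : k2) (x2 : k3) (x1 : Om) :
  injective g -> ~ algebraicOver j1 x3 -> ~ algebraicOver j2 x2 -> ~ algebraicOver j3 x1 ->
  exists psi : {rmorphism E -> Om},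
    [/\ psi \o coef_emb =1 j3 \o (j2 \o (j1 \o g)), psi gcoef3 = j3 (j2 x3),
        psi gcoef2 = j3 x2 & psi gcoef1 = x1].
Proof.
move=> injg tr3 tr2 tr1.
have inj3 := poly_ext_inj injg tr3; have inj2 := poly_ext_inj inj3 tr2.
have [psi Dpsi] := frac_map_lift fr (poly_ext_inj inj2 tr1).
exists psi; split=> [a||| ]; rewrite ?[LHS]Dpsi ?poly_extC ?poly_extX //.
Qed.

Lemma fr_neq0 a : a != 0 -> fr a != 0.
Proof. by rewrite -[X in _ -> _ != X](rmorph0 fr) (inj_eq (@frac_map_inj _ _ fr)). Qed.

Lemma coef_field_ext (T : fieldType) (s1 s2 : {rmorphism E -> T}) :
  s1 \o coef_emb =1 s2 \o coef_emb -> s1 gcoef3 = s2 gcoef3 ->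
  s1 gcoef2 = s2 gcoef2 -> s1 gcoef1 = s2 gcoef1 -> s1 =1 s2.
Proof.
move=> eqE eq3 eq2 eq1; apply: (frac_map_ext (fr := fr)).
suff: s1 \o fr =1 s2 \o fr by [].
apply: poly_morph_ext => [p1|]; last exact: eq1.
pose t1 := fr \o polyC; suff: s1 \o t1 =1 s2 \o t1 by apply.
apply: poly_morph_ext => [p2|]; last exact: eq2.
pose t2 := t1 \o polyC; suff: s1 \o t2 =1 s2 \o t2 by apply.
by apply: poly_morph_ext => [p3|]; [apply: eqE | apply: eq3].
Qed.

End CoefField.

Lemma coef_top_transcendental (Fm : fieldType) (N : nat) (E : fieldType)
    (fr : fraction_map {poly {poly {poly mpolyR Fm N}}} E) :
  ~ algebraicOver (coef_const fr) (top_coef (coef_emb fr) (gcoef3 fr)).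
Proof.
case: N fr => [|M] fr [p nzp]; apply/negP.
  pose u : {rmorphism {poly Fm} -> E} := fr \o (polyC \o polyC).
  rewrite /root (_ : _.[_] = u p); last exact: poly_map_horner u p.
  by apply: fr_neq0; rewrite !polyC_eq0.
rewrite /root /top_coef map_poly_comp horner_map; apply: fr_neq0; rewrite !polyC_eq0.
exact: mvar0_transcendental.
Qed.

Lemma top_coef_map (Fm : fieldType) (N : nat) (T T' : Type) (g : mpolyR Fm N -> T) (u : T -> T') a :
  top_coef (u \o g) (u a) = u (top_coef g a).
Proof. by rewrite /top_coef; case: N g. Qed.

Lemma exists_transcendental (k : fieldType) :
  exists (k' : fieldType) (j : {rmorphism k -> k'}) (x : k'), ~ algebraicOver j x.
Proof. by exists {fraction {poly k}}, (frac_const k), (frac_var k); apply: frac_var_transcendental. Qed.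

(** The base field E(s) and its embedding are hidden behind existentials. The clause on fixed
    elements is conditional because distinct roots are what makes the extension Galois, and they are
    established only later. *)
Lemma rational_splitting (E : fieldType) (P : {poly {poly E}}) : P != 0 ->
  exists (M : fieldType) (L : splittingFieldType M) (eps : {rmorphism {poly E} -> L})
    (G : {group gal_of {:L}}) (rs : seq L),
  [/\ injective eps /\ <<1 & rs>>%VS = fullv,
      map_poly eps P = eps (lead_coef P) *: \prod_(x <- rs) ('X - x%:P),
      forall g a, g \in G -> g (eps a) = eps a,
      (uniq rs -> fixed_in_frac G eps) &
      forall (Gm : {poly {poly E}}) (q W : {poly E}) (z z' : L)
        (h := eps \o polyC : {rmorphism E -> L})
        (f := map_poly h q + eps 'X *: map_poly h W),
        Gm \is monic -> irreducible_poly Gm -> (map_poly h W).[z] != 0 -> (map_poly h W).[z'] != 0 ->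
        (csub h Gm f).[z] = 0 -> (csub h Gm f).[z'] = 0 -> exists2 g, g \in G & g z = z'].
Proof.
move=> nzP; have [L [rs [gen_rs rsE]]] := frac_splitting_exists nzP.
exists {fraction {poly E}}, L, (frac_emb L), 'Gal({:L} / 1)%G, rs; split=> //.
- by split=> //; apply: frac_emb_inj.
- by move=> g a; apply: gal_frac_emb.
- move=> urs; apply: frac_fixed; apply: galois_of_uniq_roots gen_rs _ urs.
  have nzl : frac_emb L (lead_coef P) != 0.
    by rewrite -[X in _ != X](rmorph0 (frac_emb L)) (inj_eq (@frac_emb_inj E L)) lead_coef_eq0.
  rewrite -(scalerK nzl (\prod_(_ <- _) _)) -rsE polyOverZ //.
    by rewrite rpredV; apply/vlineP; exists (tofrac (lead_coef P)).
  rewrite map_poly_comp; apply/polyOver1P; eexists; reflexivity.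
- move=> Gm q W z z' h f; exact: (frac_generic_conj (q := q) (W := W)).
Qed.

Lemma root_in_extension (F : fieldType) (p : {poly F}) : (1 < size p)%N ->
  exists (F' : fieldType) (h : {rmorphism F -> F'}) (x : F'), root (map_poly h p) x.
Proof.
move=> p_gt1; have nzp : p != 0 by rewrite -size_poly_gt0 ltnW.
have [L [[|x rs] Drs _]] := splitting_field_exists nzp.
  by move: p_gt1; rewrite -(size_map_poly (in_alg L)) (eqp_size Drs) big_nil size_poly1.
by exists L, (in_alg L), x; rewrite (eqp_root Drs) root_prod_XsubC mem_head.
Qed.

(** The generic point is built over an extension of the fraction field of R, so that the higher
    coefficients of f stay free while f is made to pass through it. *)
Lemma curve_point (Fm : fieldType) (R : idomainType) (c : {rmorphism Fm -> R}) (Gm : {poly {poly Fm}}) :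
  Gm \is monic -> (1 < size Gm)%N ->
  exists (k : fieldType) (g : {rmorphism R -> k}) (t x : k),
    [/\ injective g, ~ algebraicOver (g \o c) t & ev2 (g \o c) t x Gm = 0].
Proof.
move=> monG G_gt1; pose F0 : fieldType := {fraction R}.
have [F1 [j [t trt]]] := exists_transcendental F0.
pose u : {rmorphism Fm -> F1} := j \o (@FracField.tofrac R \o c).
have [|k [h [x rx]]] := root_in_extension (p := map_poly (horner_eval t \o map_poly u) Gm).
  by rewrite size_map_poly_id0 // (monicP monG) rmorph1 oner_eq0.
exists k, (h \o (j \o @FracField.tofrac R)), (h t), x; split.
- by move=> a b /fmorph_inj/fmorph_inj/eqP; rewrite tofrac_eq => /eqP.
- have tr' : ~ algebraicOver (j \o (@FracField.tofrac R \o c)) t by exact: transcendental_sub.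
  by move=> [p nzp rp]; apply: (transcendental_comp (u := h) tr'); exists p.
- move/eqP: rx; rewrite -map_poly_comp ev2E => rx; rewrite -[RHS]rx; congr (_.[_]).
  by apply: eq_map_poly => p; rewrite /= /horner_eval -horner_map /= -map_poly_comp.
Qed.

Lemma deriv_csub_at (F T : comNzRingType) (h : {rmorphism F -> T}) (G : {poly {poly F}})
    (f : {poly T}) (z : T) :
  ((csub h G f)^`()).[z] = ev2 h z f.[z] (map_poly (@deriv F) G) + ev2 h z f.[z] G^`() * (f^`()).[z].
Proof.
rewrite /csub deriv_horner2 hornerD hornerM; congr (_ + _ * _).
  rewrite -horner_csub /csub; congr (_.[_].[_]).
  rewrite -!map_poly_comp_id0 ?deriv0 ?raddf0 //.
  by apply: eq_map_poly => p /=; rewrite deriv_map.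
by rewrite -horner_csub /csub deriv_map.
Qed.

Lemma ev2_map (F T T' : comNzRingType) (h : {rmorphism F -> T}) (u : {rmorphism T -> T'})
    (g : {rmorphism F -> T'}) z x P :
  g =1 u \o h -> ev2 g (u z) (u x) P = u (ev2 h z x P).
Proof.
move=> Dg; rewrite !ev2E -horner_map -map_poly_comp; congr (_.[_]).
apply: eq_map_poly => p /=; rewrite /horner_eval -horner_map -map_poly_comp; congr (_.[_]).
exact: eq_map_poly.
Qed.

Lemma split_factor (F : fieldType) (I : finType) (p : I -> {poly F}) (c : F) (s : seq F) :
  c != 0 -> \prod_i p i = c *: \prod_(x <- s) ('X - x%:P) ->
  exists r : I -> seq F, forall i, exists c, p i = c *: \prod_(x <- r i) ('X - x%:P).
Proof.
move=> nzc Dp; suff: forall i, exists r, exists c, p i = c *: \prod_(x <- r) ('X - x%:P).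
  by case/fin_all_exists=> r Dr; exists r.
move=> i; have : p i %| \prod_(x <- s) ('X - x%:P).
  by rewrite -(dvdpZr _ _ nzc) -Dp (bigD1 i) //= dvdp_mulr.
case/dvdp_prod_XsubC=> m /eqp_eq; set q := \prod_(_ <- _) _ => Dm.
exists (mask m s), (lead_coef (p i)).
by rewrite -Dm (monicP (monic_prod_XsubC _ _ _)) scale1r.
Qed.

Lemma uniq_map_inj (T1 T2 : eqType) (f : T1 -> T2) (s : seq T1) :
  uniq (map f s) -> {in s &, injective f}.
Proof.
elim: s => //= x s IH /andP[fx us] y z; rewrite !inE.
move=> /orP[/eqP->|ys] /orP[/eqP->|zs] // fyz; last exact: IH.
  by case/negP: fx; rewrite fyz map_f.
by case/negP: fx; rewrite -fyz map_f.
Qed.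

Lemma solve_affine (F : fieldType) (a b c x : F) : b != 0 -> a + b * (c + x) = 0 -> x = - (a / b) - c.
Proof.
move=> nzb H; have -> : x = (a + b * (c + x)) / b - a / b - c by field.
by rewrite H mul0r sub0r.
Qed.

Lemma splits_in_extension (F : fieldType) (p : {poly F}) : p != 0 ->
  exists (F' : fieldType) (h : {rmorphism F -> F'}) (s : seq F'),
    map_poly h p = h (lead_coef p) *: \prod_(x <- s) ('X - x%:P).
Proof.
move=> nzp; have [L [s Ds _]] := splitting_field_exists nzp.
exists L, (in_alg L), s; have := eqp_eq Ds.
by rewrite (monicP (monic_prod_XsubC _ _ _)) scale1r lead_coef_map => ->.
Qed.

Lemma prod_simple_root (F : fieldType) (I : finType) (p : I -> {poly F}) (z : F) :
  (forall i, (p i).[z] = 0 -> ((p i)^`()).[z] != 0) ->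
  (forall i j, (p i).[z] = 0 -> (p j).[z] = 0 -> i = j) ->
  (\prod_i p i).[z] = 0 -> ((\prod_i p i)^`()).[z] != 0.
Proof.
move=> simple disj /eqP; rewrite horner_prod prodf_seq_eq0 => /hasP[i _ /andP[_ /eqP pi0]].
rewrite (bigD1 i) //= derivM hornerD !hornerM pi0 mul0r addr0 mulf_neq0 ?simple //.
rewrite horner_prod; apply/prodf_neq0 => j; apply: contraNneq => pj0.
by rewrite (disj j i).
Qed.

Lemma coefp1_horner (F : comNzRingType) (A : {poly {poly F}}) (t : F) :
  (map_poly (coefp 1) A).[t] = (A.[t%:P])`_1.
Proof.
rewrite (horner_coef_wide _ (size_poly _ _)) horner_coef coef_sum; apply: eq_bigr => i _.
rewrite coef_map_id0 /=; last by rewrite coef0.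
by rewrite -polyC_exp coefMC.
Qed.

Lemma transcendental_neq0 (F T : fieldType) (h : {rmorphism F -> T}) (t : T) :
  ~ algebraicOver h t -> t != 0.
Proof. by move=> trt; apply/eqP => t0; apply: trt; rewrite t0; apply: algebraic0. Qed.

Lemma count_neq_lt (T : eqType) (P : pred T) (s : seq T) (x : T) : x \in s -> P x ->
  (count [pred z | P z && (z != x)] s < count P s)%N.
Proof.
elim: s => //= y s IHs; rewrite inE => /predU1P[<- Px | xs Px].
  by rewrite eqxx Px /= add0n add1n ltnS; apply: sub_count => z /andP[].
by rewrite -addnS leq_add ?IHs //; case: (P y); case: (y == x).
Qed.

(** * The geometric Galois group *)

Section Core.
Variables (Fm : fieldType) (N : nat) (I : finType) (Gam : I -> {poly {poly Fm}}).
Hypothesis Gam_monic : forall i, Gam i \is monic.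
Hypothesis Gam_irr : forall i, abs_irreducible (Gam i).
Hypothesis Gam_sep : forall i, (Gam i)^`() != 0.
Hypothesis Gam_inj : injective Gam.
Local Notation R := (mpolyR Fm N).
Variables (E1 : fieldType) (emb : {rmorphism R -> E1}) (c1 c2 c3 : E1).
Hypothesis top_transcendental : ~ algebraicOver (emb \o @mconst Fm N) (top_coef emb c3).
Hypothesis coef_lift : forall (k1 k2 k3 Om : fieldType) (g : {rmorphism R -> k1})
    (j1 : {rmorphism k1 -> k2}) (j2 : {rmorphism k2 -> k3}) (j3 : {rmorphism k3 -> Om})
    (x3 : k2) (x2 : k3) (x1 : Om),
  injective g -> ~ algebraicOver j1 x3 -> ~ algebraicOver j2 x2 -> ~ algebraicOver j3 x1 ->
  exists psi : {rmorphism E1 -> Om},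
    [/\ psi \o emb =1 j3 \o (j2 \o (j1 \o g)), psi c3 = j3 (j2 x3), psi c2 = j3 x2 & psi c1 = x1].
Local Notation n := N.+3.

Definition generic_val (i : I) : {poly {poly E1}} :=
  csub (polyC \o (emb \o @mconst Fm N)) (Gam i) (gen_poly (polyC \o emb) 'X c1%:P c2%:P c3%:P).

Lemma lead_generic_val i : exists2 u, u != 0 & lead_coef (generic_val i) = u%:P.
Proof.
apply: (@lead_csub _ _ _ n _ _ (top_coef emb c3)).
- exact: monic_neq0.
- exact: (size_gen_poly (polyC \o emb)).
- by rewrite (gen_poly_top (polyC \o emb)) top_coef_map.
- exact: top_transcendental.
Qed.

Hypothesis coef_ext : forall (T : fieldType) (s1 s2 : {rmorphism E1 -> T}),
  s1 \o emb =1 s2 \o emb -> s1 c3 = s2 c3 -> s1 c2 = s2 c2 -> s1 c1 = s2 c1 -> s1 =1 s2.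

Variables (K : fieldType) (L : splittingFieldType K) (e : {rmorphism {poly E1} -> L}).
Variables (rs : I -> seq L) (G : {group gal_of {:L}}).
Hypothesis e_inj : injective e.
Hypothesis rsE : forall i, map_poly e (generic_val i) =
  e (lead_coef (generic_val i)) *: \prod_(x <- rs i) ('X - x%:P).
Hypothesis Gfix : forall g a, g \in G -> g (e a) = e a.

Lemma e_lead_neq0 i : e (lead_coef (generic_val i)) != 0.
Proof.
have [u nzu ->] := lead_generic_val i.
by rewrite -[X in _ != X](rmorph0 e) (inj_eq e_inj) polyC_eq0.
Qed.

Lemma rs_stable i : gal_stable G (rs i).
Proof. exact: gal_stable_roots (e_lead_neq0 i) (rsE i) Gfix. Qed.

(** A single place adjoins the roots for all curves together, so that one g describes tau on all of
    them. *)
Lemma core_spec (Om : fieldType) (psi : {rmorphism E1 -> Om}) (a0 : Om) (rhos : I -> seq Om)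
    (f := gen_poly (psi \o emb) a0 (psi c1) (psi c2) (psi c3)) :
  (forall i, exists c, csub (psi \o (emb \o @mconst Fm N)) (Gam i) f = c *: \prod_(r <- rhos i) ('X - r%:P)) ->
  exists rho : L -> Om,
  (forall i, exists2 c, c != 0 &
     csub (psi \o (emb \o @mconst Fm N)) (Gam i) f = c *: \prod_(x <- rs i) ('X - (rho x)%:P)) /\
  (fixed_in_frac G e -> forall tau : {rmorphism Om -> Om}, (forall a, tau (psi a) = psi a) -> tau a0 = a0 ->
     exists2 g, g \in G & forall i x, x \in rs i -> tau (rho x) = rho (g x)).
Proof.
move=> split_f.
have [phi phiE] : exists phi : {rmorphism {poly E1} -> Om}, forall p, phi p = (map_poly psi p).[a0].
  by exists (horner_eval a0 \o map_poly psi).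
have phiC a : phi a%:P = psi a by rewrite phiE map_polyC hornerC.
have phiX : phi 'X = a0 by rewrite phiE map_polyX hornerX.
have phi_f : map_poly phi (gen_poly (polyC \o emb) 'X c1%:P c2%:P c3%:P) = f.
  by rewrite map_gen_poly phiX !phiC; apply: eq_gen_poly => a; apply: phiC.
have phi_val i : map_poly phi (generic_val i) = csub (psi \o (emb \o @mconst Fm N)) (Gam i) f.
  rewrite -phi_f; apply: map_csub => a /=; exact: (esym (phiC _)).
have phi_lead i : phi (lead_coef (generic_val i)) != 0.
  by have [u nzu ->] := lead_generic_val i; rewrite phiC fmorph_eq0.
have ker a : e a = 0 -> phi a = 0 by rewrite -[0](rmorph0 e) => /e_inj ->; rewrite rmorph0.
pose P := \prod_i generic_val i; pose allrs := flatten [seq rs i | i : I].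
have leadP : lead_coef P = \prod_i lead_coef (generic_val i) by rewrite lead_coef_prod.
have rs_all i x : x \in rs i -> x \in allrs.
  by move=> xi; apply/flatten_mapP; exists i; rewrite ?mem_enum.
have rootP x : x \in allrs -> root (map_poly e P) x.
  case/flatten_mapP=> i _ xi; rewrite rmorph_prod (bigD1 i) //= rootM rsE.
  by rewrite rootZ ?root_prod_XsubC ?xi // e_lead_neq0.
have phi_leadP : phi (lead_coef P) != 0 by rewrite leadP rmorph_prod; apply/prodf_neq0.
have split_P : map_poly phi P = phi (lead_coef P) *:
    \prod_(r <- flatten [seq rhos i | i : I]) ('X - r%:P).
  rewrite leadP !rmorph_prod /= -mul_polyC rmorph_prod /= big_flatten big_map big_enum /=.
  rewrite -big_split /=; apply: eq_bigr => i _; rewrite phi_val mul_polyC.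
  have [c Dc] := split_f i; rewrite Dc; congr (_ *: _).
  have := congr1 lead_coef Dc; rewrite lead_coefZ (monicP (monic_prod_XsubC _ _ _)) mulr1 => <-.
  rewrite -phi_val lead_coef_map_eq //; exact: phi_lead.
have [pl [b lift]] := place_exists ker phi_leadP rootP split_P.
exists (fun x => pl_tgt pl (b x)); split=> [i|fixG tau tau_psi tau_a0].
  exists (phi (lead_coef (generic_val i))) => //.
  by rewrite -phi_val (place_split (b := b) _ (rsE i)) // => x /rs_all/lift.
have tau_phi a : tau (phi a) = phi a.
  rewrite phiE -horner_map tau_a0 /= -map_poly_comp; congr (_.[_]).
  by apply: eq_map_poly => c; apply: tau_psi.
have stab : gal_stable G allrs.
  move=> g x gG /flatten_mapP[i _ xi]; apply: (rs_all i); exact: rs_stable.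
have [g gG Dg] := spec_gal lift fixG stab tau_phi.
by exists g => // i x /rs_all; apply: Dg.
Qed.

Lemma Gam_irreducible i : irreducible_poly (Gam i).
Proof.
have := Gam_irr i (idfun : {rmorphism Fm -> Fm}).
by rewrite map_poly_id // => p _; rewrite map_poly_id.
Qed.

Lemma Gam_size i : (1 < size (Gam i))%N.
Proof. by case: (Gam_irreducible i). Qed.

(** By [algebraic_coprime] a polynomial vanishing at a generic point of the curve is a multiple of
    its equation. The x-derivative has too small a degree for this, and the other equations are
    irreducible, monic and different. *)
Lemma curve_regular (T : fieldType) (h : {rmorphism Fm -> T}) (t x : T) i :
  ~ algebraicOver h t -> ev2 h t x (Gam i) = 0 ->
  ev2 h t x (Gam i)^`() != 0 /\ forall j, j != i -> ev2 h t x (Gam j) != 0.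
Proof.
move=> trt Gt; split=> [|j ji]; apply/eqP => H0;
  have [Q DQ] := algebraic_coprime (Gam_monic i) (Gam_irreducible i) trt Gt H0.
  have : Gam i %| (Gam i)^`() by rewrite DQ dvdp_mull.
  move/(dvdp_leq (Gam_sep i)); rewrite leqNgt lt_size_deriv //; exact: monic_neq0.
case/eqP: ji; apply: Gam_inj.
have Gij : Gam i %| Gam j by rewrite DQ dvdp_mull.
have : Gam i %= Gam j.
  by apply: (Gam_irreducible j).2 => //; case: (Gam_irreducible i) => szG _; rewrite gtn_eqF.
by move/eqp_eq; rewrite !(monicP (Gam_monic _)) !scale1r.
Qed.

(* Specialising f to the pencil q + s W over k(s), the transcendental s entering a_0 and a_1. *)
Lemma pencil_specialization (k1 k2 k : fieldType) (g : {rmorphism R -> k1})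
    (j1 : {rmorphism k1 -> k2}) (j2 : {rmorphism k2 -> k}) (x3 : k2) (x2 alpha : k)
    (q W : {poly k})
    (ck := (j2 \o j1) \o (g \o @mconst Fm N) : {rmorphism Fm -> k})
    (fk := map_poly polyC q + 'X *: map_poly polyC W : {poly {poly k}})
    (val := fun j => csub (polyC \o ck) (Gam j) fk) :
  injective g -> ~ algebraicOver j1 x3 -> ~ algebraicOver j2 x2 ->
  fk = gen_poly (polyC \o (j2 \o (j1 \o g))) fk`_0 ('X + alpha%:P) x2%:P (j2 x3)%:P ->
  (forall j, exists2 u, u != 0 & lead_coef (val j) = u%:P) /\
  exists (M : fieldType) (LA : splittingFieldType M) (eps : {rmorphism {poly k} -> LA})
    (GA : {group gal_of {:LA}}) (rsA : seq LA) (rho : L -> LA),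
  [/\ [/\ injective eps, <<1 & rsA>>%VS = fullv & 
         map_poly eps (\prod_j val j) = eps (lead_coef (\prod_j val j)) *: \prod_(x <- rsA) ('X - x%:P)],
      (forall g a, g \in GA -> g (eps a) = eps a) /\ (uniq rsA -> fixed_in_frac GA eps),
      forall (Gm : {poly {poly k}}) (z z' : LA) (h := eps \o polyC : {rmorphism k -> LA})
        (f := map_poly h q + eps 'X *: map_poly h W),
        Gm \is monic -> irreducible_poly Gm -> (map_poly h W).[z] != 0 -> (map_poly h W).[z'] != 0 ->
        (csub h Gm f).[z] = 0 -> (csub h Gm f).[z'] = 0 -> exists2 g, g \in GA & g z = z',
      forall j, exists2 c, c != 0 &
        csub ((eps \o polyC) \o ck) (Gam j) (map_poly (eps \o polyC) q + eps 'X *: map_poly (eps \o polyC) W) =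
        c *: \prod_(x <- rs j) ('X - (rho x)%:P) &
      fixed_in_frac G e -> forall tau, tau \in GA -> exists2 g, g \in G & forall j x, x \in rs j -> tau (rho x) = rho (g x)].
Proof.
move=> injg tr3 tr2 fk_gen.
pose gk : {rmorphism R -> k} := j2 \o (j1 \o g).
have topE : fk`_n = (top_coef gk (j2 x3))%:P.
  by rewrite fk_gen (gen_poly_top (polyC \o gk)) (top_coef_map gk polyC).
have szk : (size fk <= n.+1)%N by rewrite fk_gen; apply: (size_gen_poly (polyC \o gk)).
have top_tr : ~ algebraicOver ck (top_coef gk (j2 x3)).
  rewrite (top_coef_map (j1 \o g) j2); have := top_coef_transcendental injg tr3.
  by move/(transcendental_comp (u := j2)) => tr [p nzp rp]; apply: tr; exists p.
have lead j : exists2 u, u != 0 & lead_coef (val j) = u%:P.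
  by apply: (@lead_csub _ _ _ n _ _ _ _ szk topE top_tr); apply: monic_neq0.
split=> //; pose P := \prod_j val j.
have nzP : P != 0.
  apply/prodf_neq0 => j _; have [u nzu Du] := lead j.
  by rewrite -lead_coef_eq0 Du polyC_eq0.
have [M [LA [eps [GA [rsA [[eps_inj gen_rsA] P_split GA_fix fix_frac GA_conj]]]]]] := rational_splitting nzP.
pose h : {rmorphism k -> LA} := eps \o polyC.
pose f := map_poly eps fk.
have trX : ~ algebraicOver h (eps 'X).
  move=> [p nzp]; rewrite /root (poly_map_horner eps) => /eqP p0; case/eqP: nzp.
  by apply: eps_inj; rewrite p0 rmorph0.
(* The image of a_1 is s + alpha, and [coef_lift] asks for it to be transcendental over k. *)
have trX' : ~ algebraicOver h (eps ('X + alpha%:P)).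
  have -> : eps ('X + alpha%:P) = h alpha + h 1 * eps 'X by rewrite rmorph1 mul1r addrC rmorphD.
  by apply: transcendental_affine => //; apply: oner_neq0.
have [psi [psi_emb psi3 psi2 psi1]] := coef_lift injg tr3 tr2 trX'.
have f_gen : gen_poly (psi \o emb) (eps fk`_0) (psi c1) (psi c2) (psi c3) = f.
  rewrite /f {2}fk_gen (map_gen_poly (polyC \o gk)) psi1 psi2 psi3.
  rewrite -[eps x2%:P]/(h x2) -[eps (j2 x3)%:P]/(h (j2 x3)).
  by apply: eq_gen_poly => a; apply: psi_emb.
have csubE j : csub (psi \o (emb \o @mconst Fm N)) (Gam j) f = map_poly eps (val j).
  by apply: esym; apply: map_csub => a; apply: psi_emb.
have eps_leadP : eps (lead_coef P) != 0.
  by rewrite -[X in _ != X](rmorph0 eps) (inj_eq eps_inj) lead_coef_eq0.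
have [rhos Drhos] := split_factor eps_leadP (etrans (esym (rmorph_prod _ _ _ _)) P_split).
have [|rho [rhoE rho_gal]] := @core_spec LA psi (eps fk`_0) rhos.
  by move=> j; rewrite f_gen csubE; apply: Drhos.
rewrite f_gen in rhoE.
have f_affine : f = map_poly h q + eps 'X *: map_poly h W.
  by rewrite /f rmorphD /= map_polyZ -!map_poly_comp.
exists M, LA, eps, GA, rsA, rho; split=> // [Gm z z' | j | fixG tau tauG].
- exact: GA_conj.
- have [c nzc Dc] := rhoE j; exists c => //; rewrite -Dc -f_affine /csub; congr (_.[f]).
  apply: eq_map_poly => p; apply: eq_map_poly => a; exact: (esym (psi_emb (mconst N a))).
apply: (rho_gal fixG); last exact: GA_fix.
(* tau fixes k and s, hence the images of all generators of [E1]. *)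
apply: (coef_ext (s1 := tau \o psi)) => [a|||].
- by rewrite [LHS]/= -[psi (emb a)]/((psi \o emb) a) psi_emb GA_fix.
- by rewrite /= psi3 GA_fix.
- by rewrite /= psi2 GA_fix.
- by rewrite /= psi1 GA_fix.
Qed.

(* f is specialised to pass through a generic point (t1, x1) of the i-th curve, with a_1, a_2,
   a_3 still free. *)
Lemma stab_transitive i : fixed_in_frac G e -> exists2 z1, z1 \in rs i &
  forall z z', z \in rs i -> z' \in rs i -> z != z1 -> z' != z1 ->
  exists2 g, g \in G & g z1 = z1 /\ g z = z'.
Proof.
move=> fixG; have [k1 [g [t1 [x1 [injg trt Gt]]]]] :=
  curve_point (@mconst Fm N) (Gam_monic i) (Gam_size i).
have [k2 [j1 [a3 tr3]]] := exists_transcendental k1.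
have [E [j2 [a2 tr2]]] := exists_transcendental k2.
(* W and w2 vanish at t1, so every graph of the pencil passes through (t1, x1). The free
   coefficients are a_1 in front of W, a_2 in front of w2, and a_3 inside q0. *)
pose W : {poly k2} := 'X - (j1 t1)%:P.
pose w2 : {poly k2} := 'X^2 - (j1 t1 ^+ 2)%:P.
pose q0 : {poly k2} := gen_poly (j1 \o g) 0 0 0 a3.
pose q1 := q0 + (j1 x1 - q0.[j1 t1])%:P.
pose q := map_poly j2 q1 + a2 *: map_poly j2 w2.
pose fA : {poly {poly E}} := map_poly polyC q + 'X *: map_poly polyC (map_poly j2 W).
have coefA m : fA`_m = (j2 q1`_m + a2 * j2 w2`_m)%:P + 'X * (j2 W`_m)%:P.
  by rewrite coefD coefZ !coef_map /= coefD coefZ !coef_map.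
have coef_q1 m : q1`_m.+1 = q0`_m.+1 by rewrite coefD coefC addr0.
have fA_gen : fA = gen_poly (polyC \o (j2 \o (j1 \o g))) fA`_0 ('X + 0%:P) a2%:P (j2 a3)%:P.
  apply/polyP=> m; rewrite coef_gen_poly; case: m => [//|m].
  rewrite coefA coef_q1 coef_gen_poly !coefB coefX coefXn !coefC.
  case: m => [|[|[|m]]] /=;
    by rewrite !(polyC0, addr0, subr0, subrr, mulr0, rmorph0, rmorph1, polyC0, add0r, mulr1).
have [_ [M [LA [eps [GA [rsA [rho [[eps_inj _ _] [GA_fix _] GA_conj rhoE rho_gal]]]]]]]] :=
  pencil_specialization injg tr3 tr2 fA_gen.
pose h : {rmorphism E -> LA} := eps \o polyC.
pose f := map_poly h q + eps 'X *: map_poly h (map_poly j2 W).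
have trX : ~ algebraicOver h (eps 'X).
  move=> [p nzp]; rewrite /root (poly_map_horner eps) => /eqP p0; case/eqP: nzp.
  by apply: eps_inj; rewrite p0 rmorph0.
have q_t1 : q.[j2 (j1 t1)] = j2 (j1 x1).
  rewrite hornerD hornerZ !horner_map; set u := w2.[_].
  have -> : u = 0 by rewrite /u hornerD hornerN hornerXn hornerC subrr.
  by rewrite rmorph0 mulr0 addr0 hornerD hornerC addrC subrK.
pose tA := h (j2 (j1 t1)); pose xA := h (j2 (j1 x1)).
have W_at z : (map_poly h (map_poly j2 W)).[z] = z - tA.
  by rewrite rmorphB /= map_polyX map_polyC rmorphB /= map_polyX map_polyC hornerXsubC.
have f_tA : f.[tA] = xA.
  by rewrite hornerD hornerZ W_at subrr mulr0 addr0 horner_map q_t1.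
pose cE : {rmorphism Fm -> E} := (j2 \o j1) \o (g \o @mconst Fm N).
pose cA : {rmorphism Fm -> LA} := h \o cE.
pose u := (h \o (j2 \o j1)) : {rmorphism k1 -> LA}.
have evA P : ev2 cA tA xA P = u (ev2 (g \o @mconst Fm N) t1 x1 P).
  exact: (ev2_map (u := u)).
have [Gx_neq0 _] := curve_regular trt Gt.
have simple z : (csub cA (Gam i) f).[z] = 0 -> ((csub cA (Gam i) f)^`()).[z] != 0.
  (* At the base point the derivative is affine in s with nonzero slope Gamma_x(t1, x1), so a
     transcendental s is not a zero; elsewhere [generic_separable] applies. *)
  move=> rz; have [ztA|zntA] := eqVneq z tA.
    rewrite ztA deriv_csub_at f_tA !evA derivD derivZ hornerD hornerZ !deriv_map.
    rewrite derivXsubC !rmorph1 hornerC mulr1 horner_map.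
    apply/eqP => /solve_affine; rewrite fmorph_eq0 => /(_ Gx_neq0) DX.
    have /eqP[] := transcendental_notin trX
      (- (j2 (j1 (ev2 (g \o @mconst Fm N) t1 x1 (map_poly (@deriv Fm) (Gam i)))) /
          j2 (j1 (ev2 (g \o @mconst Fm N) t1 x1 (Gam i)^`()))) - q^`().[j2 (j1 t1)]).
    by rewrite DX rmorphB rmorphN fmorph_div.
  pose cc : {rmorphism Fm -> k2} := j1 \o (g \o @mconst Fm N).
  pose Gk := map_poly (map_poly cc) (Gam i).
  have csubk : csub cA (Gam i) f = csub h (map_poly (map_poly j2) Gk) f.
    rewrite (csub_comp (c := j2) (g := h \o j2)) // (csub_comp (c := cc) (g := cA)) //.
  rewrite csubk in rz *; apply: (generic_separable _ _ _ trX _ _ _ rz).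
  - exact: monic_map.
  - rewrite /Gk -map_poly_comp (eq_map_poly (g := map_poly (j2 \o cc))); first exact: Gam_irr.
    by move=> p; rewrite /= -map_poly_comp.
  - by rewrite deriv_map map_poly_eq0_id0 ?lead_coef_eq0 // map_poly_eq0 lead_coef_eq0.
  - exact: transcendental_notin.
  - have -> : W * w2^`() - W^`() * w2 = ('X - (j1 t1)%:P) ^+ 2.
      rewrite /W /w2 derivB derivXn derivC derivXsubC polyCM expr1.
      by move: ('X : {poly k2}) (_%:P) => X t; ring.
    by rewrite expf_neq0 // polyXsubC_eq0.
  - by rewrite W_at subr_eq0.
have [cst nzcst rho_i] := rhoE i.
have uniq_rho : uniq (map rho (rs i)).
  apply: (uniq_of_simple_roots (c := cst) (P := csub cA (Gam i) f)); first by rewrite big_map.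
  move=> z zr; apply: simple; apply/eqP; rewrite -/(root _ z) rho_i rootZ //.
  by rewrite -(big_map rho predT (fun r => 'X - r%:P)) root_prod_XsubC.
have rho_inj := uniq_map_inj uniq_rho.
have rho_root z : z \in rs i -> (csub cA (Gam i) f).[rho z] = 0.
  move=> zr; apply/eqP; rewrite -/(root _ _) rho_i rootZ //.
  by rewrite -(big_map rho predT (fun r => 'X - r%:P)) root_prod_XsubC map_f.
have tA_root : tA \in map rho (rs i).
  rewrite -root_prod_XsubC big_map -(rootZ _ _ nzcst) -rho_i /root horner_csub f_tA evA Gt.
  by rewrite rmorph0.
case/mapP: tA_root => z1 z1_rs rho_z1; exists z1 => // z z' zr zr' zz1 zz1'.
have W_rho y : y \in rs i -> y != z1 -> (map_poly h (map_poly j2 W)).[rho y] != 0.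
  by move=> yr; apply: contraNneq => /eqP; rewrite W_at rho_z1 subr_eq0 => /eqP/rho_inj ->.
have GE : csub cA (Gam i) f = csub h (map_poly (map_poly cE) (Gam i)) f.
  by rewrite (csub_comp (c := cE) (g := cA)).
have [tau tauG tau_z] : exists2 tau, tau \in GA & tau (rho z) = rho z'.
  apply: (GA_conj (map_poly (map_poly cE) (Gam i))); rewrite -/h -/f -?GE;
    [exact: monic_map | exact: Gam_irr | exact: W_rho | exact: W_rho | exact: rho_root | exact: rho_root].
have [g0 g0G Dg0] := rho_gal fixG tau tauG.
have g_rs y : y \in rs i -> g0 y \in rs i by apply: rs_stable.
exists g0 => //; split; apply: rho_inj; rewrite ?g_rs // -(Dg0 i) //.
(* z1 specialises to the constant t1, which tau fixes; as the specialised roots are distinct, g0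
   fixes z1. *)
by rewrite -rho_z1; apply: GA_fix.
Qed.

(** Gamma_j(0, x) is monic over F_m, so its roots are algebraic. This keeps the curves away from the
    base point t = 0 of the pencil in the direction t. *)
Lemma generic_fibre_neq0 (T : fieldType) (h : {rmorphism Fm -> T}) (y : T) j :
  ~ algebraicOver h y -> ev2 h 0 y (Gam j) != 0.
Proof.
move=> try; apply/eqP => G0; apply: try.
exists (map_poly (horner_eval 0) (Gam j)).
  by apply: monic_neq0; apply: monic_map.
apply/eqP; rewrite -[RHS]G0 ev2E -map_poly_comp; congr (_.[y]); apply: eq_map_poly => p.
by rewrite /= /horner_eval -horner_map rmorph0.
Qed.

Lemma Gam_map_inj (T : fieldType) (h : {rmorphism Fm -> T}) j j' :
  map_poly (map_poly h) (Gam j) = map_poly (map_poly h) (Gam j') -> j = j'.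
Proof. by move/(map_inj_poly (map_inj_poly (fmorph_inj h) (rmorph0 h)) (rmorph0 _)) => /Gam_inj. Qed.

Lemma generic_simple (F1 F2 T : fieldType) (c0 : {rmorphism Fm -> F1}) (c : {rmorphism F1 -> F2})
    (h : {rmorphism F2 -> T}) (q1 w2 W : {poly F1}) (a : F2) (beta z : T) j
    (f := map_poly h (map_poly c q1 + a *: map_poly c w2) + beta *: map_poly h (map_poly c W))
    (hc := h \o (c \o c0) : {rmorphism Fm -> T}) :
  ~ algebraicOver h beta -> ~ algebraicOver c a -> W * w2^`() - W^`() * w2 != 0 ->
  (map_poly h (map_poly c W)).[z] != 0 -> (csub hc (Gam j) f).[z] = 0 ->
  ((csub hc (Gam j) f)^`()).[z] != 0.
Proof.
move=> trb tra nzw Wz; pose Gk := map_poly (map_poly c0) (Gam j).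
have -> : csub hc (Gam j) f = csub h (map_poly (map_poly c) Gk) f.
  by rewrite (csub_comp (c := c) (g := h \o c)) // (csub_comp (c := c0) (g := hc)).
apply: generic_separable => //.
- exact: monic_map.
- rewrite /Gk -map_poly_comp (eq_map_poly (g := map_poly (c \o c0))); first exact: Gam_irr.
  by move=> p; rewrite /= -map_poly_comp.
- by rewrite deriv_map map_poly_eq0_id0 ?lead_coef_eq0 // map_poly_eq0 lead_coef_eq0.
- exact: transcendental_notin.
Qed.

Lemma generic_disjoint (F2 T : fieldType) (c0 : {rmorphism Fm -> F2}) (h : {rmorphism F2 -> T})
    (q W : {poly F2}) (beta z : T) j j' (f := map_poly h q + beta *: map_poly h W)
    (hc := h \o c0 : {rmorphism Fm -> T}) :
  ~ algebraicOver h beta -> (map_poly h W).[z] != 0 ->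
  (csub hc (Gam j) f).[z] = 0 -> (csub hc (Gam j') f).[z] = 0 -> j = j'.
Proof.
move=> trb Wz; rewrite -!(csub_comp (c := c0) (h := h) (g := hc)) // => Gz Gz'.
apply: (@Gam_map_inj _ c0); apply: (generic_coprime _ _ _ _ trb Wz Gz Gz');
  by [exact: monic_map | exact: Gam_irr].
Qed.

(* The pencil spanned by polynomials tangent to the curve i at (t1, x1). *)
Lemma tangent_specialization i :
  exists (k1 k2 E E' : fieldType) (g : {rmorphism R -> k1}) (j1 : {rmorphism k1 -> k2})
    (j2 : {rmorphism k2 -> E}) (u : {rmorphism E -> E'}) (t1 x1 : k1) (x3 : k2) (b : E)
    (q : {poly k2}) (rhos : seq E')
    (cE' := (u \o j2) \o (j1 \o (g \o @mconst Fm N)) : {rmorphism Fm -> E'})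
    (tA := u (j2 (j1 t1)))
    (f0 := map_poly u (map_poly j2 q + b *: map_poly j2 (('X - (j1 t1)%:P) ^+ 2))),
  [/\ [/\ injective g, ~ algebraicOver j1 x3 & ~ algebraicOver j2 b],
      ~ algebraicOver (g \o @mconst Fm N) t1 /\ ev2 (g \o @mconst Fm N) t1 x1 (Gam i) = 0,
      (forall m, q`_m.+2 = (gen_poly (j1 \o g) 0 0 0 x3)`_m.+2) /\ q.[j1 t1] = j1 x1,
      uniq (tA :: rhos) &
      exists2 c, c != 0 & \prod_j csub cE' (Gam j) f0 =
         c *: (('X - tA%:P) ^+ 2 * \prod_(r <- rhos) ('X - r%:P))].
Proof.
have [k1 [g [t1 [x1 [injg trt Gt]]]]] := curve_point (@mconst Fm N) (Gam_monic i) (Gam_size i).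
have [k2 [j1 [x3 tr3]]] := exists_transcendental k1.
have [E [j2 [b trb]]] := exists_transcendental k2.
pose cF : {rmorphism Fm -> k1} := g \o @mconst Fm N.
have [Gx_neq0 G_other] := curve_regular trt Gt.
pose W : {poly k1} := ('X - t1%:P) ^+ 2.
(* The factor X + 2 t1 cancels the quadratic term: w2 = X^3 - 3 t1^2 X + 2 t1^3. So a_3 varies along
   w2 without disturbing a_2, which belongs to W. *)
pose w2 : {poly k1} := ('X - t1%:P) ^+ 2 * ('X + (t1 + t1)%:P).
(* The slope of the curve at (t1, x1). The numbers be and al below give q1 this slope and the value
   x1 at t1. *)
pose x' := - (ev2 cF t1 x1 (map_poly (@deriv Fm) (Gam i)) / ev2 cF t1 x1 (Gam i)^`()).
have [p0 p0E] : exists p0, p0 = gen_poly g 0 0 0 0 by eexists.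
pose be := x' - p0^`().[t1]; pose al := x1 - p0.[t1] - be * t1.
pose q1 := p0 + al%:P + be *: 'X.
pose q := map_poly j1 q1 + x3 *: map_poly j1 w2.
have q1_t1 : q1.[t1] = x1.
  rewrite !hornerD hornerZ hornerX hornerC /al.
  by move: p0.[t1] (be * t1) => A B; ring.
have q1'_t1 : q1^`().[t1] = x'.
  by rewrite !derivD derivC derivZ derivX addr0 hornerD hornerZ hornerC mulr1 /be addrC subrK.
have w2_t1 : w2.[t1] = 0 by rewrite !hornerM hornerXsubC subrr !mul0r.
have w2'_t1 : w2^`().[t1] = 0.
  rewrite /w2 expr2 -mulrA derivM derivXsubC mul1r hornerD !hornerM hornerXsubC subrr.
  by rewrite !mul0r addr0.
have q_t1 : q.[j1 t1] = j1 x1 by rewrite hornerD hornerZ !horner_map w2_t1 q1_t1 rmorph0 mulr0 addr0.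
have q'_t1 : q^`().[j1 t1] = j1 x'.
  by rewrite derivD derivZ !deriv_map hornerD hornerZ !horner_map w2'_t1 q1'_t1 rmorph0 mulr0 addr0.
have q_coef m : q`_m.+2 = (gen_poly (j1 \o g) 0 0 0 x3)`_m.+2.
  have w2E : w2 = 'X^3 - (t1 * t1 + t1 * t1 + t1 * t1)%:P * 'X + (t1 * t1 * t1 + t1 * t1 * t1)%:P.
    by rewrite /w2 !polyCD !polyCM; move: ('X : {poly k1}) (t1%:P) => X t; ring.
  have w2_coef : w2`_m.+2 = (m == 1)%:R.
    by rewrite w2E coefD coefB coefCM coefXn coefX coefC; case: m => [|[|m]] /=; rewrite ?mulr0 ?subr0 addr0.
  have q1_coef : q1`_m.+2 = p0`_m.+2 by rewrite !coefD coefZ coefX coefC mulr0 !addr0.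
  rewrite coefD coefZ !coef_map w2_coef q1_coef p0E !coef_gen_poly.
  by case: m {w2_coef q1_coef} => [|[|m]] /=; rewrite !(mulr0, addr0, rmorph0, rmorph1, mulr1, add0r).
have W_map : map_poly j1 W = ('X - (j1 t1)%:P) ^+ 2.
  by rewrite rmorphXn rmorphB /= map_polyX map_polyC.
have wronsk : W * w2^`() - W^`() * w2 != 0.
  have -> : W * w2^`() - W^`() * w2 = W * W.
    rewrite /w2 -/W derivM derivD derivX derivC addr0 mulr1.
    by move: (_ + _) (W) (W^`()) => D A B; ring.
  by rewrite mulf_neq0 // expf_neq0 // polyXsubC_eq0.
have f_aff (T : fieldType) (v : {rmorphism E -> T}) :
   map_poly v (map_poly j2 q + b *: map_poly j2 (('X - (j1 t1)%:P) ^+ 2)) =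
   map_poly (v \o j2) q + v b *: map_poly (v \o j2) (map_poly j1 W).
  by rewrite W_map rmorphD /= map_polyZ -!map_poly_comp.
have W_at (T : fieldType) (h : {rmorphism k2 -> T}) z :
   (map_poly h (map_poly j1 W)).[z] = (z - h (j1 t1)) ^+ 2.
  by rewrite W_map rmorphXn rmorphB /= map_polyX map_polyC horner_exp hornerXsubC.
have val_neq0 (T : fieldType) (h : {rmorphism k2 -> T}) be' j : ~ algebraicOver h be' ->
   csub (h \o (j1 \o cF)) (Gam j) (map_poly h q + be' *: map_poly h (map_poly j1 W)) != 0.
  move=> trbe; apply/eqP => val0.
  (* W is 1 at t1 + 1, off the base point; the zero polynomial would have a multiple root there. *)
  have := generic_simple (z := h (j1 t1) + 1) (j := j) (c0 := cF) (q1 := q1) trbe tr3 wronsk.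
  rewrite val0 W_at addrC addKr expr1n oner_neq0 deriv0 horner0 eqxx.
  by move=> /(_ isT erefl).
pose f0E := map_poly idfun (map_poly j2 q + b *: map_poly j2 (('X - (j1 t1)%:P) ^+ 2)).
pose cE : {rmorphism Fm -> E} := j2 \o (j1 \o cF).
pose P0 := \prod_j csub cE (Gam j) f0E.
have nzP0 : P0 != 0.
  apply/prodf_neq0 => j _; rewrite /f0E f_aff; exact: val_neq0.
have [E' [u [s Ds]]] := splits_in_extension nzP0.
pose h : {rmorphism k2 -> E'} := u \o j2.
have trub : ~ algebraicOver h (u b) by apply: transcendental_comp.
pose cE' : {rmorphism Fm -> E'} := h \o (j1 \o cF).
pose f0 := map_poly h q + u b *: map_poly h (map_poly j1 W).
pose val j := csub cE' (Gam j) f0.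
have P0val : map_poly u P0 = \prod_j val j.
  rewrite rmorph_prod /=; apply: eq_bigr => j _; rewrite (map_csub (h' := u) (g := cE')) //.
  by congr (csub _ _ _); rewrite /f0E map_poly_id // f_aff.
pose tA := u (j2 (j1 t1)); pose xA := u (j2 (j1 x1)).
have f0_tA : f0.[tA] = xA.
  by rewrite hornerD hornerZ W_at subrr expr0n mulr0 addr0 horner_map q_t1.
have evA P : ev2 cE' tA xA P = h (j1 (ev2 cF t1 x1 P)).
  exact: (ev2_map (u := h \o j1) (h := cF)).
pose Qc := csub (j1 \o cF) (Gam i) q.
have [|| R1 DQc] := double_root_factor (p := Qc) (t := j1 t1).
- by rewrite horner_csub q_t1 (ev2_map (u := j1) (h := cF)) // Gt rmorph0.
- rewrite deriv_csub_at q_t1 q'_t1 !(ev2_map (u := j1) (h := cF)) // -rmorphM -rmorphD.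
  by rewrite /x' mulrN mulrC divfK // addrN rmorph0.
pose Wh : {poly E'} := ('X - tA%:P) ^+ 2.
have WhE : map_poly h (map_poly j1 W) = Wh.
  by rewrite W_map rmorphXn rmorphB /= map_polyX map_polyC.
pose GE := map_poly (map_poly cE') (Gam i).
(* Expanding Gamma_i(t, q + b W) around q shows a factor W. The cofactor at t1 is affine in b with
   slope Gamma_x(t1, x1), so for transcendental b the root t1 is exactly double. *)
have [w Dw] := horner_taylor1 GE (map_poly h q) ((u b)%:P * Wh).
pose Rf := map_poly h R1 + GE^`().[map_poly h q] * (u b)%:P + w * ((u b)%:P ^+ 2 * Wh).
have val_i : val i = Wh * Rf.
  rewrite /val /csub -/GE /f0 WhE -mul_polyC Dw.
  have -> : GE.[map_poly h q] = Wh * map_poly h R1.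
    rewrite -[LHS]/(csub cE' (Gam i) (map_poly h q)) -(map_csub (h := j1 \o cF)) // -/Qc DQc.
    by rewrite rmorphM rmorphXn rmorphB /= map_polyX map_polyC.
  by rewrite /Rf; move: (map_poly h R1) GE^`().[_] (u b)%:P (Wh) => A B D V; ring.
have Rf_tA : Rf.[tA] != 0.
  have Wh_tA : Wh.[tA] = 0 by rewrite horner_exp hornerXsubC subrr expr0n.
  rewrite /Rf hornerD hornerD hornerM hornerC (hornerM w) (hornerM _ Wh) Wh_tA !mulr0 addr0.
  rewrite horner_map /GE deriv_map -[_.[map_poly h q].[_]]/((csub cE' (Gam i)^`() (map_poly h q)).[tA]).
  rewrite horner_csub horner_map q_t1 evA; apply/eqP.
  rewrite -[u b]add0r => /solve_affine; rewrite !fmorph_eq0 => /(_ Gx_neq0); rewrite subr0 => Db.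
  have /eqP[] := transcendental_notin trub (- (R1.[j1 t1] / j1 (ev2 cF t1 x1 (Gam i)^`()))).
  by rewrite Db rmorphN fmorph_div.
pose Rall := Rf * \prod_(j | j != i) val j.
have prod_val : \prod_j val j = Wh * Rall by rewrite (bigD1 i) //= val_i /Rall mulrA.
have nzl : u (lead_coef P0) != 0 by rewrite fmorph_eq0 lead_coef_eq0.
have [m /eqp_eq] : exists m, Rall %= \prod_(x <- mask m s) ('X - x%:P).
  have /dvdp_prod_XsubC[m Dm] : Rall %| \prod_(x <- s) ('X - x%:P).
    by rewrite -(dvdpZr _ _ nzl) -Ds P0val prod_val dvdp_mull.
  by exists m.
set rhos := mask m s; rewrite (monicP (monic_prod_XsubC _ _ _)) scale1r => DRall.
have Rall_tA : Rall.[tA] != 0.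
  rewrite hornerM mulf_neq0 // horner_prod; apply/prodf_neq0 => j ji.
  by rewrite horner_csub f0_tA evA !fmorph_eq0 G_other.
clearbody Rall.
exists k1, k2, E, E', g, j1, j2, u, t1, x1, x3, b, q, rhos; split=> //.
- rewrite -/tA /= (_ : uniq rhos) ?andbT.
    by apply: contraNN Rall_tA; rewrite -root_prod_XsubC /root DRall hornerZ => /eqP->; rewrite mulr0.
  apply: (uniq_of_simple_roots DRall) => r rr.
  have Rall_r : Rall.[r] = 0.
    by apply/eqP; rewrite DRall hornerZ mulf_eq0 -/(root _ r) root_prod_XsubC rr orbT.
  (* The remaining roots differ from t1, the only zero of W, so they are simple and lie on one curve
     each. *)
  have W_r : (map_poly h (map_poly j1 W)).[r] != 0.
    rewrite W_at expf_neq0 // subr_eq0; apply: contraNneq Rall_tA => Er.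
    by rewrite -[tA]/(h (j1 t1)) -Er Rall_r.
  have := @prod_simple_root _ _ val r.
  rewrite prod_val derivM hornerD !hornerM Rall_r !mulr0 add0r mulf_eq0 negb_or => simple.
  have simp j : (val j).[r] = 0 -> ((val j)^`()).[r] != 0.
    exact: (generic_simple (c0 := cF) (q1 := q1) trub tr3 wronsk W_r).
  have disj j j' : (val j).[r] = 0 -> (val j').[r] = 0 -> j = j'.
    exact: (generic_disjoint (c0 := j1 \o cF) trub W_r).
  by have /andP[] := simple simp disj erefl.
exists (lead_coef Rall); last by rewrite scalerAr -DRall -/tA -/Wh -prod_val f_aff.
by rewrite lead_coef_eq0; apply: contraNneq Rall_tA => ->; rewrite horner0.
Qed.

(** The tangent graph f0 is deformed to f0 + s t. The direction t moves only a_1, and its only base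
    point t = 0 is on no curve because f0(0) is transcendental; so the generic arguments cover all
    intersection points. The clauses on distinctness come without [fixed_in_frac], since they serve
    to prove that L is Galois in the first place. *)
Lemma branch_cycle i :
  [/\ forall j, uniq (rs j),
      forall j j' z, z \in rs j -> z \in rs j' -> j = j',
      fixed_in_frac G e -> forall j z z', z \in rs j -> z' \in rs j -> exists2 g, g \in G & g z = z' &
      fixed_in_frac G e -> exists (g : gal_of {:L}) x y, [/\ g \in G, x \in rs i, y \in rs i, x != y &
        [/\ g x = y, g y = x & forall j z, z \in rs j -> z != x -> z != y -> g z = z]]].
Proof.
have [k1 [k2 [E [E' [g [j1 [j2 [u [t1 [x1 [x3 [b [q [rhos]]]]]]]]]]]]]] := tangent_specialization i.
set cE' := _ \o _; set tA := u _; set f0 := map_poly u _.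
move=> [[injg tr3 trb] [trt Gt] [q_coef q_t1] uniq_rhos [c0 nzc0 val0E]].
pose cF : {rmorphism Fm -> k1} := g \o @mconst Fm N.
pose h : {rmorphism k2 -> E'} := u \o j2.
have trub : ~ algebraicOver h (u b) by apply: transcendental_comp.
pose W : {poly k2} := ('X - (j1 t1)%:P) ^+ 2.
have f0E : f0 = map_poly h q + u b *: map_poly h W.
  by rewrite /f0 rmorphD /= map_polyZ -!map_poly_comp.
pose fk : {poly {poly E'}} := map_poly polyC f0 + 'X *: map_poly polyC 'X.
have fk_gen : fk = gen_poly (polyC \o (h \o (j1 \o g))) fk`_0 ('X + (f0`_1)%:P) (u b)%:P (h x3)%:P.
  apply/polyP=> m; rewrite coef_gen_poly; case: m => [//|m].
  rewrite coefD coefZ map_polyX coefX coef_map /=; case: m => [|m]; first by rewrite mulr1 addrC.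
  have Wm : W`_m.+2 = (m == 0)%:R.
    have -> : W = 'X^2 - (j1 t1 + j1 t1)%:P * 'X + (j1 t1 * j1 t1)%:P.
      by rewrite /W !polyCD !polyCM; move: ('X : {poly k2}) ((j1 t1)%:P) => X t; ring.
    by rewrite coefD coefB coefCM coefXn coefX coefC mulr0 subr0 addr0.
  rewrite mulr0 addr0 f0E coefD coefZ !coef_map Wm q_coef coef_gen_poly.
  case: m {Wm} => [|[|m]] /=; by rewrite !(rmorph0, rmorph1, mulr0, mulr1, addr0, add0r).
have [lead [M [LA [eps [GA [rsA [rho [[eps_inj gen_rsA P_split] [GA_fix fix_frac] GA_conj rhoE rho_gal]]]]]]]] :=
  pencil_specialization injg tr3 trub fk_gen.
pose ck : {rmorphism Fm -> E'} := (h \o j1) \o cF.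
pose hA : {rmorphism E' -> LA} := eps \o polyC.
pose cA : {rmorphism Fm -> LA} := hA \o ck.
pose f := map_poly hA f0 + eps 'X *: map_poly hA 'X.
pose valk j := csub (polyC \o ck) (Gam j) fk.
have valE j : map_poly eps (valk j) = csub cA (Gam j) f.
  rewrite (map_csub (g := cA)) //; congr (csub _ _ _).
  by rewrite /fk /f rmorphD /= map_polyZ -!map_poly_comp.
have trX : ~ algebraicOver hA (eps 'X).
  move=> [p nzp]; rewrite /root (poly_map_horner eps) => /eqP p0; case/eqP: nzp.
  by apply: eps_inj; rewrite p0 rmorph0.
(* f0(0) = q(0) + t1^2 b with b transcendental and t1 nonzero. *)
have f0_0 : ~ algebraicOver ck f0.[0].
  have -> : f0.[0] = h q.[0] + h W.[0] * u b.
    by rewrite f0E hornerD hornerZ -[0 in LHS](rmorph0 h) !horner_map mulrC.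
  apply: (transcendental_sub (c := j1 \o cF)); apply: transcendental_affine => //.
  rewrite horner_exp hornerXsubC sub0r expf_neq0 // oppr_eq0 fmorph_eq0.
  exact: transcendental_neq0 trt.
have z_neq0 j z : (csub cA (Gam j) f).[z] = 0 -> (map_poly hA 'X).[z] != 0.
  rewrite map_polyX hornerX => rz; apply/eqP => z0; move: rz; rewrite z0 horner_csub.
  have -> : f.[0] = hA f0.[0].
    by rewrite hornerD hornerZ map_polyX hornerX mulr0 addr0 -{1}(rmorph0 hA) horner_map.
  rewrite -{1}(rmorph0 hA) (ev2_map (h := ck) (u := hA)) // => /eqP.
  by rewrite fmorph_eq0 (negPf (generic_fibre_neq0 _ f0_0)).
have wronsk : 'X * W^`() - ('X)^`() * W != 0.
  have -> : 'X * W^`() - ('X)^`() * W = ('X - (j1 t1)%:P) * ('X + (j1 t1)%:P).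
    rewrite /W expr2 derivM derivXsubC derivX mul1r mulr1.
    by move: ('X : {poly k2}) ((j1 t1)%:P) => X t; ring.
  by rewrite mulf_neq0 ?polyXsubC_eq0 // -[(j1 t1)%:P]opprK -polyCN polyXsubC_eq0.
have simple j z : (csub cA (Gam j) f).[z] = 0 -> ((csub cA (Gam j) f)^`()).[z] != 0.
  (* The roles have shifted: the pencil now has direction t, and the parameter outside the smaller
     field is b, along (t - t1)^2. *)
  move=> rz; have := generic_simple (z := z) (j := j) (c0 := j1 \o cF) (q1 := q) trX trub wronsk.
  by rewrite map_polyX -f0E; apply; first exact: z_neq0 rz.
have disj j j' z : (csub cA (Gam j) f).[z] = 0 -> (csub cA (Gam j') f).[z] = 0 -> j = j'.
  move=> rz rz'; exact: (generic_disjoint (c0 := ck) trX (z_neq0 j z rz) rz rz').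
have [l nzl leadP] : exists2 l, l != 0 & lead_coef (\prod_j valk j) = l%:P.
  rewrite lead_coef_prod; apply: (big_ind (fun p : {poly E'} => exists2 l, l != 0 & p = l%:P)) => [|p p'|j _].
  - by exists 1; rewrite ?oner_neq0.
  - by move=> [l nzl ->] [l' nzl' ->]; exists (l * l'); rewrite ?mulf_neq0 ?polyCM.
  - exact: lead.
have nz_eps_lead : eps (lead_coef (\prod_j valk j)) != 0.
  by rewrite -[X in _ != X](rmorph0 eps) (inj_eq eps_inj) leadP polyC_eq0.
have P_eps : map_poly eps (\prod_j valk j) = \prod_j csub cA (Gam j) f.
  by rewrite rmorph_prod; apply: eq_bigr => j _; apply: valE.
have rsAP z : (z \in rsA) = root (\prod_j csub cA (Gam j) f) z.
  by rewrite -P_eps P_split rootZ // root_prod_XsubC.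
have uniq_rsA : uniq rsA.
  apply: (uniq_of_simple_roots P_split) => z; rewrite rsAP P_eps => /eqP.
  by apply: prod_simple_root => [j|j j']; [exact: simple | exact: disj].
have rho_mem j z : z \in rs j -> z \in rs j by [].
have rho_root j z : z \in rs j -> (csub cA (Gam j) f).[rho z] = 0.
  have [c nzc Dc] := rhoE j; move=> zr; apply/eqP; rewrite -/(root _ _) Dc rootZ //.
  by rewrite -(big_map rho predT (fun r => 'X - r%:P)) root_prod_XsubC map_f.
have rho_uniq j : uniq (map rho (rs j)).
  have [c nzc Dc] := rhoE j.
  apply: (uniq_of_simple_roots (c := c) (P := csub cA (Gam j) f)); first by rewrite big_map.
  by move=> _ /mapP[z zr ->]; apply: simple; apply: rho_root.
have rho_inj j := uniq_map_inj (rho_uniq j).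
have rho_surj j y : (csub cA (Gam j) f).[y] = 0 -> exists2 z, z \in rs j & y = rho z.
  have [c nzc Dc] := rhoE j => /eqP; rewrite -/(root _ _) Dc rootZ //.
  by rewrite -(big_map rho predT (fun r => 'X - r%:P)) root_prod_XsubC => /mapP.
have rs_disj j j' z : z \in rs j -> z \in rs j' -> j = j'.
  by move=> zr zr'; apply: (disj _ _ (rho z)); apply: rho_root.
split=> // [j | fixG j z z' zr zr' | fixG].
- exact: map_uniq (rho_uniq j).
- have GE : csub cA (Gam j) f = csub hA (map_poly (map_poly ck) (Gam j)) f.
    by rewrite (csub_comp (c := ck) (g := cA)).
  have [tau tauG tau_z] : exists2 tau, tau \in GA & tau (rho z) = rho z'.
    apply: (GA_conj (map_poly (map_poly ck) (Gam j))); rewrite -/hA -/f -?GE;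
    [exact: monic_map | exact: Gam_irr | apply: (z_neq0 j) | apply: (z_neq0 j) | | ]; exact: rho_root.
  have [g0 g0G Dg0] := rho_gal fixG tau tauG; exists g0 => //.
  by apply: (rho_inj j) => //; [exact: rs_stable zr | rewrite -(Dg0 j)].
have phi_fk : map_poly (horner_eval 0) fk = f0.
  apply/polyP=> m; rewrite coef_map coefD coefZ !coef_map /= /horner_eval hornerD hornerM.
  by rewrite hornerX hornerC mul0r addr0.
have phi_val j : map_poly (horner_eval 0) (valk j) = csub ck (Gam j) f0.
  rewrite (map_csub (g := ck)) ?phi_fk // => a; by rewrite /= /horner_eval hornerC.
pose xA := h (j1 x1).
have f0_tA : f0.[tA] = xA.
  have W_t : W.[j1 t1] = 0 by rewrite horner_exp hornerXsubC subrr expr0n.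
  by rewrite f0E -[tA]/(h (j1 t1)) hornerD hornerZ !horner_map W_t q_t1 rmorph0 mulr0 addr0.
have evA P : ev2 ck tA xA P = h (j1 (ev2 cF t1 x1 P)).
  exact: (ev2_map (u := h \o j1) (h := cF)).
have [Gx_neq0 G_other] := curve_regular trt Gt.
have [|||||||||||tau [x2 [y2 [tauG x2r y2r xy2 [tau_x tau_y tau_fix x2_spec]]]]] :=
   @ramified_transposition E' M LA eps rsA GA (\prod_j valk j) tA rhos.
- exact: fix_frac.
- exact: GA_fix.
- exact: gal_stable_roots nz_eps_lead P_split GA_fix.
- by move=> tau _; apply: gal_eq1_on_gens.
- exact: eps_inj.
- exact: uniq_rsA.
- exact: P_split.
- by rewrite leadP /= /horner_eval hornerC.
- rewrite rmorph_prod /= (eq_bigr _ (fun j _ => phi_val j)) [LHS]val0E; congr (_ *: _).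
  have mon : ('X - tA%:P) ^+ 2 * \prod_(r <- rhos) ('X - r%:P) \is monic.
    by rewrite rpredM ?rpredX ?monicXsubC // monic_prod_XsubC.
  have := congr1 lead_coef val0E; rewrite lead_coefZ (monicP mon) mulr1 => <-.
  have lead0 : horner_eval 0 (lead_coef (\prod_j valk j)) != 0.
    by rewrite leadP /= /horner_eval hornerC.
  rewrite -(lead_coef_map_eq lead0) rmorph_prod; congr lead_coef.
  by apply: eq_bigr => j _; rewrite -phi_val.
- exact: uniq_rhos.
- rewrite coefp1_horner horner_prod (bigD1 i) //=.
  (* At t1 the coefficient of s in the i-th factor is t1 Gamma_x(t1, x1), and the other factors are
     nonzero at s = 0. Hence the s-derivative of the product is nonzero and the branching is
     simple. *)
  have fk_tA : fk.[tA%:P] = xA%:P + tA%:P * 'X.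
    by rewrite hornerD hornerZ map_polyX hornerX horner_map f0_tA mulrC.
  pose GE := map_poly (map_poly (polyC \o ck)) (Gam i).
  have [w Dw] := horner_taylor1 (map_poly (horner_eval tA%:P \o map_poly (polyC \o ck)) (Gam i)) xA%:P (tA%:P * 'X).
  have ev_polyC P : ev2 (polyC \o ck) tA%:P xA%:P P = (ev2 ck tA xA P)%:P.
    exact: (ev2_map (u := polyC) (h := ck)).
  rewrite /valk horner_csub fk_tA ev2E Dw deriv_map -!ev2E !ev_polyC !evA Gt.
  rewrite !rmorph0 add0r; set Pi := \prod_(_ | _) _; set A := h (j1 (ev2 cF t1 x1 _)).
  have -> : (A%:P * (tA%:P * 'X) + w * (tA%:P * 'X) ^+ 2) * Pi =
      'X * ((A%:P * tA%:P + w * tA%:P ^+ 2 * 'X) * Pi).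
    by move: (A%:P) (tA%:P) (Pi) ('X : {poly E'}) => B D V X; ring.
  rewrite coefXM /= coef0M coefD coefMX addr0 coefCM coefC /= !mulf_neq0 ?fmorph_eq0 //.
    exact: transcendental_neq0 trt.
  rewrite -horner_coef0 horner_prod; apply/prodf_neq0 => j ji.
  have ck0 : ck =1 horner_eval 0 \o (polyC \o ck) by move=> a; rewrite /= /horner_eval hornerC.
  rewrite horner_csub fk_tA -[X in X != 0]/(horner_eval 0 (ev2 _ _ _ _)) -(ev2_map _ _ _ ck0).
  rewrite -[ev2 ck _ _ _]/(ev2 ck (tA%:P).[0] (xA%:P + tA%:P * 'X).[0] (Gam j)).
  rewrite hornerD hornerM !hornerC hornerX mulr0 addr0.
  by rewrite evA !fmorph_eq0; apply: G_other.
(* x2 specialises to t1, and (t1, x1) lies on the i-th curve only. *)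
have x2_root : (csub cA (Gam i) f).[x2] = 0.
  have : root (\prod_j csub cA (Gam j) f) x2 by rewrite -rsAP.
  rewrite /root horner_prod prodf_seq_eq0 => /hasP[j _ /andP[_ rj]].
  have := x2_spec (valk j); rewrite /root valE => /(_ rj).
  have [<- _|ji] := eqVneq j i; first exact/eqP.
  by rewrite phi_val horner_csub f0_tA evA !fmorph_eq0 (negPf (G_other j ji)).
have y2_root : (csub cA (Gam i) f).[y2] = 0.
  rewrite -tau_x -{1}(_ : map_poly tau (csub cA (Gam i) f) = csub cA (Gam i) f); last first.
    rewrite -valE -map_poly_comp; apply: eq_map_poly => a; exact: GA_fix.
  by rewrite horner_map x2_root rmorph0.
have [x xr Dx] := rho_surj i x2 x2_root; have [y yr Dy] := rho_surj i y2 y2_root.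
have [g0 g0G Dg0] := rho_gal fixG tau tauG; exists g0, x, y; split=> //.
  by apply: contraNneq xy2 => xy; rewrite Dx Dy xy.
have g_rs j z : z \in rs j -> g0 z \in rs j by apply: rs_stable.
split=> [||j z zr zx zy].
- by apply: (rho_inj i); rewrite ?g_rs // -(Dg0 i) // -Dx tau_x.
- by apply: (rho_inj i); rewrite ?g_rs // -(Dg0 i) // -Dy tau_y.
apply: (rho_inj j); rewrite ?g_rs // -(Dg0 j) // tau_fix //.
- by rewrite rsAP /root horner_prod (bigD1 j) //= rho_root // mul0r.
- apply: contra_neq zx => rzx; move: zr (rho_root j z zr); rewrite rzx => zr /(disj _ _ _ x2_root) ij.
  by subst j; apply: (rho_inj i) => //; rewrite rzx.
- apply: contra_neq zy => rzy; move: zr (rho_root j z zr); rewrite rzy => zr /(disj _ _ _ y2_root) ij.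
  by subst j; apply: (rho_inj i) => //; rewrite rzy.
Qed.

(** * All permutations from one transposition *)

Definition transposition_in (x y : L) := exists g : gal_of {:L}, [/\ g \in G, g x = y, g y = x &
  forall j z, z \in rs j -> z != x -> z != y -> g z = z].

Lemma transposition_conj i x y (h : gal_of {:L}) : h \in G -> x \in rs i ->
  transposition_in x y -> transposition_in (h x) (h y).
Proof.
move=> hG xr [g [gG gx gy g_fix]]; exists (h^-1 * g * h)%g.
have hgE z : (h^-1 * g * h)%g z = h (g ((h^-1)%g z)) by rewrite !galM ?memvf.
have hV z : (h^-1)%g (h z) = z by rewrite -galM ?memvf // mulgV gal_id.
have Vh z : h ((h^-1)%g z) = z by rewrite -galM ?memvf // mulVg gal_id.
split; rewrite ?groupM ?groupV // ?hgE ?hV ?gx ?gy //.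
move=> j z zr zx zy; rewrite hgE (g_fix j) ?Vh //.
- by apply: rs_stable; rewrite ?groupV.
- by apply: contra_neq zx => <-; rewrite Vh.
- by apply: contra_neq zy => <-; rewrite Vh.
Qed.

(** The stabiliser is known to be transitive only at one root z1. So the known transposition is
    first moved to z1, then its second root is adjusted while z1 is held, and the pair is carried
    back to x and y. *)
Lemma all_transpositions i x y : fixed_in_frac G e -> x \in rs i -> y \in rs i -> x != y ->
  transposition_in x y.
Proof.
move=> fixG xr yr xy; have [_ _ trans cycle] := branch_cycle i.
have [z1 z1r stab] := stab_transitive i fixG.
have [g [x0 [y0 [gG x0r y0r xy0 [gx gy g_fix]]]]] := cycle fixG.
have [h1 h1G h1x] := trans fixG i x0 z1 x0r z1r.
have [h2 h2G h2x] := trans fixG i x z1 xr z1r.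
have h_inj (h : gal_of {:L}) : injective h by apply: fmorph_inj.
have [||h3 h3G [h3z h3y]] := stab (h1 y0) (h2 y) (rs_stable h1G y0r) (rs_stable h2G yr).
- by rewrite -h1x (inj_eq (h_inj h1)) eq_sym.
- by rewrite -h2x (inj_eq (h_inj h2)) eq_sym.
have T0 : transposition_in x0 y0 by exists g.
have := transposition_conj h3G (rs_stable h1G x0r) (transposition_conj h1G x0r T0).
rewrite h1x h3z h3y => /(transposition_conj (h := (h2^-1)%g)).
rewrite -h2x groupV => /(_ i h2G (rs_stable h2G xr)).
by rewrite -!galM ?memvf // mulgV !gal_id.
Qed.

(** Induction on the number of moved roots: following pi by the transposition of x and pi x fixes x
    and disturbs no fixed root. *)
Lemma permutation_realised (pi : L -> L) : fixed_in_frac G e ->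
  (forall i x, x \in rs i -> pi x \in rs i) ->
  (forall i, {in rs i &, injective pi}) ->
  exists2 g, g \in G & forall i x, x \in rs i -> g x = pi x.
Proof.
move=> fixG; pose s := flatten [seq rs i | i : I].
have rs_s i x : x \in rs i -> x \in s by move=> xi; apply/flatten_mapP; exists i; rewrite ?mem_enum.
have [k] := ubnP (count [pred x | pi x != x] s); elim: k pi => // k IH pi ltk pi_rs pi_inj.
have [/hasP[x /flatten_mapP[i _ xi] /= pix] | nomove] := boolP (has [pred x | pi x != x] s); last first.
  exists 1%g => // i x /rs_s xs; rewrite gal_id; apply/esym/eqP.
  by have /hasPn/(_ x xs) := nomove; rewrite /= negbK.
have [|g0 [g0G g0x g0y g0_fix]] := all_transpositions fixG xi (pi_rs i x xi); first by rewrite eq_sym.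
have [||| g' g'G Dg'] := IH (g0 \o pi).
- rewrite -ltnS; apply: leq_trans ltk; rewrite ltnS /=.
  have sub : subpred [pred z | (z \in s) && (g0 (pi z) != z)] [pred z | (pi z != z) && (z != x)].
    move=> z /andP[/flatten_mapP[j _ zj]] /=; have [-> | zx] := eqVneq z x; first by rewrite g0y eqxx.
    rewrite andbT; apply: contraNneq => piz; rewrite piz; apply/eqP/(g0_fix j) => //.
    apply: contraNneq zx => zpi; have ij : i = j.
      by have [_ disj _ _] := branch_cycle i; apply: (disj i j z) => //; rewrite zpi pi_rs.
    by apply/eqP/(pi_inj i) => //; rewrite ?ij // piz zpi.
  have -> : count [pred z | g0 (pi z) != z] s = count [pred z | (z \in s) && (g0 (pi z) != z)] s.
    by apply: eq_in_count => z zs; rewrite /= zs.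
  apply: leq_ltn_trans (sub_count sub s) _.
  exact: (count_neq_lt (P := [pred z | pi z != z])) (rs_s i x xi) pix.
- by move=> j z zj; apply: rs_stable => //; apply: pi_rs.
- by move=> j z w zj wj /fmorph_inj; apply: (pi_inj j).
exists (g' * g0^-1)%g; first by rewrite groupM ?groupV.
by move=> j z zj; rewrite galM ?memvf // (Dg' j) //= -galM ?memvf // mulgV gal_id.
Qed.

End Core.

(** * Descent of constants *)

Section Evaluation.
Variables (R : idomainType) (T : comNzRingType).

Fixpoint meval (h : {rmorphism R -> T}) (v : nat -> T) (k : nat) : {rmorphism mpolyR R k -> T} :=
  match k return {rmorphism mpolyR R k -> T} with
  | 0 => h
  | k'.+1 => horner_eval (v k') \o map_poly (meval h v k')
  end.

Lemma mevalE h v k (p : mpolyR R k.+1) : meval h v k.+1 p = (map_poly (meval h v k) p).[v k].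
Proof. by []. Qed.

Lemma meval_polyC h v k (c : mpolyR R k) : meval h v k.+1 c%:P = meval h v k c.
Proof. by rewrite mevalE map_polyC hornerC. Qed.

Lemma meval_const h v k c : meval h v k (mconst k c) = h c.
Proof. by elim: k => // k IH; rewrite meval_polyC. Qed.

Lemma meval_var h v k j : (j < k)%N -> meval h v k (mvar R k j) = v j.
Proof.
elim: k => // k IH; rewrite ltnS => le_jk /=; have [-> | jk] := eqVneq j k.
  by rewrite /horner_eval map_polyX hornerX.
rewrite -[LHS]/(meval h v k.+1 (mvar R k j)%:P) meval_polyC.
by rewrite IH // ltn_neqAle jk.
Qed.

Lemma mpoly_ext k (s1 s2 : {rmorphism mpolyR R k -> T}) :
  (forall c, s1 (mconst k c) = s2 (mconst k c)) ->
  (forall j, (j < k)%N -> s1 (mvar R k j) = s2 (mvar R k j)) -> s1 =1 s2.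
Proof.
elim: k s1 s2 => [|k IH] s1 s2 eqC eqV; first exact: eqC.
have eqP : s1 \o polyC =1 s2 \o polyC.
  apply: IH => [c|j ltjk]; first exact: eqC.
  by have := eqV j (ltnW ltjk); rewrite /= ltn_eqF.
elim/poly_ind=> [|p c IHp]; first by rewrite !rmorph0.
rewrite !rmorphD !rmorphM IHp; congr (_ * _ + _); last exact: eqP.
by have := eqV k (leqnn _); rewrite /= eqxx.
Qed.

End Evaluation.

Lemma meval_comp (R : idomainType) (T T' : comNzRingType) (h : {rmorphism R -> T})
    (u : {rmorphism T -> T'}) (h' : {rmorphism R -> T'}) v v' k :
  u \o h =1 h' -> (forall j, (j < k)%N -> u (v j) = v' j) -> u \o meval h v k =1 meval h' v' k.
Proof.
move=> Dh Dv; apply: mpoly_ext => [c|j ltjk] /=; first by rewrite !meval_const -Dh.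
by rewrite !meval_var // Dv.
Qed.

(** Renumbering the variables backwards is an involution. It is needed because a_n is adjoined last
    in [ratfun], whereas the geometric argument wants a_0 last. *)
Lemma meval_rev_inj (R : idomainType) (T : comNzRingType) (h : {rmorphism R -> T}) v k :
  injective (meval h v k) -> injective (meval h (fun j => v (k.-1 - j)%N) k).
Proof.
move=> inj_v.
pose rho := meval (@mconst R k) (fun j => mvar R k (k.-1 - j)%N) k.
have lt_rev j : (j < k)%N -> (k.-1 - j < k)%N by case: (k) => // k' _; rewrite ltnS leq_subr.
have rhoK : rho \o rho =1 idfun.
  apply: mpoly_ext => [c|j ltjk] /=; first by rewrite !meval_const.
  rewrite meval_var // meval_var ?lt_rev // subKn //.
  by case: (k) ltjk.
have Drho : meval h v k \o rho =1 meval h (fun j => v (k.-1 - j)%N) k.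
  apply: meval_comp => [c|j ltjk] /=; first by rewrite meval_const.
  by rewrite meval_var ?lt_rev.
move=> a b; rewrite -!Drho => /inj_v Dab.
by rewrite -[a]rhoK -[b]rhoK /= Dab.
Qed.

Lemma fin_algebraic (F : fieldType) (Fm : finFieldType) (T : fieldType)
    (u : {rmorphism F -> T}) (h : {rmorphism Fm -> T}) c : algebraicOver u (h c).
Proof.
exists ('X^#|Fm| - 'X).
  by rewrite -size_poly_eq0 size_polyDl ?size_polyXn ?size_polyN ?size_polyX // ltnS finNzRing_gt1.
rewrite rmorphB rmorphXn /= map_polyX /root !hornerE /= -rmorphXn /= expf_card.
by rewrite subrr.
Qed.

(** The elements of a finite field are algebraic, so a relation for v_k over F_m[v_0, ..., v_(k-1)]
    makes v_k algebraic over the fractions of F_q[v_0, ..., v_(k-1)], against independence over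
    F_q. *)
Lemma meval_inj_finite (Fq : fieldType) (Fm : finFieldType) (T : fieldType)
    (hq : {rmorphism Fq -> T}) (hm : {rmorphism Fm -> T}) v k :
  injective (meval hq v k) -> injective (meval hm v k).
Proof.
elim: k => [|k IH] inj_q; first exact: fmorph_inj.
have inj_qk : injective (meval hq v k).
  by move=> a b Dab; apply/polyC_inj/inj_q; rewrite !meval_polyC.
have inj_m := IH inj_qk; have [u Du] := frac_lift inj_qk.
have alg_m j (c : mpolyR Fm j) : (j <= k)%N -> algebraicOver u (meval hm v j c).
  elim: j c => [|j IHj] c ltjk; first exact: fin_algebraic.
  elim/poly_ind: c => [|p c IHp]; first by rewrite rmorph0; apply: algebraic0.
  rewrite rmorphD rmorphM /=; apply: algebraic_add; last by rewrite -[X in algebraicOver _ X]/(meval hm v j.+1 c%:P) meval_polyC; apply/IHj/ltnW.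
  apply: algebraic_mul => //; rewrite /horner_eval map_polyX hornerX.
  by rewrite -(meval_var hq v ltjk) -Du; apply: algebraic_id.
apply: raddf_inj => p p0; apply/eqP/contraT => nzp.
have : algebraicOver u (v k).
  apply/integral_algebraic/(@integral_root _ _ _ (map_poly (meval hm v k) p)).
  - by rewrite map_poly_eq0_id0 // -(rmorph0 (meval hm v k)) (inj_eq inj_m) lead_coef_eq0.
  - by apply/eqP.
  by move=> _ /(nthP 0)[i _ <-]; apply/integral_algebraic; rewrite coef_map; apply: alg_m.
case=> P nzP rP; have [r nzr [P' DP']] := clear_denominators P.
have P'0 : meval hq v k.+1 P' = 0.
  rewrite mevalE -(eq_map_poly Du) map_poly_comp DP' linearZ /= hornerZ.
  by rewrite (eqP rP) mulr0.
have := inj_q _ _ (etrans P'0 (esym (rmorph0 _))) => P'E.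
move: DP'; rewrite P'E rmorph0 => /esym/eqP; rewrite scaler_eq0 (negPf nzP) tofrac_eq0.
by rewrite (negPf nzr).
Qed.

Fixpoint mmap (R S : idomainType) (phi : {rmorphism R -> S}) (k : nat) : {rmorphism mpolyR R k -> mpolyR S k} :=
  match k return {rmorphism mpolyR R k -> mpolyR S k} with
  | 0 => phi
  | k'.+1 => map_poly (mmap phi k')
  end.

Lemma meval_mmap (R S : idomainType) (T : comNzRingType) (phi : {rmorphism R -> S})
    (h : {rmorphism S -> T}) (h' : {rmorphism R -> T}) v k a :
  h \o phi =1 h' -> meval h v k (mmap phi k a) = meval h' v k a.
Proof.
move=> Dh; elim: k a => [|k IH] p; first exact: Dh.
by rewrite !mevalE /= -map_poly_comp; congr (_.[_]); apply: eq_map_poly => c; apply: IH.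
Qed.

(** Compare both sides at the leading coefficient of b, one variable after another, until w is a
    quotient of two elements of F. *)
Lemma mmap_descent (F : fieldType) (S : idomainType) (phi : {rmorphism F -> S}) k (a b : mpolyR F k) w :
  b != 0 -> mconst k w * mmap phi k b = mmap phi k a -> exists c, w = phi c.
Proof.
elim: k a b => [|k IH] a b nzb Dab.
  exists (a / b); have nzphi: phi b != 0 by rewrite fmorph_eq0.
  apply: (mulIf nzphi); rewrite -rmorphM divfK //; exact: Dab.
apply: (IH a`_(size b).-1 (lead_coef b)); first by rewrite lead_coef_eq0.
have := congr1 (fun p : {poly _} => p`_(size b).-1) Dab.
by rewrite /= coefCM !coef_map.
Qed.

(** Realises E[a_0] inside L with a_0 as outermost variable, so that the geometric results about the
    abstract [generic_f] apply to the given f. *)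
Lemma generic_point_exists (Fm E L : fieldType) (iota : {rmorphism Fm -> L}) (N : nat) (a : nat -> L)
    (fr : fraction_map {poly {poly {poly mpolyR Fm N}}} E) :
  injective (meval iota (fun j => a (N.+3 - j)%N) N.+4) ->
  exists e : {rmorphism {poly E} -> L},
    [/\ injective e, forall c, e (coef_const fr c)%:P = iota c,
        map_poly e (generic_f fr) = \sum_(j < N.+4) a j *: 'X^j,
        forall j, (j < N.+4)%N -> exists s, e s = a j &
        forall g : {rmorphism L -> L}, (forall c, g (iota c) = iota c) ->
          (forall j, (j < N.+4)%N -> g (a j) = a j) -> forall s, g (e s) = e s].
Proof.
set v := (fun j => _) => inj_v.
have [e [inj_e e_frac eC eX]] := frac_poly_lift (x := v N.+3) fr (h := meval iota v N.+3) inj_v.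
have {}eX : e 'X = a 0%N by rewrite eX /v subnn.
have e_emb p : e (coef_emb fr p)%:P = meval iota v N p.
  by rewrite [LHS]eC !meval_polyC.
have e_var (j : nat) : (j < N)%N -> e (coef_emb fr (mvar Fm N j))%:P = a (N.+3 - j)%N.
  by move=> ltj; rewrite e_emb meval_var.
have e3 : e (gcoef3 fr)%:P = a 3%N.
  by rewrite [LHS]eC !meval_polyC mevalE map_polyX hornerX /v -addn3 addKn.
have e2 : e (gcoef2 fr)%:P = a 2%N.
  by rewrite [LHS]eC meval_polyC mevalE map_polyX hornerX /v subSS -addn2 addKn.
have e1E : e (gcoef1 fr)%:P = a 1%N.
  by rewrite [LHS]eC mevalE map_polyX hornerX /v !subSS -addn1 addKn.
exists e; split=> //.
- by move=> c; rewrite e_emb meval_const.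
- rewrite map_gen_poly -(poly_def N.+4 a); apply/polyP => i.
  rewrite (coef_gen_poly (e \o (polyC \o coef_emb fr))) coef_poly.
  case: i => [|[|[|[|i]]]]; rewrite ?nth_nil //=.
  rewrite /high_coefs coef_poly !ltnS; case: ltnP => ltiN; last first.
    by rewrite [LHS]e_emb rmorph0.
  rewrite [LHS]e_var ?ltn_subrL ?(leq_ltn_trans _ ltiN) //.
  by congr (a _); rewrite subnBA // -addn3 -addnA addKn.
- move=> j ltj; exists (map_poly fr (mvar Fm N.+4 (N.+3 - j))).
  rewrite e_frac [LHS](@meval_var _ _ iota v N.+4) ?ltnS ?leq_subr //.
  by rewrite /v subKn.
move=> g g_iota g_a s; have [r nzr [P DP]] := frac_map_clear fr s.
have g_meval p : g (meval iota v N.+4 p) = meval iota v N.+4 p.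
  by apply: (meval_comp (u := g)) => // j _; apply: g_a; rewrite ltnS leq_subr.
have g_r : g (e (fr r)%:P) = e (fr r)%:P by have := g_meval r%:P; rewrite meval_polyC -eC.
have nz_er : e (fr r)%:P != 0.
  by rewrite -[X in _ != X](rmorph0 e) (inj_eq inj_e) polyC_eq0 fr_neq0.
apply: (mulfI nz_er); rewrite -{1}g_r -!rmorphM /= mul_polyC -DP e_frac; exact: g_meval.
Qed.

Lemma meval_range (R : idomainType) (S T : comNzRingType) (e : {rmorphism S -> T})
    (h : {rmorphism R -> T}) v k :
  (forall c, exists s, e s = h c) -> (forall j, (j < k)%N -> exists s, e s = v j) ->
  forall a, exists s, e s = meval h v k a.
Proof.
move=> rC; elim: k => [|k IH] rV; first exact: rC.
elim/poly_ind=> [|p c [sp Dp]]; first by exists 0; rewrite !rmorph0.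
have [sv Dv] := rV k (leqnn _); have [j ltj|sc Dc] := IH _ c; first exact/rV/ltnW.
exists (sp * sv + sc); rewrite !rmorphD !rmorphM Dp Dv Dc meval_polyC; congr (_ * _ + _).
by rewrite mevalE map_polyX hornerX.
Qed.

(** * Base change and automorphisms of the constants *)

Lemma sep_deriv_neq0 (F : fieldType) (p : nat) (P : {poly {poly F}}) :
  p \in [pchar F] -> sep_x p P -> P^`() != 0.
Proof.
move=> hp [[|j] [ndvd nzPj]]; first by rewrite dvdn0 in ndvd.
apply: contraNneq nzPj => dP0; have := congr1 (fun Q : {poly {poly F}} => Q`_j) dP0.
rewrite coef_deriv coef0 -mulr_natr => /eqP; rewrite mulf_eq0.
by rewrite -(dvdn_pcharf (rmorph_pchar polyC hp)) (negPf ndvd) orbF.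
Qed.

Lemma irreducible_coprimep (R : idomainType) (P Q : {poly R}) :
  irreducible_poly P -> ~~ (P %| Q) -> coprimep P Q.
Proof.
move=> [_ irrP]; apply: contraR => ncop.
by rewrite -(eqp_dvdl _ (irrP _ ncop (dvdp_gcdl P Q))) dvdp_gcdr.
Qed.

Lemma irreducible_scale (R : idomainType) (a : R) (P : {poly R}) :
  a != 0 -> irreducible_poly P -> irreducible_poly (a *: P).
Proof.
move=> nza [P_gt1 irrP]; split=> [|q q1 qP]; first by rewrite size_scale.
have aPP := eqp_scale P nza.
by rewrite (eqp_trans (irrP q q1 _)) 1?eqp_sym // -(eqp_dvdr _ aPP).
Qed.

(** Bezout over F gives a nonzero polynomial in t alone, which stays nonzero after base change and
    cannot be a multiple of a monic G of positive x-degree. *)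
Lemma coprime_no_common_factor (F k : fieldType) (phi : {rmorphism F -> k})
    (A B : {poly {poly F}}) (G Q Q' : {poly {poly k}}) :
  coprimep A B -> G \is monic -> (1 < size G)%N ->
  map_poly (map_poly phi) A = Q * G -> map_poly (map_poly phi) B = Q' * G -> False.
Proof.
move=> /Pdiv.Idomain.Bezout_coprimepP[[u v] /= uv1] monG G_gt1 DA DB.
have [c nzc Dc] : exists2 c : {poly F}, c != 0 & u * A + v * B = c%:P.
  have := eqp_size uv1; rewrite size_poly1 => /eqP/size_poly1P[c nzc ->]; by exists c.
have := congr1 (map_poly (map_poly phi)) Dc.
rewrite rmorphD !rmorphM /= DA DB map_polyC /= !mulrA -mulrDl => DG.
have nzc' : map_poly phi c != 0 by rewrite map_poly_eq0.
have nzL : map_poly (map_poly phi) u * Q + map_poly (map_poly phi) v * Q' != 0.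
  by apply: contraNneq nzc' => L0; rewrite -polyC_eq0 -DG L0 mul0r.
have := congr1 (fun P : {poly {poly k}} => size P) DG.
rewrite /= size_polyC nzc' size_Mmonic // => /eqP.
move: nzL G_gt1; rewrite -size_poly_gt0; move: (size (polyseq _)) (size G).
by move=> [|s] [|[|g]] // _ _; rewrite addSn !addnS.
Qed.

Lemma lead_unit (k : fieldType) (I : finType) (G : I -> {poly {poly k}}) :
  \prod_i G i \is monic -> forall i, exists2 c, c != 0 & lead_coef (G i) = c%:P.
Proof.
move=> /monicP; rewrite lead_coef_prod => lead1 i.
have := lead1; rewrite (bigD1 i) //= => D1.
have u1 : lead_coef (G i) \is a GRing.unit by apply/unitrPr; exists (\prod_(j | j != i) lead_coef (G j)).
by move: u1; rewrite poly_unitE => /andP[/size_poly1P[c nzc ->] _]; exists c.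
Qed.

(** A generator of the multiplicative group reduces statements about automorphisms of the constants
    to a single element. *)
Lemma finite_generator (Fm : finFieldType) :
  exists z : Fm, forall w, w != 0 -> exists j, w = z ^+ j.
Proof.
have /cyclicP[z Dz] := field_unit_group_cyclic [set: {unit Fm}]%G.
exists (val z) => w nzw.
have : FinRing.unit Fm (etrans (unitfE w) nzw) \in <[z]>%g by rewrite -Dz inE.
by case/cycleP=> j Dj; exists j; rewrite -FinRing.val_unitX -Dj.
Qed.

Lemma fixed_by_frobenius (Fm : finFieldType) (L : fieldType) (iota : {rmorphism Fm -> L}) (x : L) :
  x ^+ #|Fm| = x -> exists w, x = iota w.
Proof.
move=> fx; have := finField_genPoly Fm => /(congr1 (map_poly iota)).
rewrite rmorphB rmorphXn /= map_polyX rmorph_prod /= => /(congr1 (horner^~ x)) /eqP.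
rewrite !hornerE fx subrr eq_sym horner_prod prodf_seq_eq0 => /hasP[w _ /andP[_]].
by rewrite rmorphB /= map_polyX map_polyC hornerXsubC subr_eq0 => /eqP; exists w.
Qed.

Lemma morphism_factor (Fm L : fieldType) (iota tau : {rmorphism Fm -> L}) :
  (forall w, exists w', iota w' = tau w) -> exists s : {rmorphism Fm -> Fm}, forall w, iota (s w) = tau w.
Proof.
move=> im; have ex w : exists w', iota w' == tau w by have [w' <-] := im w; exists w'.
pose f w := xchoose (ex w); have fE w : iota (f w) = tau w by apply/eqP/(xchooseP (ex w)).
have fB : zmod_morphism f.
  by move=> x y; apply: (fmorph_inj iota); rewrite rmorphB !fE rmorphB.
have fM : monoid_morphism f.
  split=> [|x y]; apply: (fmorph_inj iota); first by rewrite fE !rmorph1.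
  by rewrite rmorphM !fE rmorphM.
pose HA := GRing.isZmodMorphism.Build _ _ f fB.
pose HM := GRing.isMonoidMorphism.Build _ _ f fM.
pose g : {rmorphism Fm -> Fm} := HB.pack f HA HM.
by exists g => w; apply: fE.
Qed.

(* The minimal polynomial of iota z over K is the image of a polynomial over F_q, which sigma fixes. *)
Lemma lift_automorphism (K : fieldType) (L : splittingFieldType K) (Fq Fm : finFieldType)
    (phi : {rmorphism Fq -> Fm}) (iota : {rmorphism Fm -> L}) (s : {rmorphism Fm -> Fm}) :
  galois 1 {:L} -> (forall w, iota w \in 1%VS -> exists c, w = phi c) ->
  (forall c, s (phi c) = phi c) ->
  exists2 g : gal_of {:L}, g \in ('Gal({:L} / 1))%g & forall w, g (iota w) = iota (s w).
Proof.
move=> gal1 descent s_phi; have [z gen_z] := finite_generator Fm.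
suff [g gG gz] : exists2 g : gal_of {:L}, g \in ('Gal({:L} / 1))%g & g (iota z) = iota (s z).
  exists g => // w; have [-> | /gen_z[j ->]] := eqVneq w 0; first by rewrite !rmorph0.
  by rewrite !rmorphXn /= gz.
have [r Dr] : exists r : gal_of {:L} -> Fm, forall g, iota (r g) = g (iota z).
  apply: (@fin_all_exists (gal_of {:L}) (fun=> Fm) (fun g w => iota w = g (iota z))) => g.
  have [|w ->] := @fixed_by_frobenius Fm L iota (g (iota z)); last by exists w.
  by rewrite -!rmorphXn /= expf_card.
pose Psi := \prod_(g in 'Gal({:L} / 1)%g) ('X - (r g)%:P).
have Psi_phi i : exists c, Psi`_i = phi c.
  apply: descent; rewrite -(galois_fixedField gal1); apply/fixedFieldP; rewrite ?memvf // => h hG.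
  suff hPsi : map_poly h (map_poly iota Psi) = map_poly iota Psi by rewrite -coef_map -{2}hPsi [RHS]coef_map.
  rewrite !rmorph_prod /= [RHS](reindex_inj (mulIg h)) /=; apply: eq_big => [g | g gG].
    by rewrite groupMr.
  by rewrite !rmorphB /= !map_polyX !map_polyC /= !Dr galM ?memvf.
have root_sz : root Psi (s z).
  rewrite -[s z]/(s z) (_ : Psi = map_poly s Psi).
    have r1 : r 1%g = z by apply: (fmorph_inj iota); rewrite Dr gal_id.
    by rewrite fmorph_root /Psi (bigD1 1%g) ?group1 //= rootM root_XsubC r1 eqxx.
  by apply/polyP=> i; rewrite coef_map; have [c ->] := Psi_phi i; rewrite /= s_phi.
move: root_sz; rewrite /root horner_prod prodf_seq_eq0 => /hasP[g _ /andP[gG]].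
by rewrite hornerXsubC subr_eq0 => /eqP sz; exists g => //; rewrite sz Dr.
Qed.

(** By Galois theory the fixed elements are polynomials in z over K, and both K and z lie in the
    fraction field of the image of e. *)
Lemma fixed_in_frac_adjoin (K E : fieldType) (L : splittingFieldType K) (e : {rmorphism {poly E} -> L}) (z : L) :
  galois 1 {:L} -> injective e ->
  (forall c : K, exists u v, e v != 0 /\ in_alg L c * e v = e u) -> (exists s, e s = z) ->
  fixed_in_frac 'Gal({:L} / <<1; z>>)%G e.
Proof.
move=> gal1 inj_e frac_K [s Ds] x fx.
have gal_z : galois <<1; z>> {:L}.
  by apply: (galoisS _ gal1); rewrite sub1v subvf.
have: x \in <<1; z>>%VS by rewrite -(galois_fixedField gal_z); apply/fixedFieldP; rewrite ?memvf.
have [e' De'] := frac_lift inj_e.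
case/Fadjoin_polyP => p /polyOver1P[q ->] ->.
have [y <-] : exists y, e' y = (map_poly (in_alg L) q).[z].
  elim/poly_ind: q => [|q c [y Dy]]; first by exists 0; rewrite !rmorph0 horner0.
  have [u [v [nzv Dc]]] := frac_K c.
  exists (y * tofrac s + tofrac u / tofrac v).
  have -> : map_poly (in_alg L) (q * 'X + c%:P) = map_poly (in_alg L) q * 'X + (in_alg L c)%:P.
    by rewrite rmorphD rmorphM /= map_polyX map_polyC.
  rewrite hornerMXaddC -Dy -Ds rmorphD !rmorphM fmorphV !De'.
  by congr (_ + _); apply: (mulIf nzv); rewrite divfK.
have [nzd Dy] := frac_split y; exists (generic_quotient.repr y); rewrite -!De'.
  by rewrite fmorph_eq0.
by rewrite -rmorphM Dy.
Qed.

Lemma uniq_flatten_disjoint (T : eqType) (I : eqType) (r : I -> seq T) (s : seq I) :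
  (forall i, uniq (r i)) -> (forall i j z, z \in r i -> z \in r j -> i = j) -> uniq s ->
  uniq (flatten (map r s)).
Proof.
move=> ur disj; elim: s => //= i s IH /andP[si us]; rewrite cat_uniq ur IH // andbT /=.
apply/hasPn => z /flatten_mapP[j js zj]; apply: contra si => zi.
by rewrite (disj i j z).
Qed.

(** * The Galois group over F_q(a) *)

Section Assembly.
Variables (Fq : finFieldType) (p : nat) (hp : p \in [pchar Fq]).
Variables (m : nat) (F : 'I_m -> {poly {poly Fq}}).
Hypotheses (F_monic : forall i, F i \is monic) (F_irr : forall i, irreducible_poly (F i)).
Hypotheses (F_sep : forall i, sep_x p (F i)).
Hypothesis F_nonassoc : forall i i', i != i' -> ~~ (F i %= F i').
Variables (Fm : finFieldType) (phi : {rmorphism Fq -> Fm}).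
Variables (mu : 'I_m -> nat) (Gam : forall i : 'I_m, 'I_(mu i) -> {poly {poly Fm}}).
Hypothesis Gam_fact : forall i, map_poly (map_poly phi) (F i) = \prod_(j < mu i) Gam j.
Hypothesis Gam_irr : forall i (j : 'I_(mu i)), abs_irreducible (Gam j).
Local Notation I := {i : 'I_m & 'I_(mu i)}.

Definition lead_const (P : {poly {poly Fm}}) : Fm := (lead_coef P)`_0.
Definition nGam (x : I) : {poly {poly Fm}} :=
  (lead_const (Gam (tagged x)))^-1%:P *: Gam (tagged x).

Lemma lead_Gam (x : I) : lead_const (Gam (tagged x)) != 0 /\
  lead_coef (Gam (tagged x)) = (lead_const (Gam (tagged x)))%:P.
Proof.
have mon : \prod_(j < mu (tag x)) Gam j \is monic by rewrite -Gam_fact monic_map.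
by have [c nzc Dc] := lead_unit mon (tagged x); rewrite /lead_const Dc coefC.
Qed.

Lemma nGam_monic x : nGam x \is monic.
Proof.
have [nzc Dc] := lead_Gam x.
by apply/monicP; rewrite /nGam lead_coefZ Dc -polyCM mulVf.
Qed.

Lemma Gam_nGam x : Gam (tagged x) = (lead_const (Gam (tagged x)))%:P *: nGam x.
Proof. by have [nzc _] := lead_Gam x; rewrite /nGam scalerA -polyCM divff // polyC1 scale1r. Qed.

Lemma nGam_irr x : abs_irreducible (nGam x).
Proof.
move=> E e; rewrite /nGam map_polyZ /= map_polyC /=; apply: irreducible_scale (Gam_irr _ e).
by rewrite polyC_eq0 fmorph_eq0 invr_eq0; have [] := lead_Gam x.
Qed.

Lemma nGam_gt1 x : (1 < size (nGam x))%N.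
Proof.
have [] := nGam_irr x (GRing.RMorphism.clone _ _ (@idfun Fm) _).
by rewrite size_map_inj_poly ?rmorph0 //; apply: map_inj_poly; rewrite ?rmorph0.
Qed.

Lemma nGam_dvd x : exists Q, map_poly (map_poly phi) (F (tag x)) = Q * nGam x.
Proof.
rewrite Gam_fact (bigD1 (tagged x)) //= {1}Gam_nGam -scalerAl scalerAr mulrC.
by eexists.
Qed.

Lemma F_coprime_deriv i : coprimep (F i) (F i)^`().
Proof.
apply: irreducible_coprimep (F_irr i) _; apply/negP => /dvdp_leq.
by rewrite (sep_deriv_neq0 hp (F_sep i)) leqNgt lt_size_deriv ?monic_neq0 // => /(_ isT).
Qed.

Lemma F_coprime i i' : i != i' -> coprimep (F i) (F i').
Proof.
move=> ii'; apply: irreducible_coprimep (F_irr i) _; apply: contra (F_nonassoc ii').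
by have [_ irr'] := F_irr i'; apply: irr'; have [] := F_irr i; case: (size _) => [|[]].
Qed.

Lemma nGam_sep x : (nGam x)^`() != 0.
Proof.
apply/eqP => dG; have [Q DQ] := nGam_dvd x.
apply: (coprime_no_common_factor (F_coprime_deriv (tag x)) (nGam_monic x) (nGam_gt1 x) DQ (Q' := Q^`())).
by rewrite -deriv_map DQ derivM dG mulr0 addr0.
Qed.

(** Equal factors of different F_i would contradict their coprimality; equal factors of the same F_i
    give a square dividing F_i, against the coprimality of F_i with its derivative. *)
Lemma nGam_inj : injective nGam.
Proof.
move=> x y Dxy; have [Qx DQx] := nGam_dvd x; have [Qy DQy] := nGam_dvd y.
have [txy | txy] := eqVneq (tag x) (tag y); last first.
  rewrite -Dxy in DQy.
  by case: (coprime_no_common_factor (F_coprime txy) (nGam_monic x) (nGam_gt1 x) DQx DQy).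
apply/eqP/contraT => nxy; exfalso.
suff [Q DQ] : exists Q, map_poly (map_poly phi) (F (tag x)) = Q * nGam x * nGam x.
  apply: (coprime_no_common_factor (F_coprime_deriv (tag x)) (nGam_monic x) (nGam_gt1 x) DQx
    (Q' := Q^`() * nGam x + Q * (nGam x)^`() + Q * (nGam x)^`())).
  by rewrite -deriv_map DQ !derivM !mulrDl; congr (_ + _); rewrite mulrAC.
case: x y txy Dxy nxy {Qx Qy DQx DQy} => i j [i' j'] /= ii'; rewrite -{}ii' in j' * => Dxy nxy.
have jj' : j' != j by apply: contraNneq nxy => ->.
rewrite Gam_fact (bigD1 j) // (bigD1 j') //=.
rewrite (Gam_nGam (Tagged _ j)) (Gam_nGam (Tagged (fun i => 'I_(mu i)) j')) -Dxy.
set a := _%:P; set b := _%:P; set R := \prod_(_ < _ | _) _; set G := nGam _.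
exists (a%:P * b%:P * R); rewrite -!mul_polyC.
by move: a%:P b%:P R G => A B R G; ring.
Qed.

Variables (K : fieldType) (hq : {rmorphism Fq -> K}) (N : nat) (av : nat -> K).
Hypothesis av_inj : injective (meval hq av N.+4).
Hypothesis av_frac : forall x : K, exists a b,
  meval hq av N.+4 b != 0 /\ x * meval hq av N.+4 b = meval hq av N.+4 a.
Local Notation f := (\sum_(j < N.+4) av j *: 'X^j : {poly K}).
Variable L : splittingFieldType K.
Hypothesis L_split :
  splittingFieldFor 1%VS (map_poly (in_alg L) (\prod_i csub hq (F i) f)) {:L}.
Variable iota : {rmorphism Fm -> L}.
Hypothesis iota_phi : forall c, iota (phi c) = in_alg L (hq c).
Local Notation fL := (map_poly (in_alg L) f).
Local Notation all_roots rs := (flatten [seq rs x | x : I]).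

Lemma csubZ (k T : comNzRingType) (h : {rmorphism k -> T}) c P g :
  csub h (c%:P *: P) g = h c *: csub h P g.
Proof. by rewrite /csub map_polyZ /= map_polyC hornerZ mul_polyC. Qed.

Lemma map_product : map_poly (in_alg L) (\prod_i csub hq (F i) f) =
  (\prod_(x : I) iota (lead_const (Gam (tagged x)))) *: \prod_(x : I) csub iota (nGam x) fL.
Proof.
rewrite rmorph_prod /=.
have DF i : map_poly (in_alg L) (csub hq (F i) f) = \prod_(j < mu i) csub iota (Gam j) fL.
  rewrite (map_csub (g := in_alg L \o hq)) // -(csub_comp (c := phi) (h := iota)) => [|c]; last first.
    by rewrite /= iota_phi.
  by rewrite Gam_fact /csub rmorph_prod horner_prod.
rewrite (eq_bigr _ (fun i _ => DF i)) sig_big_dep /=.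
rewrite -mul_polyC rmorph_prod -big_split /=; apply: eq_bigr => x _.
by rewrite mul_polyC -csubZ -Gam_nGam.
Qed.

Lemma lead_product_neq0 : \prod_(x : I) iota (lead_const (Gam (tagged x))) != 0.
Proof. by apply/prodf_neq0 => x _; rewrite fmorph_eq0; have [] := lead_Gam x. Qed.

Lemma values_split : exists rs : I -> seq L,
  [/\ forall x, exists2 c, c != 0 & csub iota (nGam x) fL = c *: \prod_(z <- rs x) ('X - z%:P),
      <<1 & all_roots rs>>%VS = fullv & \prod_(z <- all_roots rs) ('X - z%:P) \is a polyOver 1%VS].
Proof.
have [rs0 Drs0 gen_rs0] := L_split.
have nzc := lead_product_neq0; rewrite map_product in Drs0.
set P := \prod_(x : I) csub _ _ _ in Drs0; set c0 := \prod_(x : I) _ in nzc Drs0.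
have P_eqp : P %= \prod_(z <- rs0) ('X - z%:P) by rewrite -(eqp_ltrans (eqp_scale P nzc)).
have nzP : P != 0 by rewrite -size_poly_eq0 (eqp_size P_eqp) size_poly_eq0 monic_neq0 ?monic_prod_XsubC.
have DP : P = lead_coef P *: \prod_(z <- rs0) ('X - z%:P).
  by have := eqp_eq P_eqp; rewrite (monicP (monic_prod_XsubC _ _ _)) scale1r.
have [|rs Drs] := split_factor _ DP; first by rewrite lead_coef_eq0.
have {}Drs x : exists2 c, c != 0 & csub iota (nGam x) fL = c *: \prod_(z <- rs x) ('X - z%:P).
  have [c Dc] := Drs x; exists c => //; apply: contraNneq nzP => c0E.
  by rewrite /P (bigD1 x) //= Dc c0E scale0r mul0r.
have [c nzcc] : exists2 c, c != 0 & P = c *: \prod_(z <- all_roots rs) ('X - z%:P).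
  have [c Dc] : exists c : I -> L, forall x, c x != 0 /\
      csub iota (nGam x) fL = c x *: \prod_(z <- rs x) ('X - z%:P).
    by apply: (@fin_all_exists _ (fun=> L) (fun x a => a != 0 /\ csub iota (nGam x) fL = a *: \prod_(z <- rs x) ('X - z%:P))) => x; have [c] := Drs x; exists c.
  exists (\prod_x c x); first by apply/prodf_neq0 => x _; have [] := Dc x.
  rewrite big_flatten big_map big_enum /= -mul_polyC rmorph_prod -big_split /=.
  by apply: eq_bigr => x _; rewrite mul_polyC; have [] := Dc x.
move=> DP'; exists rs; split=> //.
  apply/eqP; rewrite eqEsubv subvf -gen_rs0 adjoin_seqSr // => z.
  rewrite -!root_prod_XsubC -(eqp_root P_eqp) DP' rootZ //.
pose q := \prod_i csub hq (F i) f.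
have Dq : map_poly (in_alg L) q = _ := map_product; rewrite -/P DP' scalerA in Dq.
have lead_q : in_alg L (lead_coef q) = c0 * c.
  by rewrite -lead_coef_map Dq lead_coefZ (monicP (monic_prod_XsubC _ _ _)) mulr1.
apply/polyOver1P; exists ((lead_coef q)^-1 *: q).
have lead_inv : in_alg L (lead_coef q)^-1 = (c0 * c)^-1 by rewrite -lead_q; apply: fmorphV.
by rewrite map_polyZ Dq [X in X *: _]lead_inv scalerA mulVf ?scale1r // mulf_neq0.
Qed.

(** F_q is algebraically closed in F_q(a): if w = a / b with a and b over F_q, then w b = a holds
    already between polynomials over F_m, the variables being independent over F_m too. *)
Lemma const_descent w : iota w \in 1%VS -> exists c, w = phi c.
Proof.
case/vlineP=> x Dx; have [a [b [nzb Dab]]] := av_frac x.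
pose va j := in_alg L (av j).
have alg_meval c : in_alg L (meval hq av N.+4 c) = meval iota va N.+4 (mmap phi N.+4 c).
  rewrite (meval_mmap (h' := in_alg L \o hq)) => [|d]; last by rewrite /= iota_phi.
  exact: (meval_comp (u := in_alg L)).
have inj_q : injective (meval (in_alg L \o hq) va N.+4).
  move=> c d; rewrite -!(meval_comp (u := in_alg L) (h := hq) (v := av)) //.
  by move=> /fmorph_inj/av_inj.
have inj_m := meval_inj_finite (hm := iota) inj_q.
apply: (@mmap_descent _ _ phi N.+4 a b w).
  by apply: contraNneq nzb => ->; rewrite rmorph0.
apply: inj_m; rewrite rmorphM meval_const -!alg_meval Dx -Dab.
by rewrite [RHS](rmorphM (in_alg L)).
Qed.

Lemma geometric_part : exists2 rs : I -> seq L,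
  forall x, exists2 c, c != 0 & csub iota (nGam x) fL = c *: \prod_(z <- rs x) ('X - z%:P) &
  galois 1 {:L} /\ forall pi : L -> L,
    (forall x z, z \in rs x -> pi z \in rs x) -> (forall x, {in rs x &, injective pi}) ->
    exists2 g : gal_of {:L}, g \in ('Gal({:L} / 1))%g /\ (forall w, g (iota w) = iota w) &
      forall x z, z \in rs x -> g z = pi z.
Proof.
have [rs [Drs gen_rs over_rs]] := values_split; exists rs => //.
have [E [fr]] : exists E, inhabited (fraction_map {poly {poly {poly mpolyR Fm N}}} E).
  by exists {fraction {poly {poly {poly mpolyR Fm N}}}}; split; apply: tofrac_map.
pose va j := in_alg L (av j).
have inj_q : injective (meval (in_alg L \o hq) va N.+4).
  move=> c d; rewrite -!(meval_comp (u := in_alg L) (h := hq) (v := av)) //.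
  by move=> /fmorph_inj/av_inj.
have inj_m : injective (meval iota (fun j => va (N.+3 - j)%N) N.+4).
  exact: (meval_rev_inj (meval_inj_finite (hm := iota) inj_q)).
have [e [inj_e e_const e_f e_var e_fix]] := generic_point_exists fr inj_m.
have {}e_f : map_poly e (generic_f fr) = fL.
  rewrite e_f rmorph_sum; apply: eq_bigr => j _.
  by rewrite /= map_polyZ map_polyXn.
have [z gen_z] := finite_generator Fm.
pose G := ('Gal({:L} / <<1; iota z>>))%G.
have G1 g : g \in G -> g \in ('Gal({:L} / 1))%g by apply/subsetP/galS; exact: subv_adjoin.
have G_iota (g : gal_of {:L}) w : g \in G -> g (iota w) = iota w.
  move=> gG; have [-> | /gen_z[j ->]] := eqVneq w 0; first by rewrite !rmorph0.
  by rewrite !rmorphXn /= (fixed_gal (subvf _) gG) ?memv_adjoin.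
have Gfix (g : gal_of {:L}) a : g \in G -> g (e a) = e a.
  move=> gG; apply: (e_fix g) => [w | j _]; first exact: G_iota.
  by apply: (fixed_gal (sub1v _) (G1 _ gG)); rewrite rpredZ ?rpred1.
have rsE x : map_poly e (generic_val nGam (coef_emb fr) (gcoef1 fr) (gcoef2 fr) (gcoef3 fr) x) =
    e (lead_coef (generic_val nGam (coef_emb fr) (gcoef1 fr) (gcoef2 fr) (gcoef3 fr) x)) *:
      \prod_(y <- rs x) ('X - y%:P).
  set P := generic_val _ _ _ _ _ _.
  have DP : map_poly e P = csub iota (nGam x) fL.
    by rewrite -e_f; apply: map_csub => c; rewrite [RHS]e_const.
  rewrite -lead_coef_map_inj ?rmorph0 // DP.
  by have [c nzc ->] := Drs x; rewrite lead_coefZ (monicP (monic_prod_XsubC _ _ _)) mulr1.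
have cycle := branch_cycle nGam_monic nGam_irr nGam_sep nGam_inj
  (coef_top_transcendental (fr := fr)) (coef_field_lift fr) (coef_field_ext (fr := fr)) inj_e rsE Gfix.
have realised := permutation_realised nGam_monic nGam_irr nGam_sep nGam_inj
  (coef_top_transcendental (fr := fr)) (coef_field_lift fr) (coef_field_ext (fr := fr)) inj_e rsE Gfix.
(* The parts of [branch_cycle] free of the fixed field condition show that the roots are distinct.
   Hence L is Galois, and the condition itself can be proved next. *)
have gal1 : galois 1 {:L}.
  apply: galois_of_uniq_roots gen_rs over_rs _.
  apply: uniq_flatten_disjoint (enum_uniq _) => [x|x y w]; first by have [] := cycle x.
  by have [_ disj _ _] := cycle x; apply: disj.
split=> // pi pi_rs pi_inj; have [|g gG Dg] := realised pi _ pi_rs pi_inj; last first.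
  by exists g => //; split=> [|w]; [apply: G1 | apply: G_iota].
apply: fixed_in_frac_adjoin => // [c|]; last by exists (coef_const fr z)%:P.
have [a [b [nzb Dc]]] := av_frac c.
have range d : exists s, e s = in_alg L (meval hq av N.+4 d).
  have [|//|s Ds] := meval_range (e := e) (h := in_alg L \o hq) (v := va) (k := N.+4) _ _ d.
    by move=> k; exists (coef_const fr (phi k))%:P; rewrite e_const iota_phi.
  by exists s; rewrite Ds; apply/esym/(meval_comp (u := in_alg L)).
have [[u Du] [v Dv]] := (range a, range b); exists u, v; rewrite Du Dv -Dc.
by rewrite fmorph_eq0 [RHS](rmorphM (in_alg L)).
Qed.

Local Notation Omega s j x := (root (csub iota (map_poly (map_poly s) (Gam j)) fL) x).

(** g fixes the coefficients of f and acts on the constants as s, so it carries Gamma(t, f) to its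
    conjugate by s. *)
Lemma Omega_gal (g : gal_of {:L}) (s : {rmorphism Fm -> Fm}) i (j : 'I_(mu i)) x :
  g \in ('Gal({:L} / 1))%g -> (forall w, g (iota w) = iota (s w)) -> Omega s j (g x) = Omega id j x.
Proof.
move=> gG Dg; rewrite (csub_comp (g := iota \o s)) //.
have -> : csub (iota \o s) (Gam j) fL = map_poly g (csub iota (Gam j) fL).
  rewrite (map_csub (g := iota \o s)) => [|w]; last by rewrite /= Dg.
  rewrite -map_poly_comp; congr (csub _ _ _); apply: eq_map_poly => a.
  by apply/esym/(fixed_gal (sub1v _) gG); rewrite rpredZ ?rpred1.
by rewrite fmorph_root map_poly_id // => P _; rewrite map_poly_id.
Qed.

Lemma galois_group_permutations (pi : L -> L) (U := fun x => exists i (j : 'I_(mu i)), Omega id j x) :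
  (forall x y, U x -> U y -> pi x = pi y -> x = y) ->
  (exists2 g : gal_of {:L}, g \in ('Gal({:L} / 1))%g & forall x, U x -> g x = pi x)
  <->
  (exists s : {rmorphism Fm -> Fm}, (forall c, s (phi c) = phi c) /\
     forall i (j : 'I_(mu i)), maps_onto pi (fun x => Omega id j x) (fun x => Omega s j x)).
Proof.
move=> pi_inj; split=> [[g gG Dg] | [s [s_phi s_pi]]].
  have [|s Ds] := @morphism_factor Fm L iota (g \o iota).
    move=> w; have [|w' Dw'] := @fixed_by_frobenius Fm L iota (g (iota w)); last by exists w'; rewrite /= Dw'.
    by rewrite -!rmorphXn /= expf_card.
  have {}Ds w : g (iota w) = iota (s w) by rewrite Ds.
  exists s; split=> [c|i j].
    apply: (fmorph_inj iota); rewrite -Ds iota_phi.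
    by apply: (fixed_gal (sub1v _) gG); rewrite rpredZ ?rpred1.
  split=> [x Ox | y Oy].
    by rewrite -Dg ?(Omega_gal _ _ gG Ds) //; exists i, j.
  have gV : g ((g^-1)%g y) = y by rewrite -galM ?memvf // mulVg gal_id.
  exists ((g^-1)%g y); first by rewrite -(Omega_gal _ _ gG Ds) gV.
  by rewrite -Dg ?gV //; exists i, j; rewrite -(Omega_gal _ _ gG Ds) gV.
have [rs Drs [gal1 realised]] := geometric_part.
have [g0 g0G Dg0] := lift_automorphism gal1 const_descent s_phi.
have rsP (x : I) z : (z \in rs x) = Omega id (tagged x) z.
  have -> : map_poly (map_poly id) (Gam (tagged x)) = Gam (tagged x).
    by rewrite map_poly_id // => P _; rewrite map_poly_id.
  rewrite [in RHS]Gam_nGam csubZ; have [c nzc ->] := Drs x; have [nzl _] := lead_Gam x.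
  by rewrite !rootZ ?fmorph_eq0 // root_prod_XsubC.
have g0V y : g0 ((g0^-1)%g y) = y by rewrite -galM ?memvf // mulVg gal_id.
(* Correcting pi by a lift g0 of s yields a map preserving each Omega separately, which the
   geometric group realises. *)
have [||g1 [g1G _] Dg1] := realised ((g0^-1)%g \o pi).
- move=> x z; rewrite !rsP => Oz; rewrite -(Omega_gal _ _ g0G Dg0) /= g0V.
  by have [+ _] := s_pi _ (tagged x); apply.
- move=> x z z'; rewrite !rsP => Oz Oz' /fmorph_inj.
  by apply: pi_inj; exists (tag x), (tagged x).
exists (g1 * g0)%g; first by rewrite groupM.
move=> x [i [j Ox]]; rewrite galM ?memvf // (Dg1 (Tagged _ j)) ?rsP //=; exact: g0V.
Qed.

End Assembly.

Theorem theorem2p3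
  (Fq : finFieldType) (p : nat) (hp : p \in [pchar Fq])
  (m : nat) (F : 'I_m -> {poly {poly Fq}})
  (hmonic : forall i, F i \is monic)
  (hdeg : forall i, (1 < size (F i))%N)
  (hirr : forall i, irreducible_poly (F i))
  (hsep : forall i, sep_x p (F i))
  (hnonassoc : forall i i', i != i' -> ~~ (F i %= F i'))
  (n : nat) (hn : (3 <= n)%N) (hsl : forall i, sl_le (F i) n)
  (Fm : finFieldType) (phi : {rmorphism Fq -> Fm})
  (mu : 'I_m -> nat) (Gam : forall i : 'I_m, 'I_(mu i) -> {poly {poly Fm}})
  (hfact : forall i, map_poly (map_poly phi) (F i) = \prod_(j < mu i) Gam i j)
  (habs : forall i j, abs_irreducible (Gam i j))
  (L : splittingFieldType (ratfun Fq n))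
  (hL : splittingFieldFor 1%VS
          (map_poly (in_alg L) (\prod_(i < m) subst_f n (F i))) fullv)
  (iota : {rmorphism Fm -> L})
  (hiota : forall c : Fq, iota (phi c) = in_alg L (cK n c)) :
  let Omega (sigma : Fm -> Fm) (i : 'I_m) (j : 'I_(mu i)) (x : L) : Prop :=
    root (subst_fL iota (map_poly (map_poly sigma) (Gam i j))) x in
  let U (x : L) : Prop := exists i : 'I_m, exists j : 'I_(mu i), Omega id i j x in
  forall pi : L -> L,
    (forall x y, U x -> U y -> pi x = pi y -> x = y) ->
    maps_onto pi U U ->
    (exists2 g : gal_of (fullv : {vspace L}), g \in ('Gal(fullv / 1%VS))%g
       & forall x, U x -> g x = pi x)
    <->
    (exists sigma : {rmorphism Fm -> Fm},
       (forall c : Fq, sigma (phi c) = phi c) /\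
       forall (i : 'I_m) (j : 'I_(mu i)), maps_onto pi (Omega id i j) (Omega sigma i j)).
Proof.
case: n hn hsl L hL iota hiota => [|[|[|N]]] // _ _ L hL iota hiota Omega U pi pi_inj pi_onto.
pose k : {rmorphism Fq -> ratfun Fq N.+3} := @FracField.tofrac (mpolyR Fq N.+4) \o @mconst Fq N.+4.
(* Evaluation at the a_j is the embedding of F_q[a] in its fraction field; this gives both
   independence and denominators. *)
have Dk : meval k (avar Fq N.+3) N.+4 =1 @FracField.tofrac (mpolyR Fq N.+4).
  by apply: mpoly_ext => [c|j ltj]; rewrite ?meval_const ?meval_var.
have av_inj : injective (meval k (avar Fq N.+3) N.+4).
  by move=> a b; rewrite !Dk => /eqP; rewrite tofrac_eq => /eqP.
have av_frac x : exists a b, meval k (avar Fq N.+3) N.+4 b != 0 /\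
    x * meval k (avar Fq N.+3) N.+4 b = meval k (avar Fq N.+3) N.+4 a.
  have [nzd Dx] := frac_split x.
  by exists (generic_quotient.repr x).1, (generic_quotient.repr x).2; rewrite !Dk.
exact: (galois_group_permutations hp hmonic hirr hsep hnonassoc hfact habs av_inj av_frac hL hiota pi_inj).
Qed.
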